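(* Let $k$ be an algebraically closed field, let $T=k[x_1,\ldots,x_m]$ be a polynomial ring, and let $f\in T$ be irreducible and monic as a polynomial in $x_m$. Let $S=T/(f)$, let $K^*$ be the quotient field of $S$, let $R=k[x_1,\ldots,x_{m-1}]$, and let $K$ be the quotient field of $R$, so that $K^*$ is a finite extension of $K$. Assume that $K^*$ is separable over $K$. Let $\nu^*$ be a valuation of $K^*$ of rank 1 with $S\subset V_{\nu^*}$ and $V_{\nu^*}/m_{\nu^*}=k$, and let $\nu$ be the restriction of $\nu^*$ to $K$. Suppose that the center of $\nu^*$ on $T$ is $(x_1,\ldots,x_m)$. Suppose that embedded local uniformization holds in dimension $m-1$, that $$r=\mathrm{ord}\, f(0,\ldots,0,x_m)>1,$$ and that the defect $\delta(\nu^*/\nu)=0$. Then there exists a birational extension $T\rightarrow T'=k[x_1',\ldots,x_m']$ along $\nu^*$, where $T'$ is a polynomial ring in $x_1',\ldots,x_m'$, such that $(x_1',\ldots,x_m')$ is the center of $\nu^*$ on $T'$, and such that, if $f'$ is the strict transform of $f$ in $T'$, so that $S'=T'/(f')$ is a birational extension $S\rightarrow S'$ along $\nu^*$, then $$\mathrm{ord}\, f'(0,\ldots,0,x_m')<r.$$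
   Context: **Valuations.** For a valuation $\nu$, $V_\nu$ denotes its valuation ring, $m_\nu$ the maximal ideal of $V_\nu$, and $\Phi_\nu$ its value group. Rank 1 means that $\Phi_\nu$ is nonzero and order isomorphic to a subgroup of $\mathbb{R}$. The equality $V_{\nu^*}/m_{\nu^*}=k$ means that the natural map $k\to V_{\nu^*}/m_{\nu^*}$ is an isomorphism. If $A\subset V_\nu$ is a subring, the center of $\nu$ on $A$ is $A\cap m_\nu$. A valuation $\nu$ of a field dominates a local subring $B$ with maximal ideal $m_B$ if $B\subset V_\nu$ and $m_\nu\cap B=m_B$. Valuations of a function field over $k$ are trivial on $k$; such a valuation is zero dimensional if its residue field has transcendence degree zero over $k$. $\mathrm{ord}$ of a one-variable polynomial is its order of vanishing at $0$. **Birational extensions.** An inclusion of domains $A\to B$ is a birational extension if $A$ and $B$ have the same quotient field and $B$ is essentially of finite type over $A$. The birational extension $S\to S'$ is along $\nu^*$ if $S'\subset V_{\nu^*}$. **Extending $\nu^*$ to $T$.** $\nu^*$ is regarded as a pseudo valuation on $T$: for $g\in T$, $\nu^*(g)=\nu^*(\overline g)$ if the residue $\overline g$ of $g$ in $S=T/(f)$ is nonzero, and $\nu^*(g)=\infty$ if $f$ divides $g$. It extends in the same way to the localization $T_{(f)}$ through the residue map $T_{(f)}\to T_{(f)}/fT_{(f)}=K^*$. A birational extension $T\to T'$ is along $\nu^*$ if $T'\subset T_{(f)}$ and the image of $T'$ in $K^*$ lies in $V_{\nu^*}$; the center of $\nu^*$ on such a $T'$ (including $T'=T$) is the ideal of elements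 whose image in $K^*$ lies in $m_{\nu^*}$. The strict transform $f'$ of $f$ in $T'$ is the irreducible element of $T'$ (unique up to units) which generates the height one prime ideal $T'\cap fT_{(f)}$; thus $f'$ is obtained from $f$ by removing the other irreducible factors of $f$ in $T'$. **Embedded local uniformization (ELU).** ELU holds in dimension $d$ if the following is true: Suppose that $A=k[x_1,\ldots,x_d]$ is a polynomial ring in $d$ variables over an algebraically closed field $k$ and $\nu$ is a zero dimensional valuation of the quotient field of $A$ which dominates $A_{\mathfrak m}$ where $\mathfrak m=(x_1,\ldots,x_d)$. Then if $0\ne f\in A$, there exists a birational extension $A\to A_1$ where $A_1=k[x_1(1),\ldots,x_d(1)]$ is a polynomial ring such that $\nu$ dominates $(A_1)_{\mathfrak m_1}$ where $\mathfrak m_1=(x_1(1),\ldots,x_d(1))$, there exists $n\le d$ such that $\{\nu(x_1(1)),\ldots,\nu(x_n(1))\}$ is a basis of the rational vector space $\Phi_\nu\otimes\mathbb{Q}$, and $f=x_1(1)^{b_1}\cdots x_n(1)^{b_n}\overline f$ with $b_1,\ldots,b_n\in\mathbb{N}$ and $\overline f\in A_1\setminus \mathfrak m_1$. **Defect.** For a finite extension of valued fields, $e(\nu^*/\nu)=[\Phi_{\nu^*}:\Phi_\nu]$ and $f(\nu^*/\nu)=[V_{\nu^*}/m_{\nu^*}:V_\nu/m_\nu]$. Let $p=\mathrm{char}\,V_\nu/m_\nu$ if this is positive, and $p=1$ otherwise. If $L/K$ is a finite Galois extension with group $G(L/K)$ and $\tilde\nu$ is a valuation of $L$ extending $\nu$,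 the splitting group is $G^s(V_{\tilde\nu}/V_\nu)=\{\sigma\in G(L/K)\mid \sigma(V_{\tilde\nu})=V_{\tilde\nu}\}$, and the defect $\delta(\tilde\nu/\nu)$ is the natural number defined by $$|G^s(V_{\tilde\nu}/V_\nu)|=e(\tilde\nu/\nu)f(\tilde\nu/\nu)p^{\delta(\tilde\nu/\nu)},$$ with $\delta(\tilde\nu/\nu)=0$ if $\mathrm{char}\,V_\nu/m_\nu=0$. For a finite separable extension $K^*/K$ with $\nu^*$ extending $\nu$, let $L$ be a Galois closure of $K^*$ over $K$ and $\tilde\nu$ an extension of $\nu^*$ to $L$; then $\delta(\nu^*/\nu)=\delta(\tilde\nu/\nu)-\delta(\tilde\nu/\nu^* )\ge 0$, which is independent of choices. *)

(* Defs.v *)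
From HB Require Import structures.
From mathcomp Require Import all_boot all_order all_algebra all_fingroup all_field.
From mathcomp Require Import boolp reals.
From mathcomp Require Import mpoly.

Set Implicit Arguments.
Unset Strict Implicit.
Unset Printing Implicit Defensive.

Import Order.TTheory GRing.Theory Num.Theory.
Local Open Scope ring_scope.

HB.mixin Record isOrderedAbGroup G of Num.POrderedZmodule G := {
  ordgroup_le_total : forall a b : G, (a <= b) || (b <= a);
  ordgroup_lerD2l : forall a b c : G, a <= b -> c + a <= c + b
}.

#[short(type="ordAbGroupType")]
HB.structure Definition OrderedAbGroup :=
  { G of isOrderedAbGroup G & Num.POrderedZmodule G }.

(* Only the values at nonzero elements are meaningful: v 0 is a junk value and
   stands for infinity.  By val_onto, G is exactly the value group of v. *)
Record valuation (F : fieldType) (G : ordAbGroupType) := Valuation {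
  val_fun :> F -> G;
  valM : forall x y, x != 0 -> y != 0 ->
    val_fun (x * y) = val_fun x + val_fun y;
  valD : forall x y, x != 0 -> y != 0 -> x + y != 0 ->
    Num.min (val_fun x) (val_fun y) <= val_fun (x + y);
  val_onto : forall g, exists2 x, x != 0 & val_fun x = g
}.

(* Since val_onto makes G the value group, rank 1 is a property of G. *)
Definition rank_one (G : ordAbGroupType) (R : realType) : Prop :=
  (exists g : G, g != 0) /\
  (exists h : {additive G -> R}, forall a b : G, (a <= b) = (h a <= h b)).

Section ValuationTheory.
Variables (F : fieldType) (G : ordAbGroupType) (v : valuation F G).

Definition vring (x : F) : bool := (x == 0) || (0 <= v x).

Definition vmax (x : F) : bool := (x == 0) || (0 < v x).

Definition dominates (B mB : F -> Prop) : Prop :=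
  (forall z, B z -> vring z) /\ (forall z, B z /\ vmax z <-> mB z).

(* In the next three, i : k -> F is the inclusion of the ground field. *)
Definition trivial_on (k : fieldType) (i : k -> F) : Prop :=
  forall c : k, c != 0 -> v (i c) = 0.

Definition residue_field_is (k : fieldType) (i : k -> F) : Prop :=
  forall x, vring x -> exists! c : k, vmax (x - i c).

Definition zero_dimensional (k : fieldType) (i : k -> F) : Prop :=
  forall x, vring x -> exists2 p : {poly k}, p != 0 & vmax (map_poly i p).[x].

(* The p of the defect formula: the residue characteristic if positive,
   and 1 otherwise. *)
Definition residue_char_exponent (p : nat) : Prop :=
  (prime p /\ vmax p%:R) \/ (p = 1%N /\ forall q, prime q -> ~~ vmax q%:R).

End ValuationTheory.

Section Birational.
Variable F : fieldType.
Implicit Types A B : F -> Prop.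

Definition quotient_field A (z : F) : Prop :=
  exists a b, [/\ A a, A b, b != 0 & z = a / b].

(* the ring A[s_1, ..., s_n] *)
Definition adjoin A n (s : 'I_n -> F) (z : F) : Prop :=
  exists P : {mpoly F[n]}, (forall m, A P@_m) /\ z = P.@[s].

Definition ess_finite_type A B : Prop :=
  exists n (s : 'I_n -> F) (M : F -> Prop),
    [/\ forall b, M b -> adjoin A s b, M 1, ~ M 0,
        forall b c, M b -> M c -> M (b * c) &
        forall z, B z <-> exists a b, [/\ adjoin A s a, M b & z = a / b]].

Definition birational_ext A B : Prop :=
  [/\ forall z, A z -> B z,
      forall z, quotient_field A z <-> quotient_field B z &
      ess_finite_type A B].

End Birational.

Definition divides (A : comNzRingType) (a b : A) : Prop := exists c, b = c * a.

Definition irreducible_elt (A : comUnitRingType) (a : A) : Prop :=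
  [/\ a != 0, a \isn't a GRing.unit &
      forall b c, a = b * c -> b \is a GRing.unit \/ c \is a GRing.unit].

(* Polynomial subrings k[y_1, ..., y_d] of the rational function field
   k(x_1, ..., x_d); polynomials in the y_i are represented by elements of
   {mpoly k[d]} through psubst y, which substitutes y for the variables. *)

Section PolynomialSubrings.
Variables (k : fieldType) (d : nat).
Notation A := {mpoly k[d]}.
Notation Q := {fraction A}.
Implicit Types (y : 'I_d -> Q) (P : A).

Definition cst (c : k) : Q := tofrac c%:MP.
Definition vars (i : 'I_d) : Q := tofrac 'X_i.

Definition psubst y P : Q := mmap cst y P.

Definition poly_subring y (z : Q) : Prop := exists P, z = psubst y P.

Definition alg_indep y : Prop := injective (psubst y).

Definition vars_ideal P : Prop := exists c : 'I_d -> A, P = \sum_i c i * 'X_i.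

(* the localization of k[y] at (y_1, ..., y_d), and its maximal ideal *)
Definition loc_origin y (z : Q) : Prop :=
  exists P P', ~ vars_ideal P' /\ z = psubst y P / psubst y P'.

Definition loc_origin_max y (z : Q) : Prop :=
  exists P P', [/\ vars_ideal P, ~ vars_ideal P' &
                   z = psubst y P / psubst y P'].

End PolynomialSubrings.

(* The rational vector space G tensor Q, by its universal property *)

Definition is_rationalization (G : zmodType) (E : lmodType rat)
    (j : {additive G -> E}) : Prop :=
  forall (W : lmodType rat) (h : {additive G -> W}),
    (exists l : {linear E -> W}, forall g, l (j g) = h g) /\
    (forall l1 l2 : {linear E -> W},
       (forall g, l1 (j g) = l2 (j g)) -> l1 =1 l2).

Definition is_basis (E : lmodType rat) n (e : 'I_n -> E) : Prop :=
  forall w : E, exists! c : {ffun 'I_n -> rat}, w = \sum_i c i *: e i.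

Definition rational_basis (G : zmodType) n (g : 'I_n -> G) : Prop :=
  exists (E : lmodType rat) (j : {additive G -> E}),
    is_rationalization j /\ is_basis (fun i => j (g i)).

(* Embedded local uniformization in dimension d.  The ground field is
   quantified here, so that the property depends on d only. *)
Definition ELU (d : nat) : Prop :=
  forall (k : closedFieldType) (G : ordAbGroupType)
         (v : valuation {fraction {mpoly k[d]}} G),
  trivial_on v (@cst k d) ->
  zero_dimensional v (@cst k d) ->
  dominates v (loc_origin (@vars k d)) (loc_origin_max (@vars k d)) ->
  forall f : {mpoly k[d]}, f != 0 ->
  exists y : 'I_d -> {fraction {mpoly k[d]}},
    [/\ alg_indep y,
        birational_ext (poly_subring (@vars k d)) (poly_subring y),
        dominates v (loc_origin y) (loc_origin_max y) &
        exists (n : nat) (le_nd : (n <= d)%N),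
          rational_basis (fun i : 'I_n => v (y (widen_ord le_nd i))) /\
          exists (b : 'I_n -> nat) (g : {mpoly k[d]}),
            ~ vars_ideal g /\
            tofrac f = (\prod_(i < n) y (widen_ord le_nd i) ^+ b i)
                       * psubst y g].

Definition has_index (G : zmodType) (A B : G -> Prop) (e : nat) : Prop :=
  exists c : 'I_e -> G, (forall i, A (c i)) /\
    (forall a, A a -> exists! i, B (a - c i)).

(* Everything here is relative to the extension L / E, the valuation on E being
   the restriction of v. *)

Section GaloisDefect.
Variables (F : fieldType) (L : splittingFieldType F) (G : ordAbGroupType).
Variables (v : valuation L G) (E : {vspace L}).

Definition value_group (U : {vspace L}) (g : G) : Prop :=
  exists x, [/\ x \in U, x != 0 & v x = g].

Definition ram_index (e : nat) : Prop :=
  has_index (value_group fullv) (value_group E) e.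

(* u lifts a basis of the residue field of v over that of v restricted to E *)
Definition residue_degree (f : nat) : Prop :=
  exists u : 'I_f -> L,
    [/\ forall i, vring v (u i),
        forall x, vring v x -> exists c : 'I_f -> L,
          (forall i, c i \in E /\ vring v (c i)) /\
          vmax v (x - \sum_i c i * u i) &
        forall c : 'I_f -> L, (forall i, c i \in E /\ vring v (c i)) ->
          vmax v (\sum_i c i * u i) -> forall i, vmax v (c i)].

Definition splitting_group : {set gal_of {:L}} :=
  [set s in 'Gal({:L} / E)%g |
    `[< forall y, vring v y <-> exists2 x, vring v x & s x = y >]].

Definition galois_defect (delta : nat) : Prop :=
  exists e f p : nat,
    [/\ ram_index e, residue_degree f, residue_char_exponent v p,
        #|splitting_group| = (e * f * p ^ delta)%N &
        p = 1%N -> delta = 0%N].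

End GaloisDefect.

Definition galois_closure (F : fieldType) (K : fieldExtType F)
    (L : splittingFieldType F) (i : 'AHom(K, L)) : Prop :=
  galois 1 {:L} /\
  forall M : {subfield L}, (limg i <= M)%VS -> galois 1 M ->
    M = fullv :> {vspace L}.

Definition extends (K L : fieldType) (i : K -> L) (G H : ordAbGroupType)
    (v : valuation K G) (w : valuation L H) : Prop :=
  exists h : {additive G -> H},
    (forall a b : G, (a <= b) = (h a <= h b)) /\
    (forall x, x != 0 -> w (i x) = h (v x)).

(* delta is the defect of v over its restriction to F: the difference of the
   defects of w over F and over K.  As it does not depend on the Galois closure
   L and on the extension w, some choice of these is required to compute it. *)
Definition has_defect (F : fieldType) (K : fieldExtType F)
    (G : ordAbGroupType) (v : valuation K G) (delta : nat) : Prop :=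
  exists (L : splittingFieldType F) (i : 'AHom(K, L))
         (H : ordAbGroupType) (w : valuation L H) (a b : nat),
    [/\ galois_closure i, extends i v w,
        galois_defect w 1 a, galois_defect w (limg i) b &
        a = (b + delta)%N].

(* g(0, ..., 0, x) *)
Definition last_axis (k : fieldType) n (g : {mpoly k[n.+1]}) : {poly k} :=
  mmap polyC (fun i => if i == ord_max then 'X else 0) g.

(* The zero polynomial has infinite order, hence no order in nat. *)
Definition has_ord (k : fieldType) (p : {poly k}) (r : nat) : Prop :=
  p != 0 /\ mup 0 p = r.

(* pi presents K as the quotient field of T/(f), compatibly with the structure
   of extension of k(x_1, ..., x_n). *)
Record presents_quotient_field (k : fieldType) n (f : {mpoly k[n.+1]})
    (K : fieldExtType {fraction {mpoly k[n]}})
    (pi : {rmorphism {mpoly k[n.+1]} -> K}) : Prop := {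
  pqf_ker : forall g, pi g = 0 <-> divides f g;
  pqf_frac : forall z, exists a b, pi b != 0 /\ z = pi a / pi b;
  pqf_base : forall a : {mpoly k[n]}, pi (mwiden a) = (tofrac a)%:A
}.

Section Hypersurface.
Variables (k : fieldType) (n : nat).
Notation T := {mpoly k[n.+1]}.
Notation Q := {fraction T}.
Variables (K : fieldExtType {fraction {mpoly k[n]}}) (pi : {rmorphism T -> K}).
Variables (G : ordAbGroupType) (v : valuation K G).
Variable f : T.

Definition residue_subring (y : K) : Prop := exists g, y = pi g.

(* the localization T_(f) *)
Definition loc_f (z : Q) : Prop :=
  exists a b, ~ divides f b /\ z = tofrac a / tofrac b.

(* The graph of the residue map T_(f) -> K.  The value of the pseudo valuation
   is infinite exactly when the residue is 0, and vmax v 0 holds. *)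
Definition residue_f (z : Q) (y : K) : Prop :=
  exists a b, [/\ ~ divides f b, z = tofrac a / tofrac b & y = pi a / pi b].

Variable x' : 'I_n.+1 -> Q.

(* S', as a subring of K *)
Definition image_subring (y : K) : Prop :=
  exists2 z, poly_subring x' z & residue_f z y.

Definition along : Prop :=
  (forall z, poly_subring x' z -> loc_f z) /\
  (forall y, image_subring y -> vring v y).

Definition center_is_origin : Prop :=
  forall P y, residue_f (psubst x' P) y -> (vmax v y <-> vars_ideal P).

(* f' is a generator of the prime ideal k[x'] \cap f T_(f) of k[x'], written
   as a polynomial in x' *)
Definition strict_transform (f' : T) : Prop :=
  irreducible_elt f' /\
  forall P, divides f' P <->
            exists2 w, loc_f w & psubst x' P = tofrac f * w.

End Hypersurface.

(* Main.v *)
Require Import Defs.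
From HB Require Import structures.
From mathcomp Require Import all_boot all_order all_algebra all_fingroup all_field.
From mathcomp Require Import boolp reals.
From mathcomp Require Import mpoly.
From mathcomp Require Import ring zify.
Set Implicit Arguments.
Unset Strict Implicit.
Unset Printing Implicit Defensive.
Import Order.TTheory GRing.Theory Num.Theory.
Local Open Scope ring_scope.

(* Let z be the class of x_m.  Since the defect is 0, either v (z - h) is not
   the value of an element of K, for some h in K, or z is a limit of elements
   of K.  Indeed, K is dense in the decomposition field of a Galois closure L
   (rank one) and the residue degrees are 1, so that elements of K* whose values
   represent the value group of K* modulo that of K span K* over the
   decomposition field; an element z = sum_i a_i b_i, approximated in K, then
   falls in one of the two cases.

   ELU gives coordinates y at the center of nu on a polynomial ring in K, in
   which h can be replaced by a polynomial; in the second case we take h so close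
   to z that v (z - h) > v (f'(z)).  By ELU again, the coefficients of f(X + h) up
   to degree r become monomials in y times units.  Perron's algorithm in
   (y, z - h) makes the monomials of f(X + h) comparable and turns one variable
   into a monomial of value 0, which is replaced by its difference with its
   residue alpha.  On the last axis, the transform is then a sum of
   g_i (X + alpha)^(lam_i) over the indices i <= r of minimal value, where the
   lam_i are distinct.  They differ by less than r: in the first case because
   lam_i - lam_j = +- (i - j) / e with e >= 2, and in the second because only the
   indices 0 and 1 can have minimal value.  As X + alpha does not vanish at 0,
   the order of the sum is at most max lam_i - min lam_i < r. *)

(** * Ordered groups and prevaluations *)

(** Zero defect enters as a count of degrees. All residue fields being k, the splitting groups over
    K and over K* have orders e1 p^a and e2 p^a with the same a, so the degree between the two
    decomposition fields is e1 / e2, and elements of K* with distinct values modulo K are numerous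
    enough to form a basis. The integer e is the least positive multiplicity of v (z - h) in a
    relation with the values of the independent variables; e = 1 would make v (z - h) the value of a
    Laurent monomial in y. The exponents of two terms of least value differ by a times the
    generating relation, which the algorithm turns into plus or minus the last unit vector: this is
    why lam_i - lam_j = +- a. In the limit case, the linear coefficient of f(X + h) has the value of
    the derivative at z, and h is close enough for the linear term to beat all later ones. An
    obstacle remains: X + alpha is a unit at the origin but not in the polynomial ring, so its
    powers too must be removed from the transform. The strict transform is recognised as the
    generator of the kernel of evaluation at the residues of the coordinates, which also gives its
    irreducibility. *)

Section OrderedGroup.
Variable G : ordAbGroupType.
Implicit Types a b c d : G.

Lemma ogle_total a b : (a <= b) || (b <= a).
Proof. exact: ordgroup_le_total. Qed.

Lemma ogleNgt a b : (a <= b) = ~~ (b < a).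
Proof.
rewrite lt_neqAle negb_and negbK; have := ogle_total a b.
case: (a =P b) => [->|ne] /=; first by rewrite lexx eqxx.
case ab: (a <= b) => /=.
  move=> _; apply/esym/orP; right; apply/negP => ba.
  by apply: ne; apply/eqP; rewrite eq_le ab ba.
by move=> ->; rewrite orbF; case: eqP => // e; case: ne.
Qed.

Lemma ogltNge a b : (a < b) = ~~ (b <= a).
Proof. by rewrite ogleNgt negbK. Qed.

Lemma og_trichotomy a b : [\/ a < b, b < a | a = b].
Proof.
have [->|ne] := eqVneq a b; first by constructor 3.
have [le|le] := orP (ogle_total a b).
  by constructor 1; rewrite lt_neqAle ne.
by constructor 2; rewrite lt_neqAle eq_sym ne.
Qed.

Lemma ogle_add2l c a b : (c + a <= c + b) = (a <= b).
Proof.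
apply/idP/idP => [|/ordgroup_lerD2l]; last exact.
by move/(ordgroup_lerD2l _ _ (- c)); rewrite !addKr.
Qed.

Lemma ogle_add2r c a b : (a + c <= b + c) = (a <= b).
Proof. by rewrite -!(addrC c) ogle_add2l. Qed.

Lemma oglt_add2r c a b : (a + c < b + c) = (a < b).
Proof. by rewrite !ogltNge ogle_add2r. Qed.

Lemma ogleD a b c d : a <= b -> c <= d -> a + c <= b + d.
Proof. by move=> h1 h2; apply: (@le_trans _ _ (b + c)); rewrite ?ogle_add2l ?ogle_add2r. Qed.

Lemma ogltD a b c d : a < b -> c <= d -> a + c < b + d.
Proof.
by move=> h1 h2; apply: (@lt_le_trans _ _ (b + c)); rewrite ?ogle_add2l ?oglt_add2r.
Qed.

Lemma ogsub_ge0 a b : (0 <= b - a) = (a <= b).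
Proof. by rewrite -(ogle_add2r a 0) add0r subrK. Qed.

Lemma ogsub_gt0 a b : (0 < b - a) = (a < b).
Proof. by rewrite -(oglt_add2r a 0) add0r subrK. Qed.

Lemma ogopp_le0 a : (- a <= 0) = (0 <= a).
Proof. by rewrite -(ogle_add2r a (- a)) add0r addNr. Qed.

Lemma ogopp_lt0 a : (- a < 0) = (0 < a).
Proof. by rewrite -(oglt_add2r a (- a)) add0r addNr. Qed.

Lemma ogopp_gt0 a : (0 < - a) = (a < 0).
Proof. by rewrite -(oglt_add2r a 0) add0r addNr. Qed.

Lemma ogD_ge0 a b : 0 <= a -> 0 <= b -> 0 <= a + b.
Proof. by move=> h1 h2; rewrite -[0]addr0; apply: ogleD. Qed.

Lemma ogD_gt0 a b : 0 < a -> 0 <= b -> 0 < a + b.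
Proof. by move=> h1 h2; rewrite -[0]addr0; apply: ogltD. Qed.

Lemma ogMn_ge0 a n : 0 <= a -> 0 <= a *+ n.
Proof.
by move=> h; elim: n => [|n IH]; rewrite ?mulr0n ?lexx // mulrS ogD_ge0.
Qed.

Lemma ogMn_gt0 a n : 0 < a -> 0 < a *+ n.+1.
Proof. by move=> h; rewrite mulrS ogD_gt0 // ogMn_ge0 // ltW. Qed.

Lemma ogMn_lt0 a n : a < 0 -> a *+ n.+1 < 0.
Proof. by rewrite -!ogopp_gt0 -mulNrn; exact: ogMn_gt0. Qed.

Lemma ogle_Mn2 a m n : 0 <= a -> (m <= n)%N -> a *+ m <= a *+ n.
Proof.
by move=> h /subnKC <-; rewrite mulrnDr -[leLHS]addr0 ogle_add2l ogMn_ge0.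
Qed.

Lemma ogMn_eq0 a n : a *+ n.+1 = 0 -> a = 0.
Proof.
move=> h; case: (eqVneq a 0) => // a0.
have [al|al] := orP (ogle_total a 0).
  by have := @ogMn_lt0 a n; rewrite h ltxx lt_neqAle a0 al; move/(_ isT).
by have := @ogMn_gt0 a n; rewrite h ltxx lt_neqAle eq_sym a0 al; move/(_ isT).
Qed.

Lemma ogmin_ge c a b : c <= a -> c <= b -> c <= Num.min a b.
Proof. by move=> h1 h2; rewrite minEle; case: ifP. Qed.

Lemma ogmin_gt c a b : c < a -> c < b -> c < Num.min a b.
Proof. by move=> h1 h2; rewrite minEle; case: ifP. Qed.

(** The form in which rank one serves the approximation arguments. It passes to the value group of
    an extension to a Galois closure by a torsion argument, without extending the embedding into the
    reals. *)
Definition archimedean_group : Prop :=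
  forall a b, 0 < a -> exists n : nat, b < a *+ n.

Lemma archimedean_shift (aG : archimedean_group) a b c :
  0 < a -> exists n : nat, forall m, (n <= m)%N -> c < a *+ m + b.
Proof.
move=> a0; have [n hn] := aG a (c - b) a0.
exists n => m nm; rewrite -(oglt_add2r (- b)) addrK.
by apply: lt_le_trans hn _; apply: ogle_Mn2 => //; exact: ltW.
Qed.

End OrderedGroup.

Arguments archimedean_group : clear implicits.

Lemma archimedean_rank_one (G : ordAbGroupType) (R : realType) :
  rank_one G R -> archimedean_group G.
Proof.
case=> _ [h hle] a b a0.
have ha : 0 < h a.
  have : 0 <= h a by rewrite -(raddf0 h) -hle ltW.
  rewrite le_eqVlt => /orP[/eqP e|//]; move: a0.
  by rewrite ogltNge hle raddf0 e lexx.
have [n hn] : exists n : nat, h b / h a < n%:R.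
  exists (Num.bound `|h b / h a|).
  by apply: le_lt_trans (archi_boundP (normr_ge0 _)); exact: ler_norm.
exists n; rewrite ogltNge hle -ltNge raddfMn -mulr_natl.
by rewrite -ltr_pdivrMr.
Qed.

(* Unlike [valuation], this does not require G to be the exact value group, so
   that valuations can be restricted along field morphisms. *)
Record prevaluation (F : fieldType) (G : ordAbGroupType) := Prevaluation {
  preval_fun :> F -> G;
  prevalM : forall x y, x != 0 -> y != 0 ->
    preval_fun (x * y) = preval_fun x + preval_fun y;
  prevalD : forall x y, x != 0 -> y != 0 -> x + y != 0 ->
    Num.min (preval_fun x) (preval_fun y) <= preval_fun (x + y)
}.

Definition preval_of (F : fieldType) (G : ordAbGroupType) (v : valuation F G) :
  prevaluation F G := Prevaluation (Defs.valM v) (Defs.valD v).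

Section PrevalComp.
Variables (F E : fieldType) (G : ordAbGroupType) (s : {rmorphism E -> F}).
Variable v : prevaluation F G.

Lemma preval_compM x y : x != 0 -> y != 0 ->
  v (s (x * y)) = v (s x) + v (s y).
Proof. by move=> x0 y0; rewrite rmorphM prevalM // fmorph_eq0. Qed.

Lemma preval_compD x y : x != 0 -> y != 0 -> x + y != 0 ->
  Num.min (v (s x)) (v (s y)) <= v (s (x + y)).
Proof.
by move=> x0 y0 xy0; rewrite rmorphD prevalD // -?rmorphD fmorph_eq0.
Qed.

Definition preval_comp : prevaluation E G :=
  @Prevaluation _ _ (fun x => v (s x)) preval_compM preval_compD.

End PrevalComp.

Section PrevalTheory.
Variables (F : fieldType) (G : ordAbGroupType) (v : prevaluation F G).
Implicit Types x y : F.

(* The junk value of v at 0 stands for infinity. *)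
Definition vge (g : G) x : bool := (x == 0) || (g <= v x).
Definition vgt (g : G) x : bool := (x == 0) || (g < v x).

Lemma preval1 : v 1 = 0.
Proof.
apply: (@addrI _ (v 1)); rewrite addr0 -{3}[1](mulr1 1).
by rewrite prevalM ?oner_neq0.
Qed.

Lemma prevalN1 : v (-1) = 0.
Proof.
have n1 : (-1 : F) != 0 by rewrite oppr_eq0 oner_neq0.
apply: (@ogMn_eq0 _ _ 1); rewrite mulr2n -prevalM // mulrNN mulr1.
exact: preval1.
Qed.

Lemma prevalN x : v (- x) = v x.
Proof.
have [->|x0] := eqVneq x 0; first by rewrite oppr0.
by rewrite -mulN1r prevalM // ?oppr_eq0 ?oner_neq0 // prevalN1 add0r.
Qed.

Lemma prevalV x : x != 0 -> v x^-1 = - v x.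
Proof.
move=> x0; apply: (@addrI _ (v x)); rewrite -prevalM ?invr_eq0 //.
by rewrite divff // preval1 subrr.
Qed.

Lemma prevalX x n : x != 0 -> v (x ^+ n) = v x *+ n.
Proof.
move=> x0; elim: n => [|n IH]; first by rewrite expr0 preval1 mulr0n.
by rewrite exprS prevalM ?expf_neq0 // IH mulrS.
Qed.

Lemma prevalXz x (n : int) : x != 0 -> v (x ^ n) = v x *~ n.
Proof.
move=> x0; case: n => n; first by rewrite -exprnP prevalX.
by rewrite NegzE -exprnN prevalV ?expf_neq0 // prevalX // mulrNz.
Qed.

Lemma preval_prod (I : Type) (s : seq I) (P : pred I) (E : I -> F) :
  (forall i, P i -> E i != 0) ->
  v (\prod_(i <- s | P i) E i) = \sum_(i <- s | P i) v (E i).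
Proof.
move=> E0; elim: s => [|i s IH]; first by rewrite !big_nil preval1.
rewrite !big_cons; case: ifP => // Pi; rewrite prevalM ?IH ?E0 //.
by elim/big_ind: _ => [|a b|j /E0 //]; [exact: oner_neq0 | exact: mulf_neq0].
Qed.

Lemma vge0 g : vge g 0. Proof. by rewrite /vge eqxx. Qed.
Lemma vgt0 g : vgt g 0. Proof. by rewrite /vgt eqxx. Qed.

Lemma vgtW g x : vgt g x -> vge g x.
Proof. by case/orP => [/eqP ->|/ltW h]; rewrite ?vge0 // /vge h orbT. Qed.

Lemma vge_nz g x : x != 0 -> vge g x = (g <= v x).
Proof. by rewrite /vge => /negbTE ->. Qed.

Lemma vgt_nz g x : x != 0 -> vgt g x = (g < v x).
Proof. by rewrite /vgt => /negbTE ->. Qed.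

Lemma vgeN g x : vge g (- x) = vge g x.
Proof. by rewrite /vge oppr_eq0 prevalN. Qed.

Lemma vgtN g x : vgt g (- x) = vgt g x.
Proof. by rewrite /vgt oppr_eq0 prevalN. Qed.

Lemma vgeD g x y : vge g x -> vge g y -> vge g (x + y).
Proof.
have [->|x0] := eqVneq x 0; first by rewrite add0r.
have [->|y0] := eqVneq y 0; first by rewrite addr0.
have [->|xy0] := eqVneq (x + y) 0; first by rewrite vge0.
rewrite !vge_nz // => h1 h2; apply: le_trans (prevalD _ _ _ _) => //.
exact: ogmin_ge.
Qed.

Lemma vgtD g x y : vgt g x -> vgt g y -> vgt g (x + y).
Proof.
have [->|x0] := eqVneq x 0; first by rewrite add0r.
have [->|y0] := eqVneq y 0; first by rewrite addr0.
have [->|xy0] := eqVneq (x + y) 0; first by rewrite vgt0.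
rewrite !vgt_nz // => h1 h2; apply: lt_le_trans (prevalD _ _ _ _) => //.
exact: ogmin_gt.
Qed.

Lemma vgeB g x y : vge g x -> vge g y -> vge g (x - y).
Proof. by move=> h1 h2; rewrite vgeD ?vgeN. Qed.

Lemma vgtB g x y : vgt g x -> vgt g y -> vgt g (x - y).
Proof. by move=> h1 h2; rewrite vgtD ?vgtN. Qed.

Lemma vgeM g h x y : vge g x -> vge h y -> vge (g + h) (x * y).
Proof.
have [->|x0] := eqVneq x 0; first by rewrite mul0r => *; exact: vge0.
have [->|y0] := eqVneq y 0; first by rewrite mulr0 => *; exact: vge0.
by rewrite !vge_nz ?mulf_neq0 // prevalM // => h1 h2; exact: ogleD.
Qed.

Lemma vgtM g h x y : vgt g x -> vge h y -> vgt (g + h) (x * y).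
Proof.
have [->|x0] := eqVneq x 0; first by rewrite mul0r => *; exact: vgt0.
have [->|y0] := eqVneq y 0; first by rewrite mulr0 => *; exact: vgt0.
rewrite vgt_nz // vge_nz // vgt_nz ?mulf_neq0 // prevalM // => h1 h2; exact: ogltD.
Qed.

Lemma vgt_sum g (I : Type) (s : seq I) (P : pred I) (E : I -> F) :
  (forall i, P i -> vgt g (E i)) -> vgt g (\sum_(i <- s | P i) E i).
Proof. by move=> h; elim/big_ind: _ => //; [exact: vgt0 | exact: vgtD]. Qed.

Lemma vge1 : vge 0 1.
Proof. by rewrite vge_nz ?oner_neq0 // preval1. Qed.

Lemma vgt1 : vgt 0 1 = false.
Proof. by rewrite vgt_nz ?oner_neq0 // preval1 ltxx. Qed.

Lemma vge0M x y : vge 0 x -> vge 0 y -> vge 0 (x * y).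
Proof. by move=> h1 h2; rewrite -[0]addr0 vgeM. Qed.

Lemma vgt0M x y : vgt 0 x -> vge 0 y -> vgt 0 (x * y).
Proof. by move=> h1 h2; rewrite -[0]addr0 vgtM. Qed.

Lemma vge0X x n : vge 0 x -> vge 0 (x ^+ n).
Proof.
by move=> h; elim: n => [|n IH]; rewrite ?expr0 ?vge1 // exprS vge0M.
Qed.

Lemma vge_le g h x : g <= h -> vge h x -> vge g x.
Proof. by move=> gh; case/orP=> [/eqP->|/(le_trans gh) e]; rewrite /vge ?eqxx ?e ?orbT. Qed.

Lemma vgt_le g h x : g <= h -> vgt h x -> vgt g x.
Proof. by move=> gh; case/orP=> [/eqP->|/(le_lt_trans gh) e]; rewrite /vgt ?eqxx ?e ?orbT. Qed.

Lemma vgtNge g x : x != 0 -> vgt g x = ~~ (v x <= g).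
Proof. by move=> x0; rewrite vgt_nz // ogltNge. Qed.

Lemma preval_dominant x y : x != 0 -> vgt (v x) y ->
  x + y != 0 /\ v (x + y) = v x.
Proof.
move=> x0 xy.
have xy0 : x + y != 0.
  apply/eqP => e; have /eqP ye : y == - x by rewrite -addr_eq0 addrC e.
  by move: xy; rewrite ye vgtN vgt_nz // ltxx.
split => //; apply/le_anti/andP; split; last first.
  by rewrite -vge_nz // vgeD ?(vgtW xy) // vge_nz.
rewrite ogleNgt; apply/negP => h.
have : vgt (v x) (x + y - y) by rewrite vgtB // vgt_nz.
by rewrite addrK vgt_nz // ltxx.
Qed.

Lemma preval_eq_close x y : x != 0 -> vgt (v x) (x - y) -> y != 0 /\ v y = v x.
Proof.
move=> x0; rewrite -vgtN opprB => h; have := preval_dominant x0 h.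
by rewrite addrCA subrr addr0.
Qed.

Lemma vgt0_prime x y : vge 0 x -> vge 0 y -> vgt 0 (x * y) -> vgt 0 x || vgt 0 y.
Proof.
have [->|x0] := eqVneq x 0; first by rewrite vgt0.
have [->|y0] := eqVneq y 0; first by rewrite vgt0 orbT.
rewrite !vge_nz // !vgt_nz ?mulf_neq0 // prevalM // => hx hy.
rewrite !lt_neqAle hx hy !andbT !(eq_sym 0) -negb_and; case/andP => h _.
by apply: contra h; case/andP => /eqP -> /eqP ->; rewrite addr0.
Qed.

Lemma vgt0_prod (I : Type) (s : seq I) (E : I -> F) :
  (forall i, vge 0 (E i)) -> vgt 0 (\prod_(i <- s) E i) ->
  exists i, vgt 0 (E i).
Proof.
move=> E0; elim: s => [|i s IH]; first by rewrite big_nil vgt1.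
rewrite big_cons => h; have hs : vge 0 (\prod_(j <- s) E j).
  by elim/big_ind: _ => // *; [exact: vge1 | exact: vge0M].
by have [ | /IH //] := orP (vgt0_prime (E0 i) hs h); exists i.
Qed.

End PrevalTheory.

(** Terms of different values cannot cancel, so the smaller one dominates at each step of the
    induction. This yields linear independence from values and, read backwards, two equal values in
    a vanishing sum. *)
Lemma preval_sum_distinct (F : fieldType) (G : ordAbGroupType)
    (v : prevaluation F G) (I : eqType) (s : seq I) (E : I -> F) :
  s != [::] -> uniq s -> (forall i, i \in s -> E i != 0) ->
  (forall i j, i \in s -> j \in s -> v (E i) = v (E j) -> i = j) ->
  exists i, [/\ i \in s, \sum_(j <- s) E j != 0,
    v (\sum_(j <- s) E j) = v (E i) & forall j, j \in s -> v (E i) <= v (E j)].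
Proof.
elim: s => // a [|b s] IH _ /andP[aN us] E0 inj.
  exists a; rewrite big_seq1; split; rewrite ?mem_head ?E0 ?mem_head //.
  by move=> j; rewrite inE => /eqP ->.
have [//|//|i ib|i j ib jb|i [ib s0 vs mi]] := IH.
- by apply: E0; rewrite in_cons ib orbT.
- by apply: inj; rewrite in_cons ?ib ?jb orbT.
have a0 : E a != 0 by apply: E0; rewrite mem_head.
rewrite big_cons; set S := \sum_(j <- _) _ in s0 vs *.
have [le|le] := orP (ogle_total (v (E a)) (v (E i))).
  have lt : v (E a) < v (E i).
    rewrite lt_neqAle le andbT; apply: contra aN => /eqP e.
    by rewrite (inj a i _ _ e) // ?mem_head // inE ib orbT.
  have [||h1 h2] := @preval_dominant _ _ v (E a) S => //.
    by rewrite vgt_nz ?vs.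
  exists a; split; rewrite ?mem_head // => j; rewrite inE => /orP[/eqP -> //|/mi].
  exact: le_trans.
have lt : v (E i) < v (E a).
  rewrite lt_neqAle le andbT; apply: contra aN => /eqP e.
  by rewrite (inj a i) // ?mem_head // inE ib orbT.
have [||h1 h2] := @preval_dominant _ _ v S (E a) => //.
  by rewrite vgt_nz ?vs.
rewrite addrC; exists i; split; rewrite ?h2 // ?[_ \in a :: _]in_cons ?ib ?orbT //.
by move=> j; rewrite in_cons => /orP[/eqP ->|/mi].
Qed.

(** * The base field and the decomposition field *)

Lemma og_lower_bound (G : ordAbGroupType) (I : finType) (g : I -> G) :
  exists b : G, b <= 0 /\ forall i, b <= g i.
Proof.
suff [b [b0 hb]] : exists b : G, b <= 0 /\ forall i, i \in enum I -> b <= g i.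
  by exists b; split=> // i; apply: hb; rewrite mem_enum.
elim: (enum I) => [|j s [b [b0 hb]]]; first by exists 0; split.
have [le|le] := orP (ogle_total b (g j)).
  by exists b; split => // i; rewrite in_cons => /orP[/eqP ->|/hb].
exists (g j); split=> [|i]; first exact: le_trans b0.
by rewrite in_cons => /orP[/eqP -> //|/hb]; exact: le_trans.
Qed.

Section Splitting.
Variables (F : fieldType) (L : splittingFieldType F) (H : ordAbGroupType).
Variable w : prevaluation L H.
Implicit Types (s t : gal_of {:L}) (x y : L).

Definition stable s : Prop := forall x, vge w 0 (s x) = vge w 0 x.

Lemma gal_mulE s t x : (s * t)%g x = t (s x).
Proof. by rewrite galM // memvf. Qed.

Lemma gal_expS s n x : (s ^+ n.+1)%g x = (s ^+ n)%g (s x).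
Proof. by rewrite expgS gal_mulE. Qed.

Lemma stableM s t : stable s -> stable t -> stable (s * t)%g.
Proof. by move=> hs ht x; rewrite gal_mulE ht hs. Qed.

Lemma stable1 : stable 1%g.
Proof. by move=> x; rewrite gal_id. Qed.

Lemma stableX s n : stable s -> stable (s ^+ n)%g.
Proof.
move=> hs; elim: n => [|n IH]; rewrite ?expg0 ?expgS; first exact: stable1.
exact: stableM.
Qed.

Lemma stableV s : stable s -> stable (s^-1)%g.
Proof. by move=> hs; rewrite invg_expg; exact: stableX. Qed.

Lemma stableMl s t : stable s -> stable (s * t)%g -> stable t.
Proof.
by move=> hs hst; rewrite -(mulKg s t); apply: stableM => //; exact: stableV.
Qed.

(** The inverse of [s] is a power of [s], so iterating the inclusion reverses it. *)
Lemma stable_incl s : (forall x, vge w 0 x -> vge w 0 (s x)) -> stable s.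
Proof.
move=> hs x; apply/idP/idP => [h|/hs //].
have hn n y : vge w 0 y -> vge w 0 ((s ^+ n)%g y).
  elim: n y => [|n IH] y hy; first by rewrite expg0 gal_id.
  by rewrite gal_expS; apply: IH; exact: hs.
have /(hn #[s]%g.-1) := h; rewrite -gal_expS prednK ?order_gt0 //.
by rewrite expg_order gal_id.
Qed.

Lemma stable_incl_inv s : (forall x, vge w 0 (s x) -> vge w 0 x) -> stable s.
Proof.
move=> hs; rewrite -(invgK s); apply/stableV/stable_incl => x hx.
by apply: hs; rewrite -gal_mulE mulVg gal_id.
Qed.

Lemma vgt0_inv x : x != 0 -> vgt w 0 x = ~~ vge w 0 x^-1.
Proof.
move=> x0; rewrite vgt_nz // vge_nz ?invr_eq0 // prevalV // -ogltNge.
by rewrite ogopp_lt0.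
Qed.

Lemma stable_vgt s x : stable s -> vgt w 0 (s x) = vgt w 0 x.
Proof.
move=> hs; have [->|x0] := eqVneq x 0; first by rewrite linear0 !vgt0.
by rewrite !vgt0_inv ?fmorph_eq0 // -fmorphV hs.
Qed.

(** If s x / x had positive value, so would s^n x / x for every n > 0, being a product of images of
    s x / x under powers of [s]; for n the order of [s] this is 1. *)
Lemma stable_quotient s x : stable s -> x != 0 -> ~~ vgt w 0 (s x / x).
Proof.
move=> hs x0; apply/negP => h.
have hn n : vgt w 0 ((s ^+ n.+1)%g x / x).
  elim: n => [|n IH]; first by rewrite expg1.
  have -> : (s ^+ n.+2)%g x / x =
            (s ^+ n.+1)%g (s x / x) * ((s ^+ n.+1)%g x / x).
    rewrite gal_expS fmorph_div mulrA divfK //.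
    by rewrite fmorph_eq0.
  by rewrite vgt0M ?(vgtW IH) // stable_vgt //; exact: stableX.
have := hn #[s]%g.-1; rewrite prednK ?order_gt0 // expg_order gal_id divff //.
by rewrite vgt1.
Qed.

Lemma stable_preval s x : stable s -> w (s x) = w x.
Proof.
move=> hs; have [->|x0] := eqVneq x 0; first by rewrite linear0.
have sx0 : s x != 0 by rewrite fmorph_eq0.
have := stable_quotient hs x0; have := @stable_quotient s x^-1 hs.
rewrite invr_eq0 => /(_ x0); rewrite invrK fmorphV !vgt_nz ?mulf_neq0 ?invr_eq0 //.
rewrite !prevalM ?invr_eq0 // !prevalV // addrC !ogsub_gt0 -!ogleNgt => h1 h2.
by apply/le_anti; rewrite h1 h2.
Qed.

(** The valuation rings of w and of w composed with s are incomparable. With x in the first only and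
    y in the second only, u = y / x works. *)
Lemma unstable_separate s : ~ stable s ->
  exists u, [/\ u != 0, w u < 0 & 0 < w (s u)].
Proof.
move=> ns.
have [x hx] : exists x, ~ (vge w 0 x -> vge w 0 (s x)).
  by apply/existsNP => h; apply: ns; exact: stable_incl.
have [y hy] : exists y, ~ (vge w 0 (s y) -> vge w 0 y).
  by apply/existsNP => h; apply: ns; exact: stable_incl_inv.
move: hx => /not_implyP[hx hsx].
move: hy => /not_implyP[hsy hy].
have x0 : x != 0 by apply/eqP => e; apply: hsx; rewrite e linear0 vge0.
have y0 : y != 0 by apply/eqP => e; apply: hy; rewrite e vge0.
exists (y / x); rewrite fmorph_div.
have sx0 : s x != 0 by rewrite fmorph_eq0.
have sy0 : s y != 0 by rewrite fmorph_eq0.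
move: hx hsx hy hsy; rewrite !vge_nz // => hx /negP hsx /negP hy hsy.
rewrite -ogltNge in hsx; rewrite -ogltNge in hy.
rewrite !prevalM ?invr_eq0 // !prevalV //; split; first by rewrite mulf_neq0 ?invr_eq0.
  by rewrite -ogopp_gt0 opprB ogsub_gt0; exact: lt_le_trans hx.
by rewrite ogsub_gt0; exact: lt_le_trans hsy.
Qed.

Hypothesis archH : archimedean_group H.
Hypothesis w_nontrivial : exists2 x : L, x != 0 & w x < 0.

(** Induction as in the approximation theorem: t serves for S and u for the new s. Either t already
    serves for s, or a large power of t times u does, after a correction when t has negative value
    at s. *)
Lemma weak_approx (S : seq (gal_of {:L})) :
  (forall s, s \in S -> ~ stable s) ->
  exists t : L, [/\ t != 0, w t < 0 & forall s, s \in S -> 0 < w (s t)].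
Proof.
elim: S => [_|s S IH hS]; first by case: w_nontrivial => x x0 hx; exists x; split.
have [|t [t0 ht hSt]] := IH; first by move=> i iS; apply: hS; rewrite in_cons iS orbT.
have [|u [u0 hu hsu]] := @unstable_separate s; first by apply: hS; rewrite mem_head.
have nz (r : gal_of {:L}) x : x != 0 -> r x != 0 by rewrite fmorph_eq0.
have [n [n0 hn]] : exists n, (0 < n)%N /\
    forall r, r \in S -> 0 < w (r t) *+ n + w (r u).
  elim: S hSt {IH hS} => [_|r S IH hSt]; first by exists 1%N.
  have [|n [n0 hn]] := IH; first by move=> i iS; apply: hSt; rewrite in_cons iS orbT.
  have [m hm] := archimedean_shift archH (w (r u)) 0 (hSt r (mem_head _ _)).
  exists (maxn n m); split=> [|i]; first by rewrite leq_max n0.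
  rewrite in_cons => /orP[/eqP ->|iS]; first by apply: hm; exact: leq_maxr.
  apply: lt_le_trans (hn i iS) _; rewrite ogle_add2r; apply: ogle_Mn2; last exact: leq_maxl.
  by apply: ltW; apply: hSt; rewrite in_cons iS orbT.
have wtn : w (t ^+ n) < 0.
  by rewrite prevalX // -(prednK n0); exact: ogMn_lt0.
have main (r : gal_of {:L}) : w (r (t ^+ n * u)) = w (r t) *+ n + w (r u).
  by rewrite rmorphM rmorphXn prevalM ?expf_neq0 ?nz // prevalX ?nz.
case: (og_trichotomy 0 (w (s t))) => st.
- by exists t; split => // r; rewrite in_cons => /orP[/eqP ->|/hSt].
- have st' : ~~ (0 <= w (s t)) by rewrite -ogltNge.
  (* t^n / d has value 0 where t has negative value, at 1 and s, and the value of t^n on S. Hence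
     t^n u / d behaves like u at 1 and s, and is small on S. *)
  pose d := 1 + t ^+ n.
  have hd (r : gal_of {:L}) : w (r t) < 0 -> r d != 0 /\ w (r d) = w (r t) *+ n.
    move=> h; rewrite -(prevalX _ _ (nz r t t0)) /d (rmorphD r) rmorph1 rmorphXn addrC.
    apply: preval_dominant; first by rewrite expf_neq0 ?nz.
    by rewrite vgt_nz ?oner_neq0 // preval1 prevalX ?nz //
      -(prednK n0) ogMn_lt0.
  have [d0 wd] : d != 0 /\ w d = w t *+ n by have := hd 1%g; rewrite !gal_id; apply.
  exists (t ^+ n * u / d); split; first by rewrite !mulf_neq0 ?expf_neq0 ?invr_eq0.
    rewrite prevalM ?mulf_neq0 ?expf_neq0 ?invr_eq0 // prevalV // wd //.
    by rewrite prevalM ?expf_neq0 // prevalX // addrAC subrr add0r.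
  move=> r; rewrite fmorph_div prevalM ?invr_eq0 ?nz ?mulf_neq0 ?expf_neq0 //.
  rewrite main prevalV ?nz // in_cons => /orP[/eqP ->|rS].
    by have [_ ->] := hd s st; rewrite addrAC subrr add0r.
  have [_ _] := (n0, n0); have h := hn r rS.
  have [_ ->] : r d != 0 /\ w (r d) = w 1.
    rewrite /d (rmorphD r) rmorph1; apply: preval_dominant; first exact: oner_neq0.
    rewrite preval1 rmorphXn vgt_nz ?expf_neq0 ?nz // prevalX ?nz //.
    by rewrite -(prednK n0) ogMn_gt0 // hSt.
  by rewrite preval1 subr0.
- exists (t ^+ n * u); split; first by rewrite mulf_neq0 ?expf_neq0.
    rewrite prevalM ?expf_neq0 // -ogopp_gt0 opprD; apply: ogD_gt0.
      by rewrite ogopp_gt0.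
    by rewrite ltW // ogopp_gt0.
  move=> r; rewrite in_cons => /orP[/eqP ->|/hn]; rewrite main //.
  by rewrite -st mul0rn add0r.
Qed.

(** Take y = t^n / (1 + t^n): it tends to 1 where t has negative value and to 0 where t has positive
    value, and the Archimedean property provides n. *)
Lemma stable_closed_unit (g : H) : 0 <= g ->
  exists y, vgt w g (y - 1) /\ forall s, ~ stable s -> vgt w g (s y).
Proof.
move=> g0; pose S := [seq s <- enum {: gal_of {:L}} | ~~ `[< stable s >]].
have memS s : s \in S <-> ~ stable s.
  by rewrite mem_filter mem_enum andbT; split=> [/asboolPn|/asboolPn].
have [|t [t0 ht hSt]] := @weak_approx S; first by move=> s /memS.
have nz (r : gal_of {:L}) x : x != 0 -> r x != 0 by rewrite fmorph_eq0.
have [n [n0 hn hnS]] : exists n, [/\ (0 < n)%N, g < - w t *+ n &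
    forall r, r \in S -> g < w (r t) *+ n].
  elim: S hSt {memS} => [_|r S IH hSt].
    have [|n hn] := archimedean_shift archH 0 g (a := - w t); first by rewrite ogopp_gt0.
    exists n.+1; split => //; rewrite -[ltRHS]addr0; exact: hn.
  have [|n [n0 hn hnS]] := IH; first by move=> i iS; apply: hSt; rewrite in_cons iS orbT.
  have [m hm] := archimedean_shift archH 0 g (hSt r (mem_head _ _)).
  exists (maxn n m); split => [||i]; first by rewrite leq_max n0.
    apply: lt_le_trans hn _; apply: ogle_Mn2; last exact: leq_maxl.
    by rewrite ltW // ogopp_gt0.
  rewrite in_cons => /orP[/eqP ->|iS].
    by rewrite -[ltRHS]addr0; apply: hm; exact: leq_maxr.
  apply: lt_le_trans (hnS i iS) _; apply: ogle_Mn2; last exact: leq_maxl.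
  by apply: ltW; apply: hSt; rewrite in_cons iS orbT.
pose d := 1 + t ^+ n.
have wtn : w (t ^+ n) < 0 by rewrite prevalX // -(prednK n0); exact: ogMn_lt0.
have [d0 wd] : d != 0 /\ w d = w t *+ n.
  rewrite -prevalX // /d addrC; apply: preval_dominant; first exact: expf_neq0.
  by rewrite vgt_nz ?oner_neq0 // preval1.
exists (t ^+ n / d); split.
  have -> : t ^+ n / d - 1 = - d^-1.
    by apply: (mulIf d0); rewrite mulrBl mul1r divfK // mulNr mulVf // /d opprD addrCA subrr addr0.
  by rewrite vgtN vgt_nz ?invr_eq0 // prevalV // wd -mulNrn.
move=> s /memS sS; rewrite fmorph_div rmorphXn.
have [sd0 swd] : s d != 0 /\ w (s d) = w 1.
  rewrite /d (rmorphD s) rmorph1; apply: preval_dominant; first exact: oner_neq0.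
  rewrite preval1 rmorphXn vgt_nz ?expf_neq0 ?nz // prevalX ?nz //.
  by rewrite -(prednK n0) ogMn_gt0 // hSt.
rewrite vgt_nz ?mulf_neq0 ?invr_eq0 ?expf_neq0 ?nz // prevalM ?expf_neq0 ?invr_eq0 ?nz //.
by rewrite prevalV ?nz // swd preval1 oppr0 addr0 prevalX ?nz // hnS.
Qed.

End Splitting.

Section Density.
Variables (F : fieldType) (L : splittingFieldType F) (H : ordAbGroupType).
Variable w : valuation L H.
Let pw := preval_of w.

Lemma mem_splitting_group (E : {vspace L}) (s : gal_of {:L}) :
  s \in splitting_group w E <-> s \in 'Gal({:L} / E)%g /\ stable pw s.
Proof.
rewrite inE; split=> [/andP[-> /asboolP h]|[-> h]].
  split=> // x; apply/idP/idP => hx; last by apply/h; exists x.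
  by have [y hy /fmorph_inj <-] := (h (s x)).1 hx.
apply/asboolP => y; split=> [hy|[x hx <-]]; last by move: (h x); rewrite /vge /vring /= => ->.
exists ((s^-1)%g y); last by rewrite -gal_mulE mulVg gal_id.
by move: (stableV h y); rewrite /vge /vring /= => ->.
Qed.

Lemma splitting_group_set (E : {subfield L}) : group_set (splitting_group w E).
Proof.
apply/group_setP; split=> [|s t /mem_splitting_group[s1 s2] /mem_splitting_group[t1 t2]].
  by apply/mem_splitting_group; split; [exact: group1 | exact: stable1].
by apply/mem_splitting_group; split; [exact: groupM | exact: stableM].
Qed.

Canonical splitting_Group E := group (splitting_group_set E).

Hypothesis galL : galois 1 {:L}.
Hypothesis archH : archimedean_group H.
Hypothesis w_nontrivial : exists2 x : L, x != 0 & w x < 0.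

Let D := splitting_group w 1%VS.
Let DG : {group gal_of {:L}} := splitting_Group 1%AS.

Lemma gal1_all (s : gal_of {:L}) : s \in 'Gal({:L} / 1)%g.
Proof. by rewrite gal_kHom ?sub1v // k1HomE ahomWin. Qed.

Lemma splitting1P (s : gal_of {:L}) : s \in D <-> stable pw s.
Proof.
by rewrite mem_splitting_group; split=> [[]//|h]; split=> //; exact: gal1_all.
Qed.

(* In rank one the base field is dense in the decomposition field: multiply a
   by an element close to 1 whose conjugates outside D are small, and take the
   sum of the conjugates. *)
Lemma decomposition_field_dense (a : L) (g : H) : a \in fixedField D ->
  exists2 c : L, c \in 1%VS & vgt pw g (a - c).
Proof.
move=> aD.
have [b0 [b0le hb0]] := og_lower_bound (fun s : gal_of {:L} => w (s a)).
(* The bound [b0] is subtracted to make up for the loss of value when multiplying by a conjugate of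
   [a]. *)
pose g' := (if 0 <= g then g else 0) - b0.
have g'0 : 0 <= g'.
  by apply: ogD_ge0; [case: ifP => //; rewrite lexx | rewrite -ogopp_le0 opprK].
have g'b : g <= g' + b0.
  by rewrite subrK; case: ifP => // h; apply: ltW; rewrite ogltNge h.
have [y [hy1 hyS]] := @stable_closed_unit _ _ _ pw archH w_nontrivial _ g'0.
have sa (s : gal_of {:L}) x : vgt pw g' x -> vgt pw g (x * s a).
  have [->|a0] := eqVneq a 0; first by rewrite linear0 mulr0 vgt0.
  move=> hx; apply: vgt_le g'b _; apply: vgtM => //.
  by rewrite vge_nz ?fmorph_eq0 // hb0.
(* The product over D makes Y invariant under D. It stays close to 1, while a conjugate by some s
   outside D has only factors outside D, hence is small. *)
pose Y := \prod_(s in D) s y.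
have YD : Y \in fixedField D.
  apply/(fixedFieldP (E := {:L}%AS) (A := D) (memvf Y)) => t tD.
  rewrite /Y rmorph_prod [RHS](reindex_acts 'R _ (tD : t \in DG)) ?astabsR //=.
  by apply: eq_bigr => s sD; rewrite gal_mulE.
have Y1 : vgt pw g' (Y - 1).
  rewrite /Y; elim/big_ind: _ => [|p q hp hq|s /splitting1P sD].
  - by rewrite subrr vgt0.
  - have -> : p * q - 1 = (p - 1) * (q - 1) + ((p - 1) + (q - 1)) by ring.
    apply: vgtD; last exact: vgtD.
    rewrite -[g']addr0; apply: vgtM => //; apply: vge_le g'0 _; exact: vgtW.
  - have -> : s y - 1 = s (y - 1) by rewrite (rmorphB s) rmorph1.
    have [->|n0] := eqVneq (y - 1) 0; first by rewrite (rmorph0 s) vgt0.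
    by rewrite vgt_nz ?fmorph_eq0 // [preval_fun _ _]stable_preval //; rewrite vgt_nz in hy1.
have YS (s : gal_of {:L}) : s \notin D -> vgt pw g' (s Y).
  move=> sD; rewrite /Y rmorph_prod (bigD1 1%g) /=; last exact: (group1 DG).
  rewrite gal_id -[g']addr0; apply: vgtM.
    by apply: hyS => /splitting1P; rewrite (negbTE sD).
  elim/big_ind: _ => [|p q hp hq|t /andP[/splitting1P tD _]]; first exact: vge1.
    exact: vge0M.
  apply/(vge_le g'0)/vgtW; rewrite -gal_mulE; apply: hyS => h.
  by move/negP: sD; apply; apply/splitting1P; exact: stableMl tD h.
pose b := a * Y.
have bD : b \in fixedField D by rewrite rpredM.
have /galois_factors := galL => /(_ (sub1v _) b (memvf _)) [r /= [rG ur mb]].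
set rb := map _ r in ur mb.
have hrb : rb != [::].
  apply/eqP => e; have := root_minPoly 1%AS b.
  by rewrite mb e big_nil rootE hornerC oner_eq0.
(* The sum of the distinct conjugates of b, a coefficient of its minimal polynomial. As b is fixed
   by D, every conjugate other than b comes from outside D and is small. *)
pose c := \sum_(x <- rb) x.
exists c.
  have := minPolyOver 1%AS b => /polyOverP/(_ (size rb).-1).
  by rewrite mb coefPn_prod_XsubC ?size_eq0 // memvN.
have brb : b \in rb.
  by rewrite -root_prod_XsubC -mb root_minPoly.
rewrite /c (bigD1_seq b) //= opprD addrA; apply: vgtB.
  rewrite /b -[X in X - _]mulr1 -mulrBr -opprB mulrN vgtN mulrC.
  by have := sa 1%g _ Y1; rewrite gal_id.
rewrite big_seq_cond; apply: vgt_sum => x /andP[/mapP[s _ ->] nb].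
have sD : s \notin D.
  apply: contra nb => sD; have [_ /(_ s sD) ->] := mem_fixedFieldP bD; exact: eqxx.
by rewrite rmorphM mulrC; apply: sa; exact: YS.
Qed.

End Density.

Lemma og_argmin (G : ordAbGroupType) (I : finType) (P : pred I) (g : I -> G) :
  (exists i, P i) -> exists2 i, P i & forall j, P j -> g i <= g j.
Proof.
suff [none|[i Pi mi]] : {in enum I, forall i, ~~ P i} \/
    exists2 i, P i & {in enum I, forall j, P j -> g i <= g j}.
- by case=> i Pi; have := none i (mem_enum _ _); rewrite Pi.
- by move=> _; exists i => // j; apply: mi; rewrite mem_enum.
elim: (enum I) => [|j s [none|[i Pi mi]]]; first by left.
  have [Pj|nPj] := boolP (P j); last first.
    by left=> i; rewrite in_cons => /orP[/eqP ->|/none].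
  right; exists j => // i; rewrite in_cons => /orP[/eqP ->|/none/negbTE -> //].
  by rewrite lexx.
right; have [/andP[Pj lt]|] := boolP (P j && (g j < g i)).
  exists j => // l; rewrite in_cons => /orP[/eqP ->|/mi h /h]; first by rewrite lexx.
  by apply: le_trans; exact: ltW.
rewrite negb_and => h; exists i => // l; rewrite in_cons => /orP[/eqP -> Pj|/mi //].
by move: h; rewrite Pj /= -ogleNgt.
Qed.

(** * Residue fields of algebraic extensions *)

Section Residue.
Variables (F : fieldType) (L : fieldExtType F) (H : ordAbGroupType).
Variables (w : prevaluation L H) (k : closedFieldType) (c : {rmorphism k -> L}).
Hypothesis w_c : forall a, a != 0 -> w (c a) = 0.
Hypothesis res1 : forall x : L, x \in 1%VS -> vge w 0 x -> exists a, vgt w 0 (x - c a).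

Lemma vge_const a : vge w 0 (c a).
Proof.
have [->|a0] := eqVneq a 0; first by rewrite rmorph0 vge0.
by rewrite vge_nz ?fmorph_eq0 // w_c.
Qed.

(** Dividing the minimal polynomial by its coefficient of least value makes its reduction a nonzero
    polynomial over k. This splits, and since its value at x is in the maximal ideal, so is one
    factor x - a. *)
Lemma algebraic_residue (x : L) : vge w 0 x -> exists a, vgt w 0 (x - c a).
Proof.
move=> x0; pose p := minPoly 1%AS x; pose n := size p.
have p0 : p != 0 by rewrite monic_neq0 ?monic_minPoly.
have n0 : (0 < n)%N by rewrite size_poly_gt0.
have [|j pj mj] := @og_argmin _ 'I_n (fun j => p`_j != 0) (fun j => w p`_j).
  have lt : (n.-1 < n)%N by rewrite prednK.
  by exists (Ordinal lt); rewrite /= -lead_coefE lead_coef_eq0.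
pose q i := p`_i / p`_j.
have p1 i : p`_i \in 1%VS by apply: (polyOverP (minPolyOver 1%AS x)).
have q1 i : q i \in 1%VS by apply: (rpred_div (p1 i) (p1 j)).
have qge i : vge w 0 (q i).
  have [lt|ge] := ltnP i n; last by rewrite /q nth_default // mul0r vge0.
  have [e|pi0] := eqVneq p`_i 0; first by rewrite /q e mul0r vge0.
  rewrite vge_nz ?mulf_neq0 ?invr_eq0 // prevalM ?invr_eq0 // prevalV //.
  by rewrite ogsub_ge0; exact: (mj (Ordinal lt)).
have [a ha] := choice (fun i : nat => res1 (q1 i) (qge i)).
pose P := \poly_(i < n) a i.
have aj : a j != 0.
  apply/eqP => e; have := ha j.
  by rewrite /q divff // e rmorph0 subr0 vgt1.
have P0 : P != 0.
  by apply/eqP => e; have := coef_poly n a j; rewrite -/P e coef0 ltn_ord => /esym/eqP; rewrite (negbTE aj).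
have Px : vgt w 0 (map_poly c P).[x].
  have -> : (map_poly c P).[x] = - \sum_(i < n) (q i - c (a i)) * x ^+ i.
    have e : \sum_(i < n) q i * x ^+ i = 0.
      have := root_minPoly 1%AS x; rewrite -/p /root horner_coef -/n => /eqP e.
      transitivity ((\sum_(i < n) p`_i * x ^+ i) / p`_j); last by rewrite e mul0r.
      by rewrite mulr_suml; apply: eq_bigr => i _; rewrite /q mulrAC.
    rewrite (@horner_coef_wide _ n); last by rewrite size_map_poly size_poly.
    rewrite [X in _ = - X](eq_bigr (fun i : 'I_n => q i * x ^+ i - c (a i) * x ^+ i)); last first.
      by move=> i _; rewrite mulrBl.
    rewrite sumrB e sub0r opprK; apply: eq_bigr => i _.
    by rewrite coef_map coef_poly ltn_ord.
  by rewrite vgtN; apply: vgt_sum => i _; apply: vgt0M => //; exact: vge0X.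
have [r er] := closed_field_poly_normal P.
move: Px; rewrite er map_polyZ /= hornerZ => /(vgt0_prime (vge_const _)).
rewrite vgt_nz ?fmorph_eq0 ?lead_coef_eq0 // w_c ?lead_coef_eq0 // ltxx /=.
have eP : (map_poly c (\prod_(z <- r) ('X - z%:P))).[x] = \prod_(z <- r) (x - c z).
  rewrite rmorph_prod horner_prod; apply: eq_bigr => z _.
  by rewrite rmorphB /= map_polyX map_polyC /= hornerXsubC.
rewrite eP => h; have [||z] := vgt0_prod _ (h _); last by exists z.
  by move=> z; rewrite vgeB // vge_const.
by elim/big_ind: _ => *; rewrite ?vge1 ?vge0M // vgeB // vge_const.
Qed.

End Residue.

(** Two distinct primes in the maximal ideal would put 1 there, by Bezout. Thus the defect formulas
    over K and over K* involve the same p. *)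
Lemma residue_char_exponent_uniq (F : fieldType) (G : ordAbGroupType)
    (v : valuation F G) (p q : nat) :
  residue_char_exponent v p -> residue_char_exponent v q -> p = q.
Proof.
pose pv := preval_of v.
case=> [[pp vp]|[-> np]]; case=> [[pq vq]|[-> nq]] //; last 2 first.
- by have := nq p pp; rewrite vp.
- by have := np q pq; rewrite vq.
apply/eqP; apply: contraT => pneq.
have cop : coprime p q by rewrite prime_coprime // dvdn_prime2.
have vnat m : vge pv 0 m%:R.
  by elim: m => [|m IH]; rewrite ?vge0 // mulrS vgeD ?vge1.
have [a b e _] := egcdnP q (prime_gt0 pp).
have : vgt pv 0 1.
  have -> : 1 = a%:R * p%:R - b%:R * q%:R :> F.
    by rewrite -!natrM e (eqP cop) natrD addrC addKr.
  by rewrite vgtB // mulrC vgt0M.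
by rewrite vgt1.
Qed.

(** If a and b are the residues of u_0 and u_1, then b u_0 - a u_1 is in the maximal ideal. Freeness
    gives b = 0, so u_1 itself is in the maximal ideal, which contradicts freeness again. *)
Lemma residue_degree_one (F : fieldType) (L : splittingFieldType F)
    (G : ordAbGroupType) (w : valuation L G) (E : {subfield L})
    (k : closedFieldType) (c : {rmorphism k -> L}) (d : nat) :
  (forall a, a != 0 -> w (c a) = 0) -> (forall a, c a \in E) ->
  (forall x, vring w x -> exists a, vmax w (x - c a)) ->
  residue_degree w E d -> d = 1%N.
Proof.
move=> wc cE res [u [u0 gen free]]; pose pw := preval_of w.
have vc a : vge pw 0 (c a) by apply: vge_const.
case: d u u0 gen free => [|[|d]] // u u0 gen free.
  have [|b [_]] := gen 1; first exact: (vge1 pw).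
  rewrite big_ord0 subr0 => h; by have := vgt1 pw; rewrite [vgt _ _ _]h.
have [a ha] := res _ (u0 0); have [b hb] := res _ (u0 1).
pose e (i : 'I_d.+2) : L := if i == 0 then c b else if i == 1 then - c a else 0.
have eE i : e i \in E /\ vring w (e i).
  rewrite /e; case: eqP => _; first by split; [exact: cE | exact: vc].
  case: eqP => _; last by rewrite mem0v /vring eqxx.
  by split; [rewrite memvN cE | have := vc a; rewrite -vgeN].
have small : vmax w (\sum_i e i * u i).
  rewrite (bigD1 0) //= (bigD1 1) //= big1 => [|i /andP[i0 i1]]; last first.
    by rewrite /e (negbTE i0) (negbTE i1) mul0r.
  rewrite /e /= addr0.
  have -> : c b * u 0 + - c a * u 1 = (u 0 - c a) * c b - (u 1 - c b) * c a by ring.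
  by apply: (@vgtB _ _ pw); apply: vgt0M.
have b0 : b = 0.
  apply/eqP; apply: contraT => bn; have := free e eE small 0.
  by rewrite /e eqxx /vmax fmorph_eq0 (negbTE bn) wc // ltxx.
have h := hb; rewrite b0 rmorph0 subr0 in h.
pose e' (i : 'I_d.+2) : L := (i == 1)%:R.
have eE' i : e' i \in E /\ vring w (e' i).
  by rewrite /e'; case: (_ == _); rewrite ?mem1v ?mem0v; split=> //; [exact: (vge1 pw)|exact: (vge0 pw)].
have small' : vmax w (\sum_i e' i * u i).
  rewrite (bigD1 1) //= /e' eqxx mul1r big1 ?addr0 // => i /negbTE ->; exact: mul0r.
have := free e' eE' small' 1; rewrite /e' eqxx => h1.
by have := vgt1 pw; rewrite [vgt _ _ _]h1.
Qed.

(** * Defectless extensions *)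

(** Pigeonhole: among the multiples of a by 0, ..., e two lie in the same coset of B. *)
Lemma has_index_torsion (G : zmodType) (A B : G -> Prop) (e : nat) :
  has_index A B e ->
  (forall a b, B a -> B b -> B (a - b)) -> (forall n a, A a -> A (a *+ n)) ->
  forall a, A a -> exists n, B (a *+ n.+1).
Proof.
case=> c [_ hc] Bsub An a Aa.
have [J hJ] := choice (fun m : nat => hc _ (An m a Aa)).
have /injectivePn[x [y nxy exy]] : ~~ injectiveb (fun m : 'I_e.+1 => J m).
  by apply/injectiveP => inj; have := leq_card _ inj; rewrite !card_ord ltnn.
wlog lt : x y nxy exy / (x < y)%N => [hw|].
  case: (ltngtP x y) => [|lt|/val_inj exy']; first exact: hw.
    by apply: (hw y x) => //; rewrite eq_sym.
  by rewrite exy' eqxx in nxy.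
exists (y - x).-1; rewrite prednK ?subn_gt0 // mulrnBr ?(ltnW lt) //.
have [+ _] := hJ y; have [+ _] := hJ x; rewrite -exy /= => hx hy.
by have := Bsub _ _ hy hx; rewrite opprB addrA addrNK.
Qed.

(** Averaging over the fibres. With I the classes of values of L modulo K and J those modulo K*, a
    fibre yields at least e1 / e2 values of K* that are distinct modulo K. *)
Lemma fiber_large (I J : finType) (g : I -> J) : (0 < #|I|)%N ->
  exists2 i0, (#|I| <= #|[set i | g i == g i0]| * #|J|)%N & true.
Proof.
move=> I0.
suff [j hj] : exists j, (#|I| <= #|[set i | g i == j]| * #|J|)%N.
  have [/set0Pn[i]|] := boolP ([set i | g i == j] != set0).
    by rewrite inE => /eqP e; exists i => //; rewrite e.
  by rewrite negbK => /eqP e; move: hj; rewrite e cards0 leqNgt I0.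
apply: contrapT => no.
have lt j : (#|[set i | g i == j]| * #|J| < #|I|)%N.
  by rewrite ltnNge; apply/negP => h; apply: no; exists j.
have sum : (\sum_j #|[set i | g i == j]| = #|I|)%N.
  rewrite -sum1_card (partition_big g predT) //=; apply: eq_bigr => j _.
  by rewrite -sum1_card; apply: eq_bigl => i; rewrite inE.
have [i _] : exists i : I, true by case/card_gt0P: I0 => i; exists i.
have : (\sum_(j : J) (#|[set i | g i == j]| * #|J|) < \sum_(j : J) #|I|)%N.
  apply: (@leq_ltn_trans (\sum_(j : J) #|I|.-1)).
    by apply: leq_sum => j _; rewrite -ltnS prednK.
  by rewrite !sum_nat_const ltn_pmul2l ?prednK //; apply/card_gt0P; exists (g i).
by rewrite -big_distrl /= sum sum_nat_const mulnC ltnn.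
Qed.

Lemma in_alg_eq0 (F : fieldType) (A : fieldExtType F) (x : F) :
  (x%:A == 0 :> A) = (x == 0).
Proof. by rewrite scaler_eq0 oner_eq0 orbF. Qed.

Section Dichotomy.
Variables (F : fieldType) (K : fieldExtType F) (G : ordAbGroupType).
Variables (v : valuation K G) (k : closedFieldType) (c : {rmorphism k -> F}).
Hypothesis v_c : forall a, a != 0 -> v (c a)%:A = 0.
Hypothesis res : forall x, vring v x -> exists a, vmax v (x - (c a)%:A).
Hypothesis archG : archimedean_group G.
Hypothesis Gn0 : exists g : G, g != 0.

Let pv := preval_of v.

(** In what follows E1 and E2 are the decomposition fields over F and over K. A fibre S of classes
    of values gives elements [b m] of K, independent over E1 because of their values, and the defect
    hypothesis bounds the degree of E2 over E1 by #|S|. So z has coordinates in E1, and the two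
    cases depend on whether a coordinate other than that of 1 is nonzero. *)
Lemma defectless_dichotomy : has_defect v 0 -> forall z : K,
  (exists b : F, z != b%:A /\ forall b' : F, b' != 0 -> v (z - b%:A) <> v b'%:A) \/
  (forall g, exists b : F, vgt pv g (z - b%:A)).
Proof.
case=> L [i [H [w [a [b [[galL _] [h [hle hw]] dw1 dwi]]]]]].
rewrite addn0 => ab; subst b => z; pose pw := preval_of w.
have hlt x y : (x < y) = (h x < h y) by rewrite !ogltNge hle.
have iA (x : F) : i x%:A = x%:A by exact: rmorph_alg.
have hinj : injective h.
  by move=> x y e; apply/le_anti; rewrite !hle e lexx.
have wA (x : F) : x != 0 -> w x%:A = h (v x%:A).
  by move=> x0; rewrite -iA hw // in_alg_eq0.
have [e1 [f1 [p1 [ram1 rd1 rc1 card1 _]]]] := dw1.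
have [e2 [f2 [p2 [ram2 rd2 rc2 card2 _]]]] := dwi.
have ep : p2 = p1 := residue_char_exponent_uniq rc2 rc1; subst p2.
pose cL : {rmorphism k -> L} := (GRing.in_alg L) \o c.
have wc x : x != 0 -> w (cL x) = 0.
  by move=> x0; rewrite /cL /= wA ?fmorph_eq0 // v_c // raddf0.
have resL x : vring w x -> exists a, vmax w (x - cL a).
  apply: (@algebraic_residue _ _ _ pw) => // y /vlineP[y' ->] hy.
  have [->|y0] := eqVneq y' 0; first by exists 0; rewrite scale0r rmorph0 subr0 vgt0.
  have : vring v y'%:A.
    move: hy; rewrite /vring vge_nz ?in_alg_eq0 // [preval_fun _ _]wA //.
    by rewrite (negbTE y0) -[X in X <= _](raddf0 h) -hle.
  case/res => d hd; exists d.
  have e : y'%:A - cL d = i (y'%:A - (c d)%:A) by rewrite linearB /= !iA.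
  rewrite e /vgt fmorph_eq0; case/orP: hd => [->//|hd].
  have [->//|n0 /=] := eqVneq (y'%:A - (c d)%:A) 0.
  by rewrite hw // -[X in X < _](raddf0 h) -hlt.
have f11 : f1 = 1%N.
  apply: (residue_degree_one (E := 1%AS)) wc _ resL rd1.
  by move=> x; apply/vlineP; exists (c x).
have f21 : f2 = 1%N.
  apply: (residue_degree_one (E := (limg i)%AS)) wc _ resL rd2.
  by move=> x; rewrite /cL /= -iA memv_img ?memvf.
rewrite f11 muln1 in card1; rewrite f21 muln1 in card2.
have p0 : (0 < p1 ^ a)%N by rewrite expn_gt0; case: rc1 => [[/prime_gt0 -> _]|[-> _]].
pose D1 := splitting_Group w 1%AS; pose D2 := splitting_Group w (limg i)%AS.
have D21 : (D2 \subset D1).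
  apply/subsetP => s /mem_splitting_group[_ hs]; exact/splitting1P.
(* The power of p is the same on both sides because the difference of the two defects is 0, and
   cancels. *)
have cardD : (#|D1| * e2 = #|D2| * e1)%N.
  by rewrite /= card1 card2 mulnAC [RHS]mulnAC (mulnC e1).
have D1_gt0 : (0 < #|D1|)%N := cardG_gt0 _.
have D2_gt0 : (0 < #|D2|)%N := cardG_gt0 _.
have e1_gt0 : (0 < e1)%N by move: D1_gt0; rewrite /= card1; case: (e1).
have e2_gt0 : (0 < e2)%N by move: D2_gt0; rewrite /= card2; case: (e2).
pose VK := value_group w (limg i); pose VF := value_group w 1%VS.
have VsubP (E : {subfield L}) x y : value_group w E x -> value_group w E y ->
    value_group w E (x - y).
  case=> x' [x1 x2 <-] [y' [y1 y2 <-]]; exists (x' / y').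
  split; [exact: rpred_div | by rewrite mulf_neq0 ?invr_eq0 |].
  by rewrite [LHS](@prevalM _ _ pw) ?invr_eq0 // (@prevalV _ _ pw).
have V0 (E : {subfield L}) : value_group w E 0.
  by exists 1; rewrite mem1v oner_neq0; split => //; exact: (preval1 pw).
have VfM n x : value_group w fullv x -> value_group w fullv (x *+ n).
  case=> x' [_ x2 <-]; exists (x' ^+ n); split; [exact: memvf | exact: expf_neq0 |].
  exact: (@prevalX _ _ pw).
have Vfull g : value_group w fullv g.
  by have [x x0 <-] := val_onto w g; exists x; split=> //; exact: memvf.
have VKh g : VK g -> exists g', h g' = g.
  by case=> _ [/memv_imgP[x _ ->]]; rewrite fmorph_eq0 => x0 <-; exists (v x); rewrite hw.
(* The values of K have finite index in H, so a positive multiple of each element of H comes from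
   G. *)
have archH : archimedean_group H.
  have tors := has_index_torsion ram2 (@VsubP (limg i)%AS) VfM.
  move=> x y x0; have [n /VKh[x' ex]] := tors x (Vfull x).
  have [m /VKh[y' ey]] := tors y (Vfull y).
  have x'0 : 0 < x' by rewrite hlt raddf0 ex; exact: ogMn_gt0.
  have [N hN] := archG y' x'0; exists (n.+1 * N.+1)%N.
  have [y0|y0] := orP (ogle_total y 0).
    by apply: le_lt_trans y0 _; rewrite mulrnA; do 2 apply: ogMn_gt0.
  apply: (@le_lt_trans _ _ (y *+ m.+1)).
    by rewrite -[X in X <= _]mulr1n; exact: ogle_Mn2.
  move: hN; rewrite hlt ey raddfMn ex -mulrnA => /lt_le_trans; apply.
  by apply: ogle_Mn2; [exact: ltW | rewrite leq_mul2l leqnSn orbT].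
have w_nt : exists2 x : L, x != 0 & w x < 0.
  have [g g0] := Gn0.
  suff [g' hg'] : exists g' : G, g' < 0.
    have [x x0 hx] := val_onto v g'; exists (i x); first by rewrite fmorph_eq0.
    by rewrite hw // -(raddf0 h) -hlt hx.
  case: (og_trichotomy g 0) => [lt|lt|e]; first by exists g.
    by exists (- g); rewrite ogopp_lt0.
  by rewrite e eqxx in g0.
have dense := decomposition_field_dense galL archH w_nt.
pose E1 : {subfield L} := fixedField_aspace (E := {:L}%AS) D1.
pose E2 : {subfield L} := fixedField_aspace (E := {:L}%AS) D2.
have dimE (Dd : {group gal_of {:L}}) : (#|Dd| * \dim (fixedField Dd) = \dim {:L})%N.
  by rewrite (dim_fixedField Dd) divnK // field_dimS // subvf.
have E1val x : x \in E1 -> x != 0 -> VF (w x).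
  move=> xE x0; have [y y1 hy] := dense x (w x) xE.
  have [y0 wy] := @preval_eq_close _ _ pw _ _ x0 hy.
  by exists y.
case: (ram1) => c1 [_ hc1]; case: (ram2) => c2 [_ hc2].
have [J hJ] := choice (fun m : 'I_e1 => hc2 (c1 m) (Vfull _)).
have [|m0 big _] := fiber_large J; first by rewrite card_ord.
rewrite !card_ord in big; set S := [set m | _] in big.
have m0S : m0 \in S by rewrite inE.
have exb (m : 'I_e1) : exists b, m \in S ->
    [/\ b \in limg i, b != 0 & w b = c1 m - c1 m0].
  have [mS|_] := boolP (m \in S); last by exists 0.
  have [hm _] := hJ m; have [hm0 _] := hJ m0.
  rewrite inE in mS; rewrite (eqP mS) in hm.
  have := @VsubP (limg i)%AS _ _ hm hm0; rewrite opprB addrA addrNK.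
  by case=> x hx; exists x.
have [bb hbb] := choice exb.
have [bm0i bm00 wbm0] := hbb m0 m0S; rewrite subrr in wbm0.
(* The normalisation makes [b m0] equal to 1, so that the coordinate of index m0 is the part of z
   lying in E1. *)
pose b m := bb m / bb m0.
have bi m : m \in S -> b m \in limg i.
  by case/hbb => h1 _ _; apply: (@rpred_div _ (limg i)%AS).
have b0 m : m \in S -> b m != 0.
  by case/hbb => _ h1 _; rewrite mulf_neq0 ?invr_eq0.
have wb m : m \in S -> w (b m) = c1 m - c1 m0.
  case/hbb => _ h1 <-; rewrite [LHS](@prevalM _ _ pw) ?invr_eq0 //.
  by rewrite (@prevalV _ _ pw) //= wbm0 oppr0 addr0.
have bm01 : b m0 = 1 by rewrite /b divff.
have winj m m' : m \in S -> m' \in S -> VF (w (b m) - w (b m')) -> m = m'.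
  move=> mS m'S; rewrite !wb // opprB addrA addrNK => hV.
  have [j [_ uj]] := hc1 (c1 m) (Vfull _).
  rewrite -(uj m) ?subrr; last exact: (V0 1%AS).
  exact: uj.
pose U (m : 'I_e1) := (E1 * <[b m]>)%VS.
have us_inj us m m' : (forall m, m \in S -> us m \in U m) ->
    m \in S -> m' \in S -> us m != 0 -> us m' != 0 -> w (us m) = w (us m') -> m = m'.
  move=> usU mS m'S; have /memv_cosetP[x xE ->] := usU m mS.
  have /memv_cosetP[y yE ->] := usU m' m'S.
  rewrite !mulf_eq0 !negb_or => /andP[x0 _] /andP[y0 _].
  rewrite [LHS](@prevalM _ _ pw) ?b0 // [RHS](@prevalM _ _ pw) ?b0 //= => e.
  apply: winj => //.
  have -> : w (b m) - w (b m') = w y - w x.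
    by apply: (@addrI _ (w x)); rewrite addrA e addrK addrCA subrr addr0.
  by apply: (@VsubP 1%AS); exact: E1val.
(* Nonzero elements of different summands have values in different classes modulo VF, since E1 has
   the same values as F by density. *)
have dir : directv (\sum_(m in S) U m)%VS.
  apply/directv_sum_independent => us usU sum0 m mS; apply/eqP; apply: contraT => nz.
  pose s := [seq m <- enum S | us m != 0].
  have [||||m' [_ n0 _ _]] := @preval_sum_distinct _ _ pw _ s us.
  - have : m \in s by rewrite mem_filter nz mem_enum.
    by case: (s).
  - by rewrite filter_uniq ?enum_uniq.
  - by move=> j; rewrite mem_filter => /andP[].
  - move=> j j'; rewrite mem_filter mem_enum => /andP[h1 h2].
    rewrite mem_filter mem_enum => /andP[h3 h4].
    exact: (us_inj us).
  case/negP: n0; rewrite -[X in _ == X]sum0 /s big_filter big_enum_cond.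
  rewrite [X in _ == X](bigID (fun m => us m != 0)) /= [X in _ + X]big1 ?addr0 //.
  by move=> j /andP[_ /negPn/eqP].
have dimS : (\dim (\sum_(m in S) U m) = #|S| * \dim E1)%N.
  rewrite (directvP dir) /= -sum_nat_const; apply: eq_bigr => m mS.
  by rewrite dim_cosetv ?b0.
have E2S : (\sum_(m in S) U m = E2)%VS.
  apply/eqP; rewrite eqEdim; apply/andP; split.
    apply/subv_sumP => m mS; apply/prodvP => x y xE /vlineP[d ->].
    rewrite -scalerAr memvZ // rpredM //.
      by move: x xE; apply/subvP; exact: fixedFieldS.
    apply/(fixedFieldP (E := {:L}%AS) (A := D2) (memvf _)) => s /mem_splitting_group[hs _].
    by apply: (fixed_gal _ hs); rewrite ?subvf ?bi.
  (* With d1 and d2 the orders of D1 and D2: d1 dim E1 = d2 dim E2 = dim L, d1 e2 = d2 e1 and e1 <=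
     #|S| e2 give dim E2 <= #|S| dim E1. *)
  rewrite dimS -(leq_pmul2l D2_gt0) -(leq_pmul2l e2_gt0).
  rewrite -[X in (_ * (_ * X) <= _)%N]/(\dim (fixedField D2)) dimE -(dimE D1).
  rewrite mulnA (mulnC e2) cardD -[\dim (fixedField _)]/(\dim E1).
  rewrite (mulnC #|D2|) -!mulnA mulnCA [X in (_ <= X)%N]mulnCA.
  rewrite leq_mul2l; apply/orP; right.
  by rewrite mulnCA mulnA leq_mul2r big orbT.
have /memv_sumP[us usU zus] : i z \in (\sum_(m in S) U m)%VS.
  rewrite E2S; apply/(fixedFieldP (E := {:L}%AS) (A := D2) (memvf _)) => s.
  case/mem_splitting_group=> hs _.
  by apply: (fixed_gal _ hs); rewrite ?subvf ?memv_img ?memvf.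
have us0E : us m0 \in E1.
  by have /memv_cosetP[x xE ->] := usU m0 m0S; rewrite bm01 mulr1.
rewrite (bigD1 m0) //= in zus.
pose s := [seq m <- enum S | (m != m0) && (us m != 0)].
have zs : i z = us m0 + \sum_(m <- s) us m.
  rewrite zus /s big_filter big_enum_cond; congr (_ + _).
  rewrite [LHS](bigID (fun m => us m != 0)) /= [X in _ + X = _]big1 ?addr0.
    by apply: eq_bigl => m; rewrite andbA.
  by move=> j /andP[_ /negPn/eqP].
(* No other coordinate: z lies in E1, where F is dense. *)
have [s0|sn0] := eqVneq s [::].
  right=> g; have [y /vlineP[y' ->]] := dense _ (h g) us0E.
  by rewrite s0 big_nil addr0 in zs; rewrite -zs -iA => hy; exists y'; move: hy;
    rewrite -linearB /vgt fmorph_eq0; case: eqP => //= /eqP n0; rewrite hw // hlt.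
left; have [||||m [ms n0 wm _]] := @preval_sum_distinct _ _ pw _ s us.
- exact: sn0.
- by rewrite filter_uniq ?enum_uniq.
- by move=> j; rewrite mem_filter => /andP[/andP[]].
- move=> j j'; rewrite mem_filter mem_enum => /andP[/andP[_ h1] h2].
  rewrite mem_filter mem_enum => /andP[/andP[_ h3] h4].
  exact: (us_inj us).
set rest := \sum_(j <- s) us j in zs n0 wm.
(* Approximating the E1-part of z beyond the value of the rest leaves z - y' with the value of a
   single term of index m <> m0, which is not a value of F. *)
have [y /vlineP[y' ->] hy] := dense _ (w rest) us0E.
have [||r0 wr] := @preval_dominant _ _ pw rest (us m0 - y'%:A) => //.
have er : i (z - y'%:A) = rest + (us m0 - y'%:A).
  by rewrite linearB /= iA zs addrAC addrC addrA.
move: ms; rewrite mem_filter mem_enum => /andP[/andP[mm0 us0] mS].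
exists y'; split=> [|b' b'0 e].
  by apply: contra r0 => /eqP e; rewrite -er e subrr rmorph0.
have zn0 : z - y'%:A != 0 by apply: contra r0 => /eqP e0; rewrite -er e0 rmorph0.
have := hw _ zn0; rewrite e -wA // er [LHS]wr wm.
have /memv_cosetP[x xE exm] := usU m mS.
rewrite exm [LHS](@prevalM _ _ pw) ?b0 //; last first.
  by apply: contra us0 => /eqP x0; rewrite exm x0 mul0r.
move=> /= e2'; case/negP: mm0; apply/eqP; apply: winj => //.
rewrite bm01 [w 1](preval1 pw) subr0.
have -> : w (b m) = w b'%:A - w x by rewrite -e2' addrAC subrr add0r.
apply: (@VsubP 1%AS); last first.
  by apply: E1val => //; apply: contra us0 => /eqP x0; rewrite exm x0 mul0r.
by exists b'%:A; rewrite in_alg_eq0; split => //; apply/vlineP; exists b'.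
Qed.
End Dichotomy.

(** * Perron's algorithm *)

Section Perron.
Variables (N : nat) (G : ordAbGroupType).
Implicit Types (t : 'I_N -> G) (c : 'rV[int]_N) (A B : 'M[int]_N) (D : pred 'I_N).

(* The values of the Laurent monomials x^(B_i), and of x^c, when the variables
   x have values t. *)
Definition mact B t (i : 'I_N) : G := \sum_j t j *~ B i j.
Definition mval t c : G := \sum_j t j *~ c 0 j.

Definition supported D c := forall j, ~~ D j -> c 0 j = 0.
Definition independent D t := forall c, supported D c -> mval t c = 0 -> c = 0.

(* A and B = A^-1 describe a monomial change of variables x = x'^A, x' = x^B,
   which involves only the variables in D. *)
Record monomial_change D A B : Prop := MonomialChange {
  mc_inv : A *m B = 1%:M;
  mc_ge0 : forall i j, 0 <= A i j;
  mc_outA : forall i j, ~~ D i || ~~ D j -> A i j = (i == j)%:R;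
  mc_outB : forall i j, ~~ D i || ~~ D j -> B i j = (i == j)%:R
}.

Lemma mc_invV D A B : monomial_change D A B -> B *m A = 1%:M.
Proof. by case=> /mulmx1C. Qed.

Lemma mval_mact B t c : mval (mact B t) c = mval t (c *m B).
Proof.
rewrite /mval /mact; under eq_bigr do rewrite mulrz_suml.
rewrite exchange_big /=; apply: eq_bigr => j _; rewrite mxE mulrz_sumr.
by apply: eq_bigr => i _; rewrite -mulrzA mulrC.
Qed.

Lemma mact_mval B t i : mact B t i = mval t (row i B).
Proof. by apply: eq_bigr => j _; rewrite mxE. Qed.

Lemma mactM B1 B2 t i : mact (B1 *m B2) t i = mact B1 (mact B2 t) i.
Proof. by rewrite !mact_mval mval_mact row_mul. Qed.

Lemma mval_change D A B t c : monomial_change D A B ->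
  mval t c = mval (mact B t) (c *m A).
Proof. by move=> h; rewrite mval_mact -mulmxA (mc_inv h) mulmx1. Qed.

Lemma mvalB t c c' : mval t (c - c') = mval t c - mval t c'.
Proof. by rewrite /mval -sumrB; apply: eq_bigr => j _; rewrite !mxE mulrzBr. Qed.

Lemma mvalZ t (a : int) c : mval t (a *: c) = mval t c *~ a.
Proof. by rewrite /mval mulrz_suml; apply: eq_bigr => j _; rewrite mxE mulrC mulrzA. Qed.

Lemma mval_delta t i : mval t (delta_mx 0 i) = t i.
Proof.
rewrite /mval (bigD1 i) //= big1 ?addr0 => [|j /negbTE ji]; rewrite mxE eqxx ?ji //.
by rewrite eqxx.
Qed.

Lemma monomial_change1 D : monomial_change D 1%:M 1%:M.
Proof.
by split=> [|i j|i j _|i j _]; rewrite ?mulmx1 ?mxE //; case: (_ == _).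
Qed.

Lemma monomial_changeM D A1 B1 A2 B2 :
  monomial_change D A1 B1 -> monomial_change D A2 B2 ->
  monomial_change D (A1 *m A2) (B2 *m B1).
Proof.
have out (M1 M2 : 'M[int]_N) :
    (forall i j, ~~ D i || ~~ D j -> M1 i j = (i == j)%:R) ->
    (forall i j, ~~ D i || ~~ D j -> M2 i j = (i == j)%:R) ->
    forall i j, ~~ D i || ~~ D j -> (M1 *m M2) i j = (i == j)%:R.
  move=> h1 h2 i j ij; rewrite mxE; case/orP: ij => [iD|jD].
    rewrite (bigD1 i) //= h1 ?iD // eqxx mul1r big1 ?addr0 => [|l /negbTE li].
      by rewrite h2 ?iD.
    by rewrite h1 ?iD // eq_sym li mul0r.
  rewrite (bigD1 j) //= h2 ?jD ?orbT // eqxx mulr1 big1 ?addr0 => [|l /negbTE lj].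
    by rewrite h1 ?jD ?orbT.
  by rewrite h2 ?jD ?orbT // lj mulr0.
case=> i1 p1 a1 b1 [i2 p2 a2 b2]; split.
- by rewrite mulmxA -(mulmxA A1) i2 mulmx1.
- by move=> i j; rewrite mxE sumr_ge0 // => l _; rewrite mulr_ge0.
- exact: out.
- exact: out.
Qed.

Lemma monomial_changeS D D' A B : (forall i, D i -> D' i) ->
  monomial_change D A B -> monomial_change D' A B.
Proof.
move=> DD' [h1 h2 h3 h4]; split=> // i j h; [apply: h3 | apply: h4];
  by case/orP: h => h; apply/orP; [left|right]; apply: contra h; exact: DD'.
Qed.

Lemma supported_change D A B c : monomial_change D A B ->
  supported D c -> supported D (c *m A).
Proof.
move=> h cD j jD; rewrite mxE big1 // => i _.
have [iD|iD] := boolP (D i); last by rewrite cD // mul0r.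
rewrite (mc_outA h) ?jD ?orbT //; case: eqP => [e|_]; last by rewrite mulr0.
by rewrite -e iD in jD.
Qed.

Lemma supported_changeV D A B c : monomial_change D A B ->
  supported D c -> supported D (c *m B).
Proof.
move=> h cD j jD; rewrite mxE big1 // => i _.
have [iD|iD] := boolP (D i); last by rewrite cD // mul0r.
rewrite (mc_outB h) ?jD ?orbT //; case: eqP => [e|_]; last by rewrite mulr0.
by rewrite -e iD in jD.
Qed.

Lemma independent_change D A B t : monomial_change D A B ->
  independent D t -> independent D (mact B t).
Proof.
move=> h ind c cD; rewrite mval_mact => /ind e.
have := e (supported_changeV h cD); move/(congr1 (mulmx^~ A)).
by rewrite -mulmxA (mc_invV h) mulmx1 mul0mx.
Qed.

Definition step_mx i j : 'M[int]_N := 1%:M + delta_mx i j.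
Definition step_imx i j : 'M[int]_N := 1%:M - delta_mx i j.

Lemma monomial_change_step D i j : i != j -> D i -> D j ->
  monomial_change D (step_mx i j) (step_imx i j).
Proof.
move=> ij iD jD.
have off a b : ~~ D a || ~~ D b -> (a == i) && (b == j) = false.
  by move=> h; apply/andP => -[/eqP ea /eqP eb]; move: h; rewrite ea eb iD jD.
split=> [|a b|a b h|a b h].
- rewrite mulmxDl mul1mx mulmxBr mulmx1 mul_delta_mx_0 1?eq_sym //.
  by rewrite subr0 subrK.
- by rewrite !mxE addr_ge0 ?ler0n.
- by rewrite !mxE off // addr0.
- by rewrite !mxE off // subr0.
Qed.

Lemma mact_step i j t l :
  mact (step_imx i j) t l = if l == i then t i - t j else t l.
Proof.
rewrite mact_mval.
have -> : row l (step_imx i j) = delta_mx 0 l - (l == i)%:R *: delta_mx 0 j.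
  by apply/rowP => b; rewrite !mxE eqxx /= eq_sym -mulnb natrM.
rewrite mvalB mvalZ !mval_delta; case: eqP => [->|_]; first by rewrite mulr1z.
by rewrite mulr0z subr0.
Qed.

Lemma row_step i j c l :
  (c *m step_mx i j) 0 l = if l == j then c 0 j + c 0 i else c 0 l.
Proof.
rewrite mulmxDr mulmx1 !mxE (bigD1 i) //= big1 => [|a /negbTE ai].
  by rewrite !mxE eqxx addr0 /=; case: eqP => [->|_]; rewrite ?mulr1 ?mulr0 ?addr0.
by rewrite !mxE ai mulr0.
Qed.

Lemma mact1 t : mact 1%:M t =1 t.
Proof.
move=> i; rewrite mact_mval.
have -> : row i 1%:M = delta_mx 0 i :> 'rV[int]_N by apply/rowP => j; rewrite !mxE eqxx eq_sym.
exact: mval_delta.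
Qed.

Definition same_sign D c :=
  (forall j, D j -> 0 <= c 0 j) \/ (forall j, D j -> c 0 j <= 0).

(* Each step subtracts a value from a larger one, at the positions i, j of a
   maximal and a minimal entry of c; it replaces one of these two entries by
   their sum, which lies strictly between them. *)
Lemma perron_step D t c : (forall i, D i -> 0 < t i) ->
  exists A B, [/\ monomial_change D A B, forall i, D i -> 0 < mact B t i &
    same_sign D (c *m A) \/
    exists i j, [/\ D i, D j, i != j & mact B t i = mact B t j]].
Proof.
(* Double induction: M bounds the length P + Q of the interval from -Q to P containing the entries,
   and cnt the number of entries at its ends. The interval shrinks when an end is not attained; when
   P or Q is 0 the entries have one sign. *)
suff main M : forall cnt t c (P Q : nat), (P + Q <= M)%N ->
    (#|[pred j | D j & ((c 0 j == P%:Z) || (c 0 j == - Q%:Z))%R]| <= cnt)%N ->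
    (forall j, D j -> - Q%:Z <= c 0 j <= P%:Z) ->
    (forall i, D i -> 0 < t i) ->
    exists A B, [/\ monomial_change D A B, forall i, D i -> 0 < mact B t i &
      same_sign D (c *m A) \/
      exists i j, [/\ D i, D j, i != j & mact B t i = mact B t j]].
  move=> tD; pose b := (\sum_j `|(c 0 j)%R|)%N.
  apply: (main (b + b)%N _ t c b b (leqnn _) (leqnn _)) => // j _.
  rewrite -ler_norml -abszE lez_nat /b (bigD1 j) //=; exact: leq_addr.
elim: M => [|M IHM] cnt; elim: cnt => [|cnt IHc] {}t {}c P Q PQ hcnt hc tD.
- exists 1%:M, 1%:M; split; [exact: monomial_change1|by move=> i /tD; rewrite mact1|].
  by left; left=> j /hc; rewrite mulmx1; lia.
- exists 1%:M, 1%:M; split; [exact: monomial_change1|by move=> i /tD; rewrite mact1|].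
  by left; left=> j /hc; rewrite mulmx1; lia.
all: case: (posnP P) => [P0|P0]; first by
  exists 1%:M, 1%:M; split; [exact: monomial_change1|by move=> i /tD; rewrite mact1|];
  left; right=> j /hc; rewrite mulmx1; lia.
all: case: (posnP Q) => [Q0|Q0]; first by
  exists 1%:M, 1%:M; split; [exact: monomial_change1|by move=> i /tD; rewrite mact1|];
  left; left=> j /hc; rewrite mulmx1; lia.
all: have [[i [iD ci]]|noP] := pselect (exists i, D i /\ c 0 i = P%:Z); last first.
all: try by apply: (IHM _ t c P.-1 Q _ (leqnn _)) => // [|l lD]; [lia|];
  have := hc l lD; have : c 0 l <> P%:Z by [move=> e; apply: noP; exists l]; lia.
all: have [[j [jD cj]]|noQ] := pselect (exists j, D j /\ c 0 j = - Q%:Z); last first.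
all: try by apply: (IHM _ t c P Q.-1 _ (leqnn _)) => // [|l lD]; [lia|];
  have := hc l lD; have : c 0 l <> - Q%:Z by [move=> e; apply: noQ; exists l]; lia.
  move: hcnt; rewrite leqn0 => /eqP/card0_eq/(_ i).
  by rewrite !inE iD ci eqxx.
have ij : i != j by apply/eqP => e; move: ci; rewrite e cj; lia.
(* The entry at b, one end of the interval, becomes P - Q, strictly inside it, so the count
   decreases. *)
have step a b : a != b -> D a -> D b -> c 0 a + c 0 b = P%:Z - Q%:Z ->
    (c 0 b = P%:Z \/ c 0 b = - Q%:Z) -> t b < t a ->
    exists A B, [/\ monomial_change D A B, forall i, D i -> 0 < mact B t i &
      same_sign D (c *m A) \/
      exists i j, [/\ D i, D j, i != j & mact B t i = mact B t j]].
  move=> ab aD bD cab cb tab.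
  have [|||A [B [h1 h2 h3]]] :=
      IHc (mact (step_imx a b) t) (c *m step_mx a b) P Q PQ.
  - rewrite -ltnS; apply: leq_trans hcnt; apply: proper_card; apply/properP; split.
      apply/subsetP => l; rewrite !inE row_step.
      case: (eqVneq l b) => [->|//]; rewrite bD /=; move: cab cb; lia.
    exists b; rewrite !inE ?row_step ?eqxx ?bD /=; move: cab cb; lia.
  - by move=> l lD; rewrite row_step; case: (l == b); [lia | exact: hc].
  - by move=> l lD; rewrite mact_step; case: eqP => _; rewrite ?ogsub_gt0 //; exact: tD.
  exists (step_mx a b *m A), (B *m step_imx a b); split.
  - by apply: monomial_changeM => //; exact: monomial_change_step.
  - by move=> l lD; rewrite mactM h2.
  - by rewrite mulmxA; case: h3 => [h3|[i' [j' h3]]]; [left | right; exists i', j'; rewrite !mactM].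
case: (og_trichotomy (t i) (t j)) => lt.
- apply: (step j i) => //; rewrite 1?eq_sym //; [lia | by left].
- apply: (step i j) => //; [lia | by right].
- exists 1%:M, 1%:M; split; [exact: monomial_change1|by move=> l /tD; rewrite mact1|].
  by right; exists i, j; rewrite !mact1.
Qed.

Lemma mval_supported D t c : supported D c ->
  mval t c = \sum_(j | D j) t j *~ c 0 j.
Proof.
move=> cD; rewrite /mval (bigID D) /= [X in _ + X]big1 ?addr0 // => j jD.
by rewrite cD // mulr0z.
Qed.

Lemma mval_ge0_eq0 D t c : (forall i, D i -> 0 < t i) -> supported D c ->
  (forall j, D j -> 0 <= c 0 j) -> mval t c <= 0 -> c = 0.
Proof.
move=> tD cD c0; rewrite (mval_supported _ cD) => le0.
apply/rowP => j; rewrite mxE; have [jD|/cD //] := boolP (D j).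
apply/eqP; apply: contraT => cj; move: le0.
rewrite ogleNgt (bigD1 j) //= => /negP[]; apply: ogD_gt0.
  have := c0 j jD; move: cj; case: (c 0 j) => [[|m]|m] // _ _.
  exact: ogMn_gt0 (tD _ jD).
elim/big_ind: _ => [|x y|l /andP[lD _]]; [exact: lexx | exact: ogD_ge0 |].
have := c0 l lD; case: (c 0 l) => // m _.
by apply: ogMn_ge0; exact/ltW/tD.
Qed.

Lemma mvalN t c : mval t (- c) = - mval t c.
Proof. by rewrite -scaleN1r mvalZ mulrNz mulr1z. Qed.

Lemma supportedN D c : supported D c -> supported D (- c).
Proof. by move=> h j jD; rewrite mxE h // oppr0. Qed.

Lemma same_sign_ge0 D t c : (forall i, D i -> 0 < t i) -> supported D c ->
  same_sign D c -> 0 <= mval t c -> forall j, D j -> 0 <= c 0 j.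
Proof.
move=> tD cD [h|h] h0 // j jD.
have : - c = 0.
  apply: (@mval_ge0_eq0 D t) => //; first exact: supportedN.
    by move=> l lD; rewrite mxE oppr_ge0 h.
  by rewrite mvalN ogopp_le0.
by move/eqP; rewrite oppr_eq0 => /eqP ->; rewrite mxE.
Qed.

Lemma same_sign_change D E A B c : (forall i, D i -> E i) ->
  monomial_change D A B -> same_sign D c -> same_sign D (c *m A).
Proof.
move=> DE hm h.
have e j : D j -> (c *m A) 0 j = \sum_(i | D i) c 0 i * A i j.
  move=> jD; rewrite mxE (bigID D) /= [X in _ + X]big1 ?addr0 // => i iD.
  rewrite (mc_outA hm) ?iD //; case: eqP => [ij|_]; last by rewrite mulr0.
  by rewrite ij jD in iD.
case: h => h; [left|right] => j jD; rewrite e //.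
  by apply: sumr_ge0 => i iD; rewrite mulr_ge0 ?h ?(mc_ge0 hm).
by apply: sumr_le0 => i iD; rewrite mulr_le0_ge0 ?h ?(mc_ge0 hm).
Qed.

(** Independence excludes the outcome of two equal values, and the signs already obtained persist
    because the later matrices have nonnegative entries. *)
Lemma perron_independent D t (cs : seq 'rV[int]_N) :
  (forall i, D i -> 0 < t i) -> independent D t ->
  exists A B, [/\ monomial_change D A B, forall i, D i -> 0 < mact B t i &
    forall c, c \in cs -> same_sign D (c *m A)].
Proof.
elim: cs t => [|c cs IH] t tD ind.
  exists 1%:M, 1%:M; split=> //; first exact: monomial_change1.
  by move=> i /tD; rewrite mact1.
have [A1 [B1 [h1 p1 s1]]] := IH t tD ind.
have [A2 [B2 [h2 p2 s2]]] := perron_step (c *m A1) p1.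
exists (A1 *m A2), (B2 *m B1); split.
- exact: monomial_changeM.
- by move=> i iD; rewrite mactM p2.
move=> c'; rewrite in_cons mulmxA => /orP[/eqP ->|/s1 /(same_sign_change (E := D) _ h2)]; last exact.
case: s2 => // -[i [j [iD jD ij e]]]; exfalso.
have ind2 := independent_change h2 (independent_change h1 ind).
have : delta_mx 0 i - delta_mx 0 j = 0 :> 'rV[int]_N.
  apply: ind2; last by rewrite mvalB !mval_delta e subrr.
  move=> l lD; rewrite !mxE /=; case: eqP => [el|_]; first by rewrite el iD in lD.
  by case: eqP => [el|_] //; rewrite el jD in lD.
by move/rowP/(_ i); rewrite !mxE !eqxx (negbTE ij).
Qed.

End Perron.

Section PerronDependent.
Variables (n : nat) (G : ordAbGroupType).
Implicit Types (t : 'I_n.+1 -> G) (c : 'rV[int]_n.+1).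

Lemma monomial_change_tperm (D : pred 'I_n.+1) i j : D i -> D j ->
  monomial_change D (perm_mx (tperm i j)) (perm_mx (tperm i j)).
Proof.
move=> iD jD.
have fx a : ~~ D a -> tperm i j a = a.
  by move=> aD; apply: tpermD; [move: aD | move: aD]; apply: contraNneq => <-.
have out a b : ~~ D a || ~~ D b -> (perm_mx (tperm i j) : 'M[int]_n.+1) a b = (a == b)%:R.
  rewrite !mxE => /orP[/fx -> //|/fx e].
  by rewrite -[in LHS]e (inj_eq perm_inj).
split=> //; first by rewrite -perm_mxM tperm2 perm_mx1.
by move=> a b; rewrite !mxE ler0n.
Qed.

Lemma mact_perm (s : 'S_n.+1) t l : mact (perm_mx s) t l = t (s l).
Proof.
rewrite mact_mval.
have -> : row l (perm_mx s) = delta_mx 0 (s l) :> 'rV[int]_n.+1.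
  by apply/rowP => b; rewrite !mxE eqxx /= eq_sym.
exact: mval_delta.
Qed.

(* The relation c0 between the values forces the algorithm to reach two equal
   values; the quotient of the two variables is then the only variable of value
   0, and the remaining values are independent. *)
Lemma perron_dependent (D0 : pred 'I_n.+1) t c0 (cs : seq 'rV[int]_n.+1) :
  let D := [pred i | D0 i || (i == ord_max)] in
  ~~ D0 ord_max -> (forall i, D i -> 0 < t i) -> supported D c0 -> c0 != 0 ->
  mval t c0 = 0 ->
  (forall c, supported D c -> mval t c = 0 -> exists a : int, c = a *: c0) ->
  exists A B, [/\ monomial_change D A B, mact B t ord_max = 0,
    forall i, D0 i -> 0 < mact B t i,
    exists2 e : int, e * e = 1 & c0 *m A = e *: delta_mx 0 ord_max &
    forall c, c \in cs -> same_sign D0 (c *m A)].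
Proof.
move=> D nmax tD c0D c0n0 c0rel gen.
have Dmax : D ord_max by rewrite /= eqxx orbT.
have [A1 [B1 [h1 p1 s1]]] := perron_step c0 tD.
(* A vector of one sign and of value 0, for positive values t, would be zero; so the algorithm stops
   at two equal values. *)
have [i [j [iD jD ij eij]]] :
    exists i j, [/\ D i, D j, i != j & mact B1 t i = mact B1 t j].
  case: s1 => // ss; case/eqP: c0n0.
  have c1D := supported_change h1 c0D.
  have e1 : c0 *m A1 = 0.
    have e1 := mval_change t c0 h1; rewrite c0rel in e1.
    case: ss => ss; first by apply: (mval_ge0_eq0 p1 c1D ss); rewrite -e1.
    apply: oppr_inj; rewrite oppr0; apply: (mval_ge0_eq0 p1 (supportedN c1D)).
      by move=> l /ss h; rewrite -oppr_le0 -[X in X <= _]/(- (- (c0 *m A1)) 0 l) [X in - X]mxE opprK.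
    by rewrite mvalN -e1 oppr0.
  by rewrite -[c0]mulmx1 -(mc_inv h1) mulmxA e1 mul0mx.
have h2 := monomial_change_step ij iD jD.
have h3 := monomial_change_tperm iD Dmax.
(* The quotient of the two variables of equal value stands at place i; P moves it to the last
   place. *)
pose P : 'M[int]_n.+1 := perm_mx (tperm i ord_max).
pose A := A1 *m (step_mx i j *m P); pose B := P *m step_imx i j *m B1.
have h : monomial_change D A B by apply: monomial_changeM => //; apply: monomial_changeM.
have tB l : mact B t l = mact (step_imx i j) (mact B1 t) (tperm i ord_max l).
  by rewrite !mactM mact_perm.
have tmax : mact B t ord_max = 0.
  by rewrite tB tpermR mact_step eqxx eij subrr.
have tD0 l : D0 l -> 0 < mact B t l.
  move=> lD; rewrite tB.
  have lm : l != ord_max by apply: contraTneq lD => ->.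
  rewrite mact_step; case: tpermP => [el|el|/eqP li _].
  - have mi : ord_max != i by rewrite -el eq_sym.
    by rewrite (negbTE mi) p1.
  - by rewrite el eqxx in lm.
  - by rewrite (negbTE li) p1 //= lD.
have gen' c : supported D c -> mval (mact B t) c = 0 -> exists a : int, c = a *: (c0 *m A).
  move=> cD e; have [|a ea] := gen (c *m B) (supported_changeV h cD).
    by rewrite -mval_mact.
  by exists a; rewrite scalemxAl -ea -mulmxA (mc_invV h) mulmx1.
(* The last unit vector is now itself a relation, hence b times the transformed generator. Comparing
   last entries shows that b is a unit of the integers. *)
have [|b eb] := gen' (delta_mx 0 ord_max) _ (etrans (mval_delta _ _) tmax).
  by move=> l; rewrite !mxE negb_or => /andP[_ /negbTE ->]; rewrite andbF.
have b1 : b * (c0 *m A) 0 ord_max = 1.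
  by have /rowP/(_ ord_max) := eb; rewrite [LHS]mxE [RHS]mxE !eqxx /= => <-.
have bb : b * b = 1.
  have /eqP : (`|b| * `|(c0 *m A)%R 0%R ord_max| = 1)%N by rewrite -abszM b1.
  by rewrite muln_eq1 => /andP[/eqP + _]; case: (b) => [[|[|]]|[|]].
have ind : independent D0 (mact B t).
  move=> c cD e; have [|a ea] := gen' c _ e.
    by move=> l; rewrite negb_or => /andP[/cD ->].
  have {}ea : c = (a * b) *: delta_mx 0 ord_max by rewrite eb scalerA -mulrA bb mulr1.
  have := cD _ nmax; rewrite ea !mxE !eqxx mulr1 => ->; exact: scale0r.
(* The values on D0 are independent, since relations are multiples of the last unit vector; this
   last change leaves the last variable alone. *)
have [A4 [B4 [h4 p4 s4]]] := perron_independent [seq c *m A | c <- cs] tD0 ind.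
exists (A *m A4), (B4 *m B).
have h4D : monomial_change D A4 B4 by apply: monomial_changeS h4 => l lD; rewrite /= lD.
have rowmax (M : 'M[int]_n.+1) : (forall a b, ~~ D0 a || ~~ D0 b -> M a b = (a == b)%:R) ->
    row ord_max M = delta_mx 0 ord_max.
  by move=> hM; apply/rowP => l; rewrite !mxE hM ?nmax // eqxx /= eq_sym.
split.
- exact: monomial_changeM.
- by rewrite mactM mact_mval (rowmax _ (mc_outB h4)) mval_delta.
- by move=> l lD; rewrite mactM p4.
- exists b => //; rewrite mulmxA.
  have -> : c0 *m A = b *: delta_mx 0 ord_max by rewrite eb scalerA bb scale1r.
  by rewrite -scalemxAl -rowE (rowmax _ (mc_outA h4)).
- by move=> c cc; rewrite mulmxA; apply: s4; exact: map_f.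
Qed.

End PerronDependent.

(** * Polynomials and Laurent monomials *)

Section MpolyTools.
Variables (n : nat) (R : comNzRingType).
Implicit Types p q : {mpoly R[n]}.

Lemma mpoly_ring_ind (Pr : {mpoly R[n]} -> Prop) :
  (forall c, Pr c%:MP) -> (forall i, Pr 'X_i) ->
  (forall p q, Pr p -> Pr q -> Pr (p + q)) ->
  (forall p q, Pr p -> Pr q -> Pr (p * q)) -> forall p, Pr p.
Proof.
move=> hC hX hD hM p; rewrite (mpolyE p).
elim/big_ind: _ => [||m _]; [by rewrite -mpolyC0 | by [] |].
rewrite -mul_mpolyC; apply: (hM _ _ (hC _)); rewrite mpolyXE_id.
elim/big_ind: _ => [||i _]; [by rewrite -mpolyC1 | by [] |].
by elim: (m i) => [|l IH]; rewrite ?expr0 -?mpolyC1 // exprS; apply: hM.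
Qed.

Lemma eq_mpoly_rmorph (S : comNzRingType) (f g : {rmorphism {mpoly R[n]} -> S}) :
  (forall c, f c%:MP = g c%:MP) -> (forall i, f 'X_i = g 'X_i) -> f =1 g.
Proof.
move=> hC hX; elim/mpoly_ring_ind => // p q hp hq; first by rewrite !rmorphD hp hq.
by rewrite !rmorphM hp hq.
Qed.

Lemma mmapU (S : comNzRingType) (f : {rmorphism R -> S}) h i :
  mmap f h ('X_i : {mpoly R[n]}) = h i.
Proof. by rewrite mmapX mmap1U. Qed.

Lemma mmap_comp (S T : comNzRingType) (f : {rmorphism R -> S}) h
    (g : {rmorphism S -> T}) p :
  g (mmap f h p) = mmap (g \o f) (g \o h) p.
Proof.
have := @eq_mpoly_rmorph _ (g \o mmap f h) (mmap (g \o f) (g \o h)).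
by apply=> [c|i] /=; rewrite ?mmapC ?mmapU.
Qed.

Lemma mmap_mmap m (S : comNzRingType) (f : {rmorphism R -> S})
    (h : 'I_m -> S) (Y : 'I_n -> {mpoly R[m]}) p :
  mmap f h (mmap (@mpolyC m R) Y p) = mmap f (fun i => mmap f h (Y i)) p.
Proof.
have := @eq_mpoly_rmorph _ (mmap f h \o mmap (@mpolyC m R) Y)
  (mmap f (fun i => mmap f h (Y i))).
by apply=> [c|i] /=; rewrite ?mmapC ?mmapU ?mmapC.
Qed.

Lemma eq_mmap (S : comNzRingType) (f g : {rmorphism R -> S}) h1 h2 p :
  f =1 g -> h1 =1 h2 -> mmap f h1 p = mmap g h2 p.
Proof.
move=> fg h12; have := @eq_mpoly_rmorph _ (mmap f h1) (mmap g h2).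
by apply=> [c|i] /=; rewrite ?mmapC ?mmapU; [exact: fg | exact: h12].
Qed.

Lemma mcoeff0X i : ('X_i : {mpoly R[n]})@_0%MM = 0.
Proof. by rewrite mcoeffX mnm1_eq0. Qed.

End MpolyTools.

Section VarsIdeal.
Variables (n : nat) (k : fieldType).
Implicit Types p q : {mpoly k[n]}.

Lemma vars_idealE p : vars_ideal p <-> p@_0%MM = 0.
Proof.
split=> [[c ->]|p0].
  by rewrite raddf_sum big1 // => i _; rewrite /= rmorphM /= mcoeff0X mulr0.
suff [c ec] : exists c : 'I_n -> {mpoly k[n]}, p = (p@_0%MM)%:MP + \sum_i c i * 'X_i.
  by exists c; rewrite {1}ec p0 mpolyC0 add0r.
elim/mpoly_ring_ind: p {p0} => [c|i|p q [c hc] [d hd]|p q [c hc] [d hd]].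
- by exists (fun=> 0); rewrite big1 ?addr0 => [|i _]; rewrite ?mcoeffC ?eqxx ?mulr1 ?mul0r.
- exists (fun j => (i == j)%:R); rewrite mcoeff0X mpolyC0 add0r (bigD1 i) //= eqxx mul1r.
  by rewrite big1 ?addr0 // => j /negbTE ji; rewrite eq_sym ji mul0r.
- exists (fun i => c i + d i); rewrite {1}hc {1}hd mcoeffD mpolyCD.
  rewrite addrACA -big_split /=; congr (_ + _); apply: eq_bigr => i _.
  by rewrite mulrDl.
- exists (fun i => c i * q + (p@_0%MM)%:MP * d i).
  rewrite {1}hc mulrDl {1}hd mulrDr rmorphM /= mpolyCM -!addrA; congr (_ + _).
  rewrite addrC mulr_suml mulr_sumr -big_split /=; apply: eq_bigr => i _.
  by ring.
Qed.

Lemma vars_idealN p : ~ vars_ideal p <-> p@_0%MM != 0.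
Proof. by rewrite vars_idealE; split=> [/eqP|/eqP]. Qed.

Lemma vars_idealNMl p q : ~ vars_ideal (p * q) -> ~ vars_ideal p.
Proof. by rewrite !vars_idealN rmorphM /= mulf_eq0 negb_or => /andP[]. Qed.

Definition msubst1 (i : 'I_n) (c : k) : {mpoly k[n]} -> {mpoly k[n]} :=
  mmap (@mpolyC n k) (fun j => if j == i then c%:MP else 'X_j).
HB.instance Definition _ i c := GRing.RMorphism.on (msubst1 i c).

(** The factor theorem in the variable i. It exhibits ['X_i - c] as generating the kernel of a
    morphism into a domain, whence its primality. *)
Lemma divides_linear i c p :
  divides ('X_i - c%:MP) p <-> msubst1 i c p = 0.
Proof.
split=> [[q ->]|p0].
  by rewrite rmorphM rmorphB /= /msubst1 mmapC mmapU eqxx subrr mulr0.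
suff [q hq] : exists q, p - msubst1 i c p = q * ('X_i - c%:MP).
  by exists q; rewrite -hq p0 subr0.
elim/mpoly_ring_ind: p {p0} => [d|j|p q [a ha] [b hb]|p q [a ha] [b hb]].
- by exists 0; rewrite /msubst1 mmapC subrr mul0r.
- rewrite /msubst1 mmapU; have [->|ji] := eqVneq j i; first by exists 1; rewrite mul1r.
  by exists 0; rewrite subrr mul0r.
- by exists (a + b); rewrite rmorphD /= opprD addrACA ha hb mulrDl.
- exists (a * q + msubst1 i c p * b); rewrite rmorphM /=.
  transitivity ((p - msubst1 i c p) * q + msubst1 i c p * (q - msubst1 i c q)); first by ring.
  by rewrite ha hb; ring.
Qed.

Lemma linear_prime i c p q :
  divides ('X_i - c%:MP) (p * q) -> divides ('X_i - c%:MP) p \/ divides ('X_i - c%:MP) q.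
Proof.
rewrite !divides_linear rmorphM => /eqP; rewrite mulf_eq0 => /orP[/eqP|/eqP]; tauto.
Qed.

Lemma var_prime i p q : divides 'X_i (p * q) -> divides 'X_i p \/ divides 'X_i q.
Proof. by move=> h; have := @linear_prime i 0 p q; rewrite mpolyC0 subr0; apply. Qed.

Lemma mpolyX_neq0 (m : 'X_{1..n}) : ('X_[m] : {mpoly k[n]}) != 0.
Proof.
by apply/eqP => /(congr1 (mcoeff m))/eqP; rewrite mcoeffX eqxx mcoeff0 oner_eq0.
Qed.

(** Each variable of the monomial is prime, so it can be cancelled from p or from q, by induction on
    the degree. This lets ELU, which treats one polynomial, monomialise several at once through
    their product. *)
Lemma monomial_factor (b : 'X_{1..n}) p q g : p * q = 'X_[b] * g -> ~ vars_ideal g ->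
  exists m g', [/\ (m <= b)%MM, ~ vars_ideal g' & p = 'X_[m] * g'].
Proof.
have [d] := ubnP (mdeg b); elim: d b p q => // d IH b p q bd e gn.
have [b0|/eqP bn0] := eqVneq b 0%MM.
  exists 0%MM, p; split; [by apply/mnm_lepP => j; rewrite mnm0E | | by rewrite mpolyX0 mul1r].
  by apply: (@vars_idealNMl p q); rewrite e b0 mpolyX0 mul1r.
have [i bi] : exists i, b i != 0%N.
  by apply/existsP; apply: contraT; rewrite negb_exists => /forallP h; case: bn0;
     apply/mnmP => i; rewrite mnm0E; apply/eqP; rewrite -[_ == _]negbK h.
have leb : (U_(i) <= b)%MM by rewrite lep1mP.
have eb : 'X_[b] = 'X_[b - U_(i)] * 'X_i :> {mpoly k[n]} by rewrite -mpolyXD submK.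
have db : (mdeg (b - U_(i)) < d)%N.
  by rewrite -ltnS; apply: leq_trans bd; rewrite -{2}(submK leb) mdegD mdeg1 addn1.
have : divides 'X_i (p * q) by exists ('X_[b - U_(i)] * g); rewrite e eb mulrAC.
case/var_prime => [[p' ep]|[q' eq]].
  have [|m [g' [mb gn' ep']]] := IH _ p' q db _ gn.
    apply: (mulIf (mpolyX_neq0 U_(i))); rewrite mulrAC -ep e eb; exact: mulrAC.
  exists (m + U_(i))%MM, g'; split => //; last by rewrite ep ep' mpolyXD mulrAC.
  by rewrite -(submK leb); apply/mnm_lepP => j; rewrite !mnmDE leq_add2r; exact: (mnm_lepP mb).
have [|m [g' [mb gn' ep']]] := IH _ p q' db _ gn.
  apply: (mulIf (mpolyX_neq0 U_(i))); rewrite -mulrA -eq e eb; exact: mulrAC.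
exists m, g'; split => //; apply: lepm_trans mb _; exact: lem_subr.
Qed.

End VarsIdeal.

Section Laurent.
Variables (n : nat) (L : fieldType).
Implicit Types (x : 'I_n -> L) (c : 'rV[int]_n).

Definition laurent x c : L := \prod_i x i ^ c 0 i.

Lemma laurent_neq0 x c : (forall i, x i != 0) -> laurent x c != 0.
Proof. by move=> x0; apply/prodf_neq0 => i _; rewrite expfz_neq0. Qed.

Lemma laurentD x c d : (forall i, x i != 0) ->
  laurent x (c + d) = laurent x c * laurent x d.
Proof.
move=> x0; rewrite /laurent -big_split /=; apply: eq_bigr => i _.
by rewrite mxE expfzDr.
Qed.

Lemma laurent0 x : laurent x 0 = 1.
Proof. by rewrite /laurent big1 // => i _; rewrite mxE expr0z. Qed.

Lemma laurent_sum x (I : Type) (s : seq I) (E : I -> 'rV[int]_n) : (forall i, x i != 0) ->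
  laurent x (\sum_(i <- s) E i) = \prod_(i <- s) laurent x (E i).
Proof.
move=> x0; elim: s => [|i s IH]; first by rewrite !big_nil laurent0.
by rewrite !big_cons laurentD // IH.
Qed.

Lemma laurentZ x (a : int) c : (forall i, x i != 0) ->
  laurent x (a *: c) = laurent x c ^ a.
Proof.
move=> x0; rewrite /laurent.
elim/big_rec2: _ => [|i u w _ ->]; first by rewrite exp1rz.
by rewrite expfzMl mxE [(a * _)%R]mulrC -exprz_exp.
Qed.

Lemma laurent_laurent x (B : 'M[int]_n) c : (forall i, x i != 0) ->
  laurent (fun i => laurent x (row i B)) c = laurent x (c *m B).
Proof.
move=> x0; rewrite mulmx_sum_row laurent_sum //.
by apply: eq_bigr => i _; rewrite laurentZ.
Qed.

Lemma laurent_delta x i : laurent x (delta_mx 0 i) = x i.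
Proof.
rewrite /laurent (bigD1 i) //= big1 ?mulr1 => [|j /negbTE ji]; rewrite mxE eqxx ?ji //=.
by rewrite eqxx expr1z.
Qed.

Definition mnm_row (m : 'X_{1..n}) : 'rV[int]_n := \row_i (m i)%:Z.

Lemma mmap1_laurent x m : mmap1 x m = laurent x (mnm_row m).
Proof. by apply: eq_bigr => i _; rewrite mxE. Qed.

End Laurent.

(** * Frames of a rational function field *)

Section FractionLift.
Variables (A : idomainType) (L : fieldType) (f : {rmorphism A -> L}).
Hypothesis f_inj : injective f.

Lemma fraction_ex (z : {fraction A}) :
  exists ab : A * A, ab.2 != 0 /\ z = tofrac ab.1 / tofrac ab.2.
Proof.
elim/quotW: z => x; exists (frac x); split; first exact: denom_ratioP.
have d0 := denom_ratioP x.
have t0 : tofrac (frac x).2 != 0 by rewrite tofrac_eq0.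
apply: (mulIf t0); rewrite divfK //.
unlock tofrac; rewrite -[LHS]FracField.pi_mul; apply/eqmodP => /=.
rewrite FracField.equivfE /FracField.mulf.
by rewrite !numden_Ratio ?mulf_neq0 ?oner_eq0 // !mulr1 mulrC.
Qed.

(* The dummy dependency on f_inj lets the morphism structure be inferred. *)
Definition fraction_lift (z : {fraction A}) : L :=
  let _ := f_inj in let ab := projT1 (cid (fraction_ex z)) in f ab.1 / f ab.2.

Let f0 c : c != 0 -> f c != 0.
Proof. by rewrite -(inj_eq f_inj) rmorph0. Qed.

Lemma fraction_liftE a b : b != 0 -> fraction_lift (tofrac a / tofrac b) = f a / f b.
Proof.
move=> b0; rewrite /fraction_lift; case: cid => -[a' b'] /= [b'0 e].
apply/eqP; rewrite eqr_div ?f0 // -!rmorphM (inj_eq f_inj).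
have t0 c : c != 0 -> tofrac c != 0 :> {fraction A} by rewrite tofrac_eq0.
by move/eqP: e; rewrite eqr_div ?t0 // -!tofracM tofrac_eq eq_sym.
Qed.

Lemma fraction_lift_tofrac a : fraction_lift (tofrac a) = f a.
Proof.
by have := @fraction_liftE a 1 (oner_neq0 _); rewrite tofrac1 rmorph1 !divr1.
Qed.

Lemma fraction_lift_zmod : zmod_morphism fraction_lift.
Proof.
move=> x y; have [[a b] /= [b0 ->]] := fraction_ex x.
have [[c d] /= [d0 ->]] := fraction_ex y.
have tb : tofrac b != 0 by rewrite tofrac_eq0.
have td : tofrac d != 0 by rewrite tofrac_eq0.
rewrite -mulNr addf_div // -tofracN -!tofracM -tofracD !fraction_liftE ?mulf_neq0 //.
by rewrite -mulNr addf_div ?f0 // -rmorphN -!rmorphM -rmorphD.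
Qed.

Lemma fraction_lift_monoid : monoid_morphism fraction_lift.
Proof.
split=> [|x y]; first by rewrite -tofrac1 fraction_lift_tofrac rmorph1.
have [[a b] /= [b0 ->]] := fraction_ex x.
have [[c d] /= [d0 ->]] := fraction_ex y.
rewrite mulf_div -!tofracM !fraction_liftE ?mulf_neq0 //.
by rewrite mulf_div -!rmorphM.
Qed.

HB.instance Definition _ :=
  GRing.isZmodMorphism.Build {fraction A} L fraction_lift fraction_lift_zmod.
HB.instance Definition _ :=
  GRing.isMonoidMorphism.Build {fraction A} L fraction_lift fraction_lift_monoid.

End FractionLift.

(** * Value groups of restricted valuations and rational bases *)

Section ValueGroup.
Variables (F : fieldType) (G : ordAbGroupType) (v : prevaluation F G).

Definition in_value_group : pred G := fun g => `[< exists2 x, x != 0 & v x = g >].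

Lemma in_value_group_zmod : zmod_closed in_value_group.
Proof.
split=> [|_ _ /asboolP[x x0 <-] /asboolP[y y0 <-]]; apply/asboolP.
  by exists 1; rewrite ?oner_neq0 ?preval1.
by exists (x / y); rewrite ?mulf_neq0 ?prevalM ?prevalV ?invr_eq0.
Qed.
HB.instance Definition _ := GRing.isZmodClosed.Build G in_value_group in_value_group_zmod.

(** ELU requires a valuation onto its group, whereas the restriction of v to K takes its values in a
    subgroup of G; that subgroup is made an ordered group of its own. *)
Record value_subgroup := ValueSubgroup {
  value_subgroup_val :> G; _ : value_subgroup_val \in in_value_group }.
HB.instance Definition _ := [isSub for value_subgroup_val].
HB.instance Definition _ := [Choice of value_subgroup by <:].
HB.instance Definition _ := [SubChoice_isSubZmodule of value_subgroup by <:].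
HB.instance Definition _ := [SubChoice_isSubPOrder of value_subgroup by <: with ring_display].

Lemma value_subgroup_total (a b : value_subgroup) : (a <= b) || (b <= a).
Proof. rewrite !leEsub; exact: ogle_total. Qed.

Lemma value_subgroup_leD (a b c : value_subgroup) : a <= b -> c + a <= c + b.
Proof. rewrite !leEsub !raddfD; exact: ordgroup_lerD2l. Qed.

HB.instance Definition _ :=
  isOrderedAbGroup.Build value_subgroup value_subgroup_total value_subgroup_leD.

End ValueGroup.

Section RestrictedValuation.
Variables (F : fieldType) (G : ordAbGroupType) (v : prevaluation F G).

(** The default 0 can only be taken at x = 0, where the value is junk anyway. *)
Definition restricted_val (x : F) : value_subgroup v := insubd (0 : value_subgroup v) (v x).

Lemma restricted_valE x : x != 0 -> val (restricted_val x) = v x.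
Proof. by move=> x0; rewrite insubdK //; apply/asboolP; exists x. Qed.

Lemma restricted_valM x y : x != 0 -> y != 0 ->
  restricted_val (x * y) = restricted_val x + restricted_val y.
Proof.
move=> x0 y0; apply: val_inj; rewrite restricted_valE ?mulf_neq0 // prevalM //.
by rewrite [RHS]raddfD; congr (_ + _); symmetry; exact: restricted_valE.
Qed.

Lemma restricted_valD x y : x != 0 -> y != 0 -> x + y != 0 ->
  Num.min (restricted_val x) (restricted_val y) <= restricted_val (x + y).
Proof.
move=> x0 y0 xy0; have := prevalD v x0 y0 xy0.
have e : (restricted_val x <= restricted_val y) = (v x <= v y).
  by rewrite leEsub !restricted_valE.
by rewrite !minEle e; case: ifP => _ h; rewrite leEsub !restricted_valE.
Qed.

Lemma restricted_val_onto (g : value_subgroup v) : exists2 x, x != 0 & restricted_val x = g.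
Proof.
have /asboolP[x x0 e] := valP g; exists x => //.
by apply: val_inj; rewrite restricted_valE.
Qed.

Definition restricted_valuation : valuation F (value_subgroup v) :=
  Valuation restricted_valM restricted_valD restricted_val_onto.

Lemma restricted_vring x : vring restricted_valuation x = vge v 0 x.
Proof.
rewrite /vring /vge; have [//|x0 /=] := eqVneq x 0.
by rewrite leEsub restricted_valE // raddf0.
Qed.

Lemma restricted_vmax x : vmax restricted_valuation x = vgt v 0 x.
Proof.
rewrite /vmax /vgt; have [//|x0 /=] := eqVneq x 0.
by rewrite ltEsub restricted_valE // raddf0.
Qed.

End RestrictedValuation.

(* A real field as a rational vector space, to test the universal property of
   the rationalization on an embedding into R. *)
Section RationalScaling.
Variable R : realType.
Definition rational_scaling : Type := R.
HB.instance Definition _ := GRing.Zmodule.on rational_scaling.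
Definition rat_scale (q : rat) (x : rational_scaling) : rational_scaling :=
  (ratr q : R) * (x : R).
Lemma rat_scaleA a b x : rat_scale a (rat_scale b x) = rat_scale (a * b) x.
Proof. by rewrite /rat_scale rmorphM mulrA. Qed.
Lemma rat_scale1 : left_id 1 rat_scale.
Proof. by move=> x; rewrite /rat_scale rmorph1 mul1r. Qed.
Lemma rat_scaleDr : right_distributive rat_scale +%R.
Proof. by move=> q x y; exact: mulrDr. Qed.
Lemma rat_scaleDl x : {morph rat_scale^~ x : a b / a + b}.
Proof. by move=> a b; rewrite /rat_scale rmorphD; exact: mulrDl. Qed.
HB.instance Definition _ := GRing.Zmodule_isLmodule.Build rat rational_scaling
  rat_scaleA rat_scale1 rat_scaleDr rat_scaleDl.
End RationalScaling.

Section RationalBasis.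
Variables (G : zmodType) (n : nat) (g : 'I_n -> G).

Lemma rational_basis_independent : rational_basis g ->
  forall c : 'I_n -> int, \sum_i g i *~ c i = 0 -> forall i, c i = 0.
Proof.
case=> E [j [_ bas]] c e i.
have [c0 [h0 u0]] := bas 0.
have : c0 = [ffun=> 0] by apply: u0; rewrite big1 // => l _; rewrite ffunE scale0r.
have : c0 = [ffun l => (c l)%:~R].
  apply: u0; transitivity (j (\sum_l g l *~ c l)); first by rewrite e raddf0.
  by rewrite raddf_sum; apply: eq_bigr => l _; rewrite ffunE raddfMz scaler_int.
by move=> -> /ffunP/(_ i); rewrite !ffunE => /eqP; rewrite intr_eq0 => /eqP.
Qed.

(** The universal property, tested on the embedding of G into the reals, shows that j is injective.
    An equality obtained in E after clearing denominators then holds in G. *)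
Lemma rational_basis_span (R : realType) (h : {additive G -> R}) : injective h ->
  rational_basis g -> forall a, exists (m : nat) (c : 'I_n -> int),
  a *+ m.+1 = \sum_i g i *~ c i.
Proof.
move=> hinj [E [j [univ bas]]] a.
have [[l hl] _] := univ (rational_scaling R) (h : {additive G -> rational_scaling R}).
have jinj : injective j by move=> x y e; apply: hinj; rewrite -!hl e.
have [c [hc _]] := bas (j a).
pose d i : nat := `|denq (c i)|%N.
have dE i : (d i)%:Z = denq (c i) by rewrite /d gez0_abs // ltW.
pose N : nat := (\prod_i d i)%N.
pose z i : int := numq (c i) * (\prod_(l | l != i) d l)%N%:Z.
have cz i : c i * N%:R = (z i)%:~R.
  rewrite /N (bigD1 i) //= natrM mulrA /z intrM -[(d i)%:R]/((d i)%:Z%:~R) dE.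
  by rewrite -[X in X * _ * _]divq_num_den divfK // intr_eq0 denq_eq0.
have N0 : (0 < N)%N.
  by rewrite /N prodn_gt0 // => i; rewrite /d absz_gt0 denq_eq0.
exists N.-1, z; rewrite prednK //; apply: jinj.
rewrite raddfMn raddf_sum hc -scaler_nat scaler_sumr; apply: eq_bigr => i _.
by rewrite raddfMz -scaler_int scalerA mulrC cz.
Qed.
End RationalBasis.

Section PolyValues.
Variables (k L : fieldType) (G : ordAbGroupType) (w : prevaluation L G).
Variables (e : {rmorphism k -> L}) (n : nat) (u : 'I_n -> L).
Hypothesis w_e : forall c, c != 0 -> w (e c) = 0.
Hypothesis w_u : forall i, vgt w 0 (u i).
Implicit Types P : {mpoly k[n]}.

Lemma vge_cst c : vge w 0 (e c).
Proof.
have [->|c0] := eqVneq c 0; first by rewrite rmorph0 vge0.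
by rewrite vge_nz ?fmorph_eq0 // w_e.
Qed.

Lemma mmap_residue P : vgt w 0 (mmap e u P - e P@_0%MM).
Proof.
elim/mpoly_ring_ind: P => [c|i|P Q hP hQ|P Q hP hQ].
- by rewrite mmapC mcoeffC eqxx mulr1 subrr vgt0.
- by rewrite mmapU mcoeff0X rmorph0 subr0.
- by rewrite !rmorphD opprD addrACA vgtD.
have -> : mmap e u (P * Q) - e (P * Q)@_0%MM =
    (mmap e u P - e P@_0%MM) * (mmap e u Q - e Q@_0%MM) +
    ((mmap e u P - e P@_0%MM) * e Q@_0%MM + (mmap e u Q - e Q@_0%MM) * e P@_0%MM).
  by rewrite !rmorphM /=; ring.
by rewrite !vgtD ?vgt0M ?vge_cst // vgtW.
Qed.

Lemma mmap_vge P : vge w 0 (mmap e u P).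
Proof.
by rewrite -[mmap e u P](subrK (e P@_0%MM)) vgeD ?vge_cst // vgtW // mmap_residue.
Qed.

Lemma mmap_vgt P : P@_0%MM = 0 -> vgt w 0 (mmap e u P).
Proof. by move=> P0; have := mmap_residue P; rewrite P0 rmorph0 subr0. Qed.

Lemma mmap_unit P : P@_0%MM != 0 -> mmap e u P != 0 /\ w (mmap e u P) = 0.
Proof.
move=> P0; have e0 : e P@_0%MM != 0 by rewrite fmorph_eq0.
have := @preval_dominant _ _ w (e P@_0%MM) (mmap e u P - e P@_0%MM) e0.
by rewrite subrKC w_e //; apply; exact: mmap_residue.
Qed.

Lemma mmap_vgtE P : vgt w 0 (mmap e u P) = (P@_0%MM == 0).
Proof.
have [h|h] := eqVneq P@_0%MM 0; first exact: mmap_vgt.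
have [P0 wP] := mmap_unit h.
by rewrite vgt_nz // wP ltxx.
Qed.

End PolyValues.

Section LaurentIndependence.
Variables (k L : fieldType) (e : {rmorphism k -> L}) (n : nat) (x : 'I_n -> L).
Hypothesis x_indep : injective (mmap e x : {mpoly k[n]} -> L).
Hypothesis x_neq0 : forall i, x i != 0.

(** The exponent map m |-> m B is injective. Multiplying a relation by one large monomial makes all
    its exponents nonnegative, and turns it into a polynomial relation between the x_i. *)
Lemma laurent_independent (A B : 'M[int]_n) : B *m A = 1%:M ->
  injective (mmap e (fun i => laurent x (row i B)) : {mpoly k[n]} -> L).
Proof.
move=> BA; apply/raddf_inj => P P0; apply/eqP; rewrite -msupp_eq0; apply/eqP.
pose ex m : 'rV[int]_n := mnm_row m *m B.
have ex_inj : injective ex.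
  move=> m m' /(congr1 (mulmx^~ A)); rewrite -!mulmxA BA !mulmx1 => /rowP h.
  by apply/mnmP => i; have := h i; rewrite !mxE => -[].
pose M (j : 'I_n) : nat := (\sum_(m <- msupp P) `|(ex m 0%R j)%R|)%N.
pose phi m : 'X_{1..n} := [multinom `|(ex m 0%R j + (M j)%:Z)%R|%N | j < n].
have exM m j : m \in msupp P -> (0 <= ex m 0 j + (M j)%:Z).
  move=> mP; have : (`|(ex m 0%R j)%R| <= M j)%N.
    by rewrite /M (bigD1_seq m) ?msupp_uniq //= leq_addr.
  lia.
have phiE m : m \in msupp P -> mnm_row (phi m) = ex m + \row_j (M j)%:Z.
  by move=> mP; apply/rowP => j; rewrite !mxE mnmE gez0_abs ?exM // !mxE.
have phi_inj m m' : m \in msupp P -> m' \in msupp P -> phi m = phi m' -> m = m'.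
  move=> mP m'P /(congr1 (@mnm_row n)); rewrite !phiE // => /addIr; exact: ex_inj.
pose Q := \sum_(m <- msupp P) P@_m *: 'X_[phi m] : {mpoly k[n]}.
have Q0 : Q = 0.
  apply: x_indep; rewrite rmorph0 /Q rmorph_sum /=.
  transitivity (mmap e (fun i => laurent x (row i B)) P * laurent x (\row_j (M j)%:Z)).
    rewrite /(mmap _ _ P) mulr_suml; apply: eq_big_seq => m mP.
    rewrite mmapZ mmapX (mmap1_laurent x) phiE // laurentD // mulrA; congr (_ * _ * _).
    by rewrite mmap1_laurent laurent_laurent.
  by rewrite P0 mul0r.
case e0: (msupp P) => [//|m0 s]; have m0P : m0 \in msupp P by rewrite e0 mem_head.
have := congr1 (mcoeff (phi m0)) Q0; rewrite mcoeff0 /Q raddf_sum /=.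
rewrite (bigD1_seq m0) ?msupp_uniq //= mcoeffZ mcoeffX eqxx mulr1 big_seq_cond big1.
  by rewrite addr0 => /eqP; rewrite mcoeff_eq0 m0P.
move=> m /andP[mP mm0]; rewrite mcoeffZ mcoeffX; case: eqP => [/phi_inj em|]; rewrite ?mulr0 //.
by rewrite em ?eqxx in mm0.
Qed.

End LaurentIndependence.

HB.instance Definition _ (k : fieldType) d :=
  GRing.RMorphism.copy (@cst k d) (@FracField.tofrac {mpoly k[d]} \o @mpolyC d k).
HB.instance Definition _ (k : fieldType) d (y : 'I_d -> {fraction {mpoly k[d]}}) :=
  GRing.RMorphism.copy (psubst y) (mmap (@cst k d) y).

Section Substitution.
Variables (k : fieldType) (d : nat).
Implicit Types (y : 'I_d -> {fraction {mpoly k[d]}}) (P : {mpoly k[d]}).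

Lemma psubstX y i : psubst y 'X_i = y i.
Proof. exact: mmapU. Qed.

Lemma psubstC y c : psubst y c%:MP = cst d c.
Proof. exact: mmapC. Qed.

Lemma psubst_vars P : psubst (@vars k d) P = tofrac P.
Proof.
have := @eq_mpoly_rmorph _ _ _ (psubst (@vars k d)) (@FracField.tofrac {mpoly k[d]}).
by apply=> [c|i]; [exact: psubstC | exact: psubstX].
Qed.

Lemma psubst_psubst x y (Y : 'I_d -> {mpoly k[d]}) P : (forall i, x i = psubst y (Y i)) ->
  psubst x P = psubst y (mmap (@mpolyC d k) Y P).
Proof. by move=> h; rewrite /psubst mmap_mmap; apply: eq_mmap => // i; exact: h. Qed.

Lemma poly_subring_trans x y : (forall i, poly_subring y (x i)) ->
  forall z, poly_subring x z -> poly_subring y z.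
Proof.
move=> /choice[Y hY] z [P ->]; exists (mmap (@mpolyC d k) Y P).
exact: psubst_psubst.
Qed.

Lemma psubst_mnm y (b : 'X_{1..d}) : psubst y 'X_[b] = \prod_i y i ^+ b i.
Proof. by rewrite /psubst mmapX. Qed.

Lemma fraction_psubst (y : 'I_d -> {fraction {mpoly k[d]}}) :
  (forall i, poly_subring y (vars k i)) -> forall z, exists P P',
  psubst y P' != 0 /\ z = psubst y P / psubst y P'.
Proof.
move=> hy z; have [[a b] /= [b0 ->]] := fraction_ex z.
have hp P : poly_subring y (tofrac P).
  by apply: (poly_subring_trans hy); exists P; rewrite psubst_vars.
have [P eP] := hp a; have [P' eP'] := hp b.
by exists P, P'; rewrite -eP -eP' tofrac_eq0.
Qed.

End Substitution.

Section Frames.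
Variables (k : closedFieldType) (n : nat) (G : ordAbGroupType).
Notation K := {fraction {mpoly k[n]}}.
Variable vK : prevaluation K G.
Hypothesis vK_c : forall c, c != 0 -> vK (cst n c) = 0.
Hypothesis vK_res : forall x, vge vK 0 x -> exists c, vgt vK 0 (x - cst n c).

(** Coordinates of a polynomial ring that contains the original one inside the same field and on
    which the valuation is centred at the origin. *)
Record frame (y : 'I_n -> K) : Prop := Frame {
  frame_indep : alg_indep y;
  frame_vars : forall i, poly_subring y (vars k i);
  frame_pos : forall i, vgt vK 0 (y i)
}.

Lemma frame_neq0 y i : frame y -> y i != 0.
Proof.
move=> hy; rewrite -psubstX -(rmorph0 (psubst y)) (inj_eq (frame_indep hy)).
exact: mpolyX_neq0.
Qed.

Lemma frame_gt0 y i : frame y -> 0 < vK (y i).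
Proof. by move=> hy; rewrite -vgt_nz ?frame_neq0 // frame_pos. Qed.

Variables (R : realType) (h : {additive G -> R}).
Hypothesis h_inj : injective h.
Hypothesis elu : ELU n.

(** ELU starts from the standard variables. It is applied to vK composed with the automorphism s of
    K that sends them to y, and its result is carried back by s. D consists of the first indices,
    whose values form the rational basis. *)
Lemma ELU_frame y (g : {mpoly k[n]}) : frame y -> g != 0 ->
  exists (y1 : 'I_n -> K) (D : pred 'I_n),
  [/\ frame y1, forall z, poly_subring y z -> poly_subring y1 z,
      independent D (vK \o y1),
      forall x, x != 0 -> exists (m : nat) (c : 'rV[int]_n), 
        supported D c /\ vK x *+ m.+1 = mval (vK \o y1) c &
      exists (b : 'X_{1..n}) (g1 : {mpoly k[n]}),
        [/\ supported D (mnm_row b), ~ vars_ideal g1 & psubst y g = psubst y1 ('X_[b] * g1)]].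
Proof.
move=> fy g0; have yi := frame_indep fy.
pose s : {rmorphism K -> K} := fraction_lift yi.
have sE P : s (tofrac P) = psubst y P := fraction_lift_tofrac yi P.
have s_c c : s (cst n c) = cst n c by rewrite [LHS]sE psubstC.
have sS P u : s (psubst u P) = psubst (s \o u) P.
  rewrite /psubst mmap_comp; apply: eq_mmap => // c; exact: s_c.
have s_surj z : exists x, s x = z.
  have [P [P' [_ ->]]] := fraction_psubst (frame_vars fy) z.
  by exists (tofrac P / tofrac P'); rewrite fmorph_div !sE.
pose v1 := preval_comp s vK; pose v := restricted_valuation v1.
have v1_c c : c != 0 -> v1 (cst n c) = 0 by move=> c0; rewrite /v1 /= s_c vK_c.
have v1_u i : vgt v1 0 (vars k i).
  by have := frame_pos fy i; rewrite /vgt /= -[y i]psubstX -sE fmorph_eq0.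
have vE x : x != 0 -> val (v x) = vK (s x) by move=> x0; rewrite restricted_valE.
have [|||y0 [y0i [y0sub _ _] [y0ring y0max] [n' [le [rb [b [g1 [g1n eg]]]]]]]] :=
    elu (v := v) _ _ _ g0.
- move=> c c0; apply: val_inj; rewrite raddf0 vE ?fmorph_eq0 //.
  by rewrite s_c vK_c.
- move=> x; rewrite restricted_vring => hx.
  have [|c hc] := @vK_res (s x); first by move: hx; rewrite /vge fmorph_eq0.
  exists ('X - c%:P); first by rewrite polyXsubC_eq0.
  rewrite restricted_vmax rmorphB /= map_polyX map_polyC hornerXsubC.
  by move: hc; rewrite -[in X in X -> _]s_c -rmorphB /vgt fmorph_eq0.
- have unitP P : ~ vars_ideal P -> psubst (@vars k n) P != 0 /\ v1 (psubst (@vars k n) P) = 0.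
    by move/vars_idealN => P0; exact: (mmap_unit v1_c v1_u).
  split=> z.
    case=> P [P' [nP' ->]]; have [P'0 vP'] := unitP P' nP'.
    rewrite restricted_vring; apply: vge0M; first exact: (mmap_vge v1_c v1_u).
    by rewrite vge_nz ?invr_eq0 // prevalV // vP' oppr0.
  split=> [[[P [P' [nP' ->]]]]|[P [P' [iP nP' ->]]]].
    have [P'0 vP'] := unitP P' nP'.
    rewrite restricted_vmax => hz; exists P, P'; split=> //.
    apply/vars_idealE/eqP; rewrite -(mmap_vgtE v1_c v1_u).
    rewrite -[mmap _ _ _](divfK P'0); apply: vgt0M => //; exact: (mmap_vge v1_c v1_u).
  have [P'0 vP'] := unitP P' nP'.
  split; first by exists P, P'.
  rewrite restricted_vmax; apply: vgt0M.
    by apply: (mmap_vgt v1_c v1_u); apply/vars_idealE.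
  by rewrite vge_nz ?invr_eq0 // prevalV // vP' oppr0.
pose y1 := s \o y0; pose D := [pred i : 'I_n | (i < n')%N].
have y00 i : y0 i != 0.
  by rewrite -psubstX -(rmorph0 (psubst y0)) (inj_eq y0i) mpolyX_neq0.
have y1E P : s (psubst y0 P) = psubst y1 P := sS P y0.
have sub z : poly_subring y z -> poly_subring y1 z.
  case=> P ->; have [|Q eQ] := y0sub (tofrac P); first by exists P; rewrite psubst_vars.
  by exists Q; rewrite -sE eQ y1E.
have fy1 : frame y1.
  split.
  - by move=> P Q; rewrite -!y1E => /fmorph_inj /y0i.
  - by move=> i; apply/sub/(frame_vars fy).
  - move=> i; have [|_] := (y0max (y0 i)).2.
      exists 'X_i, 1; split; last by rewrite psubstX rmorph1 divr1.
        by apply/vars_idealE; rewrite mcoeff0X.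
      by apply/vars_idealN; rewrite mcoeff1 eqxx oner_eq0.
    by rewrite restricted_vmax /vgt fmorph_eq0.
have val_sum (c : 'I_n' -> int) (d : 'rV[int]_n) : supported D d ->
    (forall i, d 0 (widen_ord le i) = c i) ->
    val (\sum_i v (y0 (widen_ord le i)) *~ c i) = mval (vK \o y1) d.
  move=> dD dc; rewrite (mval_supported _ dD) big_ord_narrow raddf_sum.
  by apply: eq_bigr => i _; rewrite raddfMz dc /= -vE.
have ins (T : Type) (c : 'I_n' -> T) t i : oapp c t (insub (widen_ord le i : nat)) = c i.
  by rewrite (_ : widen_ord le i = val i :> nat) // valK.
have insN (T : Type) (c : 'I_n' -> T) t (j : 'I_n) : ~~ D j -> oapp c t (insub (j : nat)) = t.
  by move=> jD; rewrite insubF //; exact/negbTE.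
exists y1, D; split=> //.
- move=> c cD c0.
  have zero := rational_basis_independent rb (c := fun i => c 0 (widen_ord le i)).
  apply/rowP => j; rewrite mxE; have [jD|/cD //] := boolP (D j).
  have -> : j = widen_ord le (Ordinal jD) by apply: val_inj.
  by apply: zero; apply: val_inj; rewrite (val_sum _ c cD) // c0 raddf0.
- move=> x; have [x0 <-] := s_surj x; rewrite fmorph_eq0 => x00.
  have hv_inj : injective (h \o (\val : value_subgroup v1 -> G)).
    by move=> a1 a2 /= /h_inj /val_inj.
  have [m [c hc]] := rational_basis_span hv_inj rb (v x0).
  exists m, (\row_j oapp c 0 (insub (j : nat))); split.
    by move=> j jD; rewrite mxE insN.
  rewrite -(val_sum c) => [|j jD|i]; last 2 first.
  - by rewrite mxE insN.
  - by rewrite mxE ins.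
  by rewrite -hc raddfMn /= -vE.
exists [multinom oapp b 0%N (insub (j : nat)) | j < n], g1; split=> //.
  by move=> j jD; rewrite mxE mnmE insN.
rewrite -sE eg [LHS]rmorphM [RHS]rmorphM y1E; congr (_ * _).
rewrite -[RHS]/(psubst y1 _) psubst_mnm.
rewrite [RHS](bigID D) /= [X in _ * X]big1 ?mulr1 => [|j jD]; last first.
  by rewrite mnmE insN.
rewrite big_ord_narrow rmorph_prod; apply: eq_bigr => i _.
by rewrite rmorphXn mnmE ins.
Qed.
End Frames.

Lemma preval_laurent (L : fieldType) (G : ordAbGroupType) (w : prevaluation L G)
    n (x : 'I_n -> L) c : (forall i, x i != 0) ->
  w (laurent x c) = mval (w \o x) c.
Proof.
move=> x0; rewrite preval_prod => [|i _]; last by rewrite expfz_neq0.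
by apply: eq_bigr => i _; rewrite prevalXz.
Qed.

Definition abs_mnm n (c : 'rV[int]_n) : 'X_{1..n} := [multinom `|c 0%R j|%N | j < n].

Lemma laurent_abs_mnm (L : fieldType) n (x : 'I_n -> L) (c : 'rV[int]_n) :
  (forall j, 0 <= c 0 j) -> laurent x c = mmap1 x (abs_mnm c).
Proof.
move=> c0; rewrite mmap1_laurent; congr (laurent x _).
by apply/rowP => j; rewrite mxE mnmE gez0_abs.
Qed.

Lemma laurent_change (L : fieldType) n (x : 'I_n -> L) (D : pred 'I_n) A B c :
  (forall i, x i != 0) -> monomial_change D A B ->
  laurent x c = laurent (fun i => laurent x (row i B)) (c *m A).
Proof.
by move=> x0 hm; rewrite laurent_laurent // -mulmxA (mc_inv hm) mulmx1.
Qed.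

Lemma laurent_out (L : fieldType) n (x : 'I_n -> L) (D : pred 'I_n) A B i :
  monomial_change D A B -> ~~ D i -> laurent x (row i B) = x i.
Proof.
move=> hm iD; rewrite -[RHS]laurent_delta; congr (laurent x _).
by apply/rowP => j; rewrite !mxE (mc_outB hm) ?iD // eqxx eq_sym.
Qed.

Lemma mulf_cancel (L : fieldType) (a b c d : L) : b != 0 ->
  a * b * c / (b * d) = a * (c / d).
Proof.
move=> b0; have -> : a * b * c = b * (a * c) by ring.
by rewrite -mulf_div divff // mul1r mulrA.
Qed.

Lemma preval_div_unit (L : fieldType) (G : ordAbGroupType) (w : prevaluation L G) a b :
  a != 0 -> b != 0 -> w a = 0 -> w b = 0 -> a / b != 0 /\ w (a / b) = 0.
Proof.
move=> a0 b0 wa wb; split; first by rewrite mulf_neq0 ?invr_eq0.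
by rewrite prevalM ?invr_eq0 // prevalV // wa wb subrr.
Qed.

Lemma exists_vgt_mulX (L : fieldType) (G : ordAbGroupType) (w : prevaluation L G)
    (g : G) (a t : L) : archimedean_group G -> vgt w 0 t -> exists N, vgt w g (a * t ^+ N).
Proof.
move=> archG tpos; have [->|a0] := eqVneq a 0; first by exists 0%N; rewrite mul0r vgt0.
have [->|t0] := eqVneq t 0; first by exists 1%N; rewrite expr1 mulr0 vgt0.
rewrite vgt_nz // in tpos.
have [N hN] := archimedean_shift archG (w a) g tpos.
exists N; rewrite vgt_nz ?mulf_neq0 ?expf_neq0 // prevalM ?expf_neq0 // prevalX //.
by rewrite addrC; exact: hN.
Qed.

Section FrameApprox.
Variables (k : closedFieldType) (n : nat) (G : ordAbGroupType).
Notation K := {fraction {mpoly k[n]}}.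
Variable vK : prevaluation K G.
Hypothesis vK_c : forall c, c != 0 -> vK (cst n c) = 0.
Hypothesis vK_res : forall x, vge vK 0 x -> exists c, vgt vK 0 (x - cst n c).

Lemma frame_unit y Q : frame vK y -> Q@_0%MM != 0 ->
  psubst y Q != 0 /\ vK (psubst y Q) = 0.
Proof. by move=> fy; exact: (mmap_unit vK_c (frame_pos fy)). Qed.

Lemma frame_vgtE y Q : frame vK y -> vgt vK 0 (psubst y Q) = (Q@_0%MM == 0).
Proof. by move=> fy; exact: (mmap_vgtE vK_c (frame_pos fy)). Qed.

Lemma frame_change y (D : pred 'I_n) A B : frame vK y -> monomial_change D A B ->
  (forall i, D i -> 0 < mact B (vK \o y) i) ->
  let y' i := laurent y (row i B) in
  frame vK y' /\ forall z, poly_subring y z -> poly_subring y' z.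
Proof.
move=> fy hm pos y'.
have y0 i : y i != 0 by apply: frame_neq0 fy.
have sub : forall z, poly_subring y z -> poly_subring y' z.
  apply: poly_subring_trans => i; exists 'X_[abs_mnm (row i A)].
  rewrite -[y i]laurent_delta (laurent_change _ y0 hm) -rowE laurent_abs_mnm.
    by rewrite /psubst mmapX.
  by move=> j; rewrite mxE (mc_ge0 hm).
split=> //; split.
- exact: (laurent_independent (frame_indep fy) y0 (mc_invV hm)).
- by move=> i; apply/sub/(frame_vars fy).
- move=> i; have [iD|iD] := boolP (D i); last first.
    by rewrite /y' (laurent_out _ hm iD) frame_pos.
  by rewrite vgt_nz ?laurent_neq0 // preval_laurent // -mact_mval pos.
Qed.

Variables (R : realType) (h : {additive G -> R}).
Hypothesis h_inj : injective h.
Hypothesis archG : archimedean_group G.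
Hypothesis elu : ELU n.

(** ELU applied to the product of numerator and denominator makes h0 a Laurent monomial times a
    quotient of units at the origin. That monomial has positive value, so Perron's algorithm makes
    its exponents nonnegative. *)
Lemma frame_fraction y (h0 : K) : frame vK y -> vgt vK 0 h0 -> h0 != 0 ->
  exists y' P U, [/\ frame vK y', forall z, poly_subring y z -> poly_subring y' z,
    U@_0%MM != 0 & h0 = psubst y' P / psubst y' U].
Proof.
move=> fy hpos hn0; have [P [P' [P'0 eh]]] := fraction_psubst (frame_vars fy) h0.
have P0 : psubst y P != 0 by apply: contraNneq hn0 => e; rewrite eh e mul0r.
have nz Q : psubst y Q != 0 -> Q != 0 by apply: contraNneq => ->; rewrite rmorph0.
have [|y1 [D [fy1 sub1 ind1 _ [b [g1 [bD g1n eg]]]]]] :=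
  ELU_frame vK_c vK_res h_inj elu (g := P * P') fy; first by rewrite mulf_neq0 ?nz.
have [|P1 eP1] := sub1 (psubst y P); first by exists P.
have [|P1' eP1'] := sub1 (psubst y P'); first by exists P'.
have e1 : P1 * P1' = 'X_[b] * g1.
  by apply: (frame_indep fy1); rewrite -eg [LHS]rmorphM [RHS]rmorphM; congr (_ * _); exact/esym.
have [ma [ga [mab gan ea]]] := monomial_factor e1 g1n.
have [mb [gb [mbb gbn eb]]] := monomial_factor (etrans (mulrC _ _) e1) g1n.
have leD m : (m <= b)%MM -> supported D (mnm_row m).
  move=> /mnm_lepP hm j /bD; rewrite !mxE => -[bj]; apply/eqP.
  by rewrite eqz_nat -leqn0 -bj hm.
pose t := vK \o y1; pose c := mnm_row ma - mnm_row mb.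
have cD : supported D c.
  move=> j jD; have := leD ma mab j jD; have := leD mb mbb j jD.
  by rewrite !mxE => -> ->.
have y10 i : y1 i != 0 by apply: frame_neq0 fy1.
have [ga0 vga] := frame_unit fy1 ((vars_idealN _).1 gan).
have [gb0 vgb] := frame_unit fy1 ((vars_idealN _).1 gbn).
have psX m g : psubst y1 ('X_[m] * g) = laurent y1 (mnm_row m) * psubst y1 g.
  by rewrite [LHS]rmorphM; congr (_ * _); rewrite [LHS]mmapX mmap1_laurent.
have h0E : h0 = laurent y1 c * (psubst y1 ga / psubst y1 gb).
  rewrite eh eP1 eP1' ea eb !psX.
  have -> : laurent y1 (mnm_row ma) = laurent y1 c * laurent y1 (mnm_row mb).
    by rewrite -laurentD // subrK.
  by rewrite mulf_cancel ?laurent_neq0.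
have [q0 vq] := preval_div_unit ga0 gb0 vga vgb.
have vc : 0 < mval t c.
  have := hpos; rewrite (vgt_nz vK 0 hn0) h0E.
  by rewrite (prevalM vK (laurent_neq0 c y10) q0) vq addr0 preval_laurent.
have tD i : D i -> 0 < t i by move=> _; exact: frame_gt0 fy1.
have [A [B [hm pos ss]]] := perron_independent [:: c] tD ind1.
have [fy2 sub2] := frame_change fy1 hm pos.
set y2 := fun i => _ in fy2 sub2.
have cA j : 0 <= (c *m A) 0 j.
  have [jD|jD] := boolP (D j); last by rewrite (supported_change hm cD jD).
  apply: (same_sign_ge0 pos (supported_change hm cD)) => //.
    by apply: ss; rewrite mem_head.
  by rewrite -(mval_change _ _ hm) ltW.
have [|Ga eGa] := sub2 (psubst y1 ga); first by exists ga.
have [|Gb eGb] := sub2 (psubst y1 gb); first by exists gb.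
exists y2, ('X_[abs_mnm (c *m A)] * Ga), Gb; split=> //.
- by move=> z /sub1 /sub2.
- rewrite -(frame_vgtE Gb fy2) -eGb.
  by rewrite (vgt_nz vK 0 gb0) vgb ltxx.
- rewrite h0E eGa eGb (laurent_change c y10 hm) laurent_abs_mnm //.
  by rewrite [psubst y2 (_ * _)]rmorphM mulrA; congr (_ * _ / _); rewrite [RHS]mmapX.
Qed.

(** The denominator U is a unit at the origin, with constant term u. Its inverse is expanded as a
    geometric series in T = 1 - U / u; stopping after N terms leaves the error h0 t^N, where t has
    positive value. *)
Lemma frame_approx y (h0 : K) (g : G) : frame vK y -> vgt vK 0 h0 ->
  exists y' H, [/\ frame vK y', forall z, poly_subring y z -> poly_subring y' z &
    vgt vK g (h0 - psubst y' H)].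
Proof.
move=> fy hpos; have [e|hn0] := eqVneq h0 0.
  by exists y, 0; split => //; rewrite rmorph0 subr0 e vgt0.
have [y' [P [U [fy' sub U0 eh]]]] := frame_fraction fy hpos hn0.
set u := U@_0%MM in U0; pose T := 1 - u^-1 *: U.
have [t et] : exists t, t = psubst y' T by exists (psubst y' T).
have T0 : T@_0%MM = 0 by rewrite mcoeffB mcoeff1 eqxx mcoeffZ mulVf // subrr.
have tpos : vgt vK 0 t by rewrite et (frame_vgtE T fy') T0.
have psZ a Q : psubst y' (a *: Q) = cst n a * psubst y' Q by exact: mmapZ.
have [Un0 _] := frame_unit fy' U0.
have h1 : h0 * (1 - t) = psubst y' (u^-1 *: P).
  have -> : t = 1 - cst n u^-1 * psubst y' U.
    by rewrite -psZ et /T [LHS]rmorphB rmorph1.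
  by rewrite opprB addrCA subrr addr0 psZ eh mulrCA divfK.
have [N hN] := exists_vgt_mulX g h0 archG tpos.
have sumE : psubst y' (\sum_(i < N) T ^+ i) = \sum_(i < N) t ^+ i.
  by rewrite rmorph_sum; apply: eq_bigr => i _; rewrite rmorphXn et.
exists y', (u^-1 *: P * \sum_(i < N) T ^+ i); split; [exact: fy' | exact: sub |].
have -> : psubst y' (u^-1 *: P * \sum_(i < N) T ^+ i) = h0 * (1 - t) * \sum_(i < N) t ^+ i.
  by rewrite -sumE h1 [LHS]rmorphM.
have -> : h0 - h0 * (1 - t) * \sum_(i < N) t ^+ i = h0 * t ^+ N; last exact: hN.
rewrite -mulrA -[1 - t]opprB mulNr -subrX1 mulrN opprK mulrBr mulr1.
by rewrite addrCA subrr addr0.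
Qed.

End FrameApprox.

(** * The residue map of the hypersurface *)

Lemma birational_ext_adjoin (k L : fieldType) (e : {rmorphism k -> L}) m
    (s : 'I_m -> L) (A B : L -> Prop) :
  (forall z, A z -> B z) -> (forall z, exists a b, [/\ A a, A b, b != 0 & z = a / b]) ->
  (forall c, A (e c)) -> (forall z, B z <-> exists P : {mpoly k[m]}, z = mmap e s P) ->
  birational_ext A B.
Proof.
move=> AB fracA Ae BE.
have adjE z : adjoin A s z <-> B z.
  split=> [[P [hP ->]]|/BE[P ->]].
    have BD x y : B x -> B y -> B (x + y).
      by move=> /BE[p ->] /BE[q ->]; apply/BE; exists (p + q); rewrite rmorphD.
    have BM x y : B x -> B y -> B (x * y).
      by move=> /BE[p ->] /BE[q ->]; apply/BE; exists (p * q); rewrite rmorphM.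
    have Bs i : B (s i) by apply/BE; exists 'X_i; rewrite mmapU.
    have B0 : B 0 by apply/BE; exists 0; rewrite rmorph0.
    have B1 : B 1 by apply/BE; exists 1; rewrite rmorph1.
    rewrite mevalE; apply: (@big_ind _ B 0 +%R B0 BD) => l _; apply: (BM); first exact/AB/hP.
    apply: (@big_ind _ B 1 *%R B1 BM) => i _.
    by elim: (l i) => [|j IH]; rewrite ?expr0 // exprS; apply: BM.
  exists (map_mpoly e P); split=> [l|]; first by rewrite mcoeff_map_mpoly; exact: Ae.
  have := @eq_mpoly_rmorph _ _ _ (mmap e s) (meval s \o map_mpoly e).
  apply=> [c|i] /=; first by rewrite mmapC map_mpolyC mevalC.
  by rewrite mmapU map_mpolyX mevalXU.
split=> // [z|]; first by split=> _; have [a [b [Aa Ab b0 ->]]] := fracA z;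
  exists a, b; split=> //; exact: AB.
exists m, s, (fun z => z = 1); split=> [b ->||||z].
- by apply/adjE/BE; exists 1; rewrite rmorph1.
- by [].
- by move/esym/eqP; rewrite oner_eq0.
- by move=> b c -> ->; rewrite mulr1.
- split=> [Bz|[a [b [/adjE Ba -> ->]]]]; last by rewrite divr1.
  by exists z, 1; rewrite divr1; split=> //; apply/adjE.
Qed.

Section Place.
Variables (k : closedFieldType) (n : nat) (f : {mpoly k[n.+1]}).
Variables (Ks : fieldExtType {fraction {mpoly k[n]}}) (pi : {rmorphism {mpoly k[n.+1]} -> Ks}).
Hypothesis pqf : presents_quotient_field f pi.
Notation T := {mpoly k[n.+1]}.
Notation Q := {fraction T}.
Local Notation res := (residue_f pi f).

Lemma pi_neq0 b : ~ divides f b <-> pi b != 0.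
Proof.
split=> h; first by apply/eqP => /(pqf_ker pqf).
by move=> /(pqf_ker pqf) e; rewrite e eqxx in h.
Qed.

Lemma pi_tofrac_neq0 b : pi b != 0 -> tofrac b != 0 :> Q.
Proof. by rewrite tofrac_eq0; apply: contraNneq => ->; rewrite rmorph0. Qed.

Lemma residue_fE z y : res z y <->
  exists a b, [/\ pi b != 0, z = tofrac a / tofrac b & y = pi a / pi b].
Proof. by split=> -[a [b [h1 h2 h3]]]; exists a, b; split=> //; apply/pi_neq0. Qed.

Lemma residue_f_fun z y y' : res z y -> res z y' -> y = y'.
Proof.
move=> /residue_fE[a [b [b0 -> ->]]] /residue_fE[c [d [d0 + ->]]].
move/eqP; rewrite eqr_div ?pi_tofrac_neq0 // -!tofracM tofrac_eq => /eqP e.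
by apply/eqP; rewrite eqr_div // -!rmorphM e.
Qed.

Lemma residue_tofrac a : res (tofrac a) (pi a).
Proof.
by apply/residue_fE; exists a, 1; rewrite !rmorph1 !divr1 oner_neq0.
Qed.

Lemma residue_fD x y x' y' : res x x' -> res y y' -> res (x + y) (x' + y').
Proof.
move=> /residue_fE[a [b [b0 -> ->]]] /residue_fE[c [d [d0 -> ->]]].
apply/residue_fE; exists (a * d + c * b), (b * d).
rewrite !rmorphM !rmorphD !rmorphM !addf_div ?pi_tofrac_neq0 //.
by rewrite mulf_neq0.
Qed.

Lemma residue_fM x y x' y' : res x x' -> res y y' -> res (x * y) (x' * y').
Proof.
move=> /residue_fE[a [b [b0 -> ->]]] /residue_fE[c [d [d0 -> ->]]].
by apply/residue_fE; exists (a * c), (b * d); rewrite !rmorphM !mulf_div mulf_neq0.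
Qed.

Lemma residue_fN x x' : res x x' -> res (- x) (- x').
Proof.
move=> /residue_fE[a [b [b0 -> ->]]]; apply/residue_fE; exists (- a), b.
by rewrite !rmorphN !mulNr.
Qed.

Lemma residue_fV x x' : res x x' -> x' != 0 -> res x^-1 x'^-1.
Proof.
move=> /residue_fE[a [b [b0 -> ->]]]; rewrite mulf_eq0 invr_eq0 negb_or => /andP[a0 _].
by apply/residue_fE; exists b, a; rewrite !invf_div.
Qed.

Lemma residue_fXz x x' (m : int) : res x x' -> x' != 0 -> res (x ^ m) (x' ^ m).
Proof.
have rX y y' l : res y y' -> res (y ^+ l) (y' ^+ l).
  move=> h; elim: l => [|l IH]; last by rewrite !exprS; exact: residue_fM.
  by rewrite !expr0; have := residue_tofrac 1; rewrite tofrac1 rmorph1.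
move=> h x0; case: m => l; first exact: rX.
by rewrite NegzE -!exprnN; apply: residue_fV (rX _ _ _ h) _; rewrite expf_neq0.
Qed.

Lemma residue_laurent m (x : 'I_m -> Q) (u : 'I_m -> Ks) c :
  (forall i, res (x i) (u i)) -> (forall i, u i != 0) -> res (laurent x c) (laurent u c).
Proof.
move=> xu u0; rewrite /laurent; elim/big_ind2: _ => [|a b a' b'|i _].
- by have := residue_tofrac 1; rewrite tofrac1 rmorph1.
- exact: residue_fM.
- exact: residue_fXz.
Qed.

Lemma loc_fE z : loc_f f z <-> exists y, res z y.
Proof.
split=> [[a [b [h ->]]]|[y [a [b [h -> _]]]]]; last by exists a, b.
by exists (pi a / pi b), a, b.
Qed.

Lemma residue_f0 z : res z 0 <-> exists2 w, loc_f f w & z = tofrac f * w.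
Proof.
split=> [/residue_fE[a [b [b0 -> e]]]|[w /loc_fE[y hy] ->]].
  have a0 : pi a = 0.
    by move/esym/eqP: e; rewrite mulf_eq0 invr_eq0 (negbTE b0) orbF => /eqP.
  have [c ec] := (pqf_ker pqf a).1 a0; exists (tofrac c / tofrac b).
    by exists c, b; split => //; apply/pi_neq0.
  by rewrite ec tofracM mulrA [tofrac f * tofrac c]mulrC.
have f0 : pi f = 0 by apply/(pqf_ker pqf); exists 1; rewrite mul1r.
by rewrite -[X in res _ X](mul0r y) -f0; apply: residue_fM => //; exact: residue_tofrac.
Qed.

Definition pic : {rmorphism k -> Ks} := pi \o @mpolyC n.+1 k.

Lemma residue_psubst (x : 'I_n.+1 -> Q) u P : (forall i, res (x i) (u i)) ->
  res (psubst x P) (mmap pic u P).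
Proof.
move=> xu; elim/mpoly_ring_ind: P => [c|i|p q hp hq|p q hp hq].
- by rewrite psubstC mmapC; exact: residue_tofrac.
- by rewrite psubstX mmapU.
- by rewrite [psubst _ _]rmorphD [mmap _ _ _]rmorphD; exact: residue_fD.
- by rewrite [psubst _ _]rmorphM [mmap _ _ _]rmorphM; exact: residue_fM.
Qed.

Variables (G : ordAbGroupType) (v : valuation Ks G).
Hypothesis v_c : trivial_on v (fun c : k => pi c%:MP).

Definition order_drop (r : nat) : Prop :=
  exists x' : 'I_n.+1 -> Q,
  [/\ alg_indep x',
      birational_ext (poly_subring (@vars k n.+1)) (poly_subring x'),
      along pi v f x',
      center_is_origin pi v f x' &
      exists f' : {mpoly k[n.+1]},
        [/\ strict_transform f x' f',
            birational_ext (residue_subring pi) (image_subring pi f x') &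
            exists2 r' : nat, has_ord (last_axis f') r' & (r' < r)%N]].

(** Everything is read off the residues u of the new variables: their positive values give the ring
    along v and its centre, and the strict transform is the kernel of evaluation at u, since the
    residue of an element vanishes exactly when it lies in f T_(f). *)
Lemma order_drop_intro (x' : 'I_n.+1 -> Q) (u : 'I_n.+1 -> Ks) (f' : T) (r r' : nat) :
  alg_indep x' -> (forall i, poly_subring x' (vars k i)) ->
  (forall i, res (x' i) (u i)) -> (forall i, vmax v (u i)) ->
  irreducible_elt f' -> (forall P, mmap pic u P = 0 <-> divides f' P) ->
  has_ord (last_axis f') r' -> (r' < r)%N -> order_drop r.
Proof.
move=> x'i x'sub xu upos f'irr f'ker ord' lt.
pose pv := preval_of v.
have pv_c c : c != 0 -> pv (pic c) = 0 := v_c (c := c).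
have pv_u i : vgt pv 0 (u i) := upos i.
have resP P := residue_psubst P xu.
have sub z : poly_subring (@vars k n.+1) z -> poly_subring x' z by apply: poly_subring_trans.
have imE y : image_subring pi f x' y <-> exists P, y = mmap pic u P.
  split=> [[_ [P ->] hy]|[P ->]]; last by exists (psubst x' P) => //; exists P.
  by exists P; apply: residue_f_fun hy (resP P).
exists x'; split=> //.
- apply: (birational_ext_adjoin (e := @cst k n.+1) (s := x')) => //.
  + move=> z; have [[a b] /= [b0 ->]] := fraction_ex z.
    exists (tofrac a), (tofrac b); rewrite tofrac_eq0; split=> //.
      by exists a; rewrite psubst_vars.
    by exists b; rewrite psubst_vars.
  + by move=> c; exists c%:MP; rewrite psubstC.
- split=> [z [P ->]|y /imE[P ->]]; first by apply/loc_fE; exists (mmap pic u P).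
  exact: (mmap_vge pv_c pv_u).
- move=> P y /(residue_f_fun (resP P)) <-.
  rewrite vars_idealE -[vmax _ _]/(vgt pv 0 _) (mmap_vgtE pv_c pv_u).
  by split=> /eqP.
- exists f'; split; last by exists r'.
    split=> // P; rewrite -f'ker -residue_f0; split=> [e|]; first by rewrite -e.
    exact: residue_f_fun.
  apply: (birational_ext_adjoin (e := pic) (s := u)) => //.
  + move=> _ [g ->]; exists (tofrac g); last exact: residue_tofrac.
    by apply: sub; exists g; rewrite psubst_vars.
  + move=> z; have [a [b [b0 ->]]] := pqf_frac pqf z.
    by exists (pi a), (pi b); split=> //; [exists a | exists b].
  + by move=> c; exists c%:MP.
Qed.

End Place.

Section Extend.
Variables (n : nat) (T : Type) (a : 'I_n -> T) (b : T).

Definition extend (i : 'I_n.+1) : T := oapp a b (insub (i : nat)).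

Lemma extend_widen j : extend (widen_ord (leqnSn n) j) = a j.
Proof. by rewrite /extend (_ : widen_ord _ j = val j :> nat) // valK. Qed.

Lemma extend_max : extend ord_max = b.
Proof. by rewrite /extend insubF //= ltnn. Qed.

End Extend.

Lemma ord_widen_max n (i : 'I_n.+1) :
  i = ord_max \/ exists j, i = widen_ord (leqnSn n) j.
Proof.
have [lt|] := ltnP i n; first by right; exists (Ordinal lt); exact: val_inj.
by rewrite leq_eqVlt ltnNge -ltnS ltn_ord orbF => /eqP e; left; apply: val_inj.
Qed.

Section Unmuni.
Variables (n : nat) (R : comNzRingType).
Implicit Types (P : {mpoly R[n.+1]}) (p : {poly {mpoly R[n]}}).
Local Notation widen := (widen_ord (leqnSn n)).

Lemma muni_var (m : 'X_{1..n.+1}) :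
  muni ('X_[m] : {mpoly R[n.+1]}) = 'X_[[multinom m (widen i) | i < n]] *: 'X^(m ord_max).
Proof. by rewrite muniE msuppX big_seq1 mcoeffX eqxx scale1r. Qed.

Lemma muni_max : muni ('X_ord_max : {mpoly R[n.+1]}) = 'X.
Proof.
rewrite muni_var mnm1E eqxx expr1.
have -> : [multinom U_(ord_max)%MM (widen i) | i < n] = 0%MM.
  apply/mnmP => i; rewrite mnmE mnm0E mnm1E; case: eqP => // /(congr1 val) /= e.
  by have := ltn_ord i; rewrite -e ltnn.
by rewrite mpolyX0 scale1r.
Qed.

Lemma muni_widen i : muni ('X_(widen i) : {mpoly R[n.+1]}) = ('X_i)%:P.
Proof.
rewrite muni_var mnm1E.
have -> : (widen i == ord_max) = false.
  by apply/eqP => /(congr1 val) /= e; have := ltn_ord i; rewrite e ltnn.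
rewrite expr0 -mul_polyC mulr1; congr ('X_[_])%:P.
by apply/mnmP => j; rewrite mnmE !mnm1E -val_eqE.
Qed.

Lemma muni_mwiden (q : {mpoly R[n]}) : muni (mwiden q) = q%:P.
Proof.
have := @eq_mpoly_rmorph _ _ _ (@muni n R \o @mwiden n R) polyC.
apply=> [c|i] /=; first by rewrite mwidenC muniC.
by rewrite /mwiden mmapU muni_widen.
Qed.

Definition unmuni p : {mpoly R[n.+1]} := (map_poly (@mwiden n R) p).['X_ord_max].

Lemma muniK P : unmuni (muni P) = P.
Proof.
elim/mpoly_ring_ind: P => [c|i|p q hp hq|p q hp hq].
- by rewrite muniC /unmuni map_polyC /= hornerC mwidenC.
- case: (ord_widen_max i) => [->|[j ->]].
    by rewrite muni_max /unmuni map_polyX hornerX.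
  by rewrite muni_widen /unmuni map_polyC hornerC /= /mwiden mmapU.
- by rewrite rmorphD /unmuni rmorphD hornerD [X in X + _]hp [X in _ + X]hq.
- by rewrite rmorphM /unmuni rmorphM hornerM [X in X * _]hp [X in _ * X]hq.
Qed.

Lemma unmuniM p q : unmuni (p * q) = unmuni p * unmuni q.
Proof. by rewrite /unmuni rmorphM hornerM. Qed.

Lemma unmuniE p : unmuni p = \sum_(i < size p) mwiden p`_i * 'X_ord_max ^+ i.
Proof.
rewrite /unmuni (@horner_coef_wide _ (size p)) ?size_poly //.
by apply: eq_bigr => i _; rewrite coef_map.
Qed.

Lemma unmuniK p : muni (unmuni p) = p.
Proof.
rewrite unmuniE rmorph_sum -[RHS]coefK poly_def; apply: eq_bigr => i _.
by rewrite /= muniM [muni (_ ^+ _)]rmorphXn /= muni_max muni_mwiden mul_polyC.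
Qed.

Lemma mmap_extend (S : comNzRingType) (e : {rmorphism R -> S}) (a : 'I_n -> S) b P :
  mmap e (extend a b) P = (map_poly (mmap e a) (muni P)).[b].
Proof.
have := @eq_mpoly_rmorph _ _ _ (mmap e (extend a b))
  (horner_eval b \o (map_poly (mmap e a) \o @muni n R)).
apply=> [c|i] /=; rewrite horner_evalE.
  by rewrite mmapC muniC map_polyC hornerC /= mmapC.
rewrite mmapU; case: (ord_widen_max i) => [->|[j ->]].
  by rewrite extend_max muni_max map_polyX hornerX.
by rewrite extend_widen muni_widen map_polyC hornerC /= mmapU.
Qed.

End Unmuni.

Lemma last_axisE (k : fieldType) n (g : {mpoly k[n.+1]}) :
  last_axis g = map_poly (mcoeff 0%MM) (muni g).
Proof.
have := @eq_mpoly_rmorph _ _ _ (mmap polyC (fun i : 'I_n.+1 => if i == ord_max then 'X else 0))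
  (map_poly (mcoeff 0%MM) \o @muni n k).
apply=> [c|i] /=.
  by rewrite mmapC muniC map_polyC /= mcoeffC eqxx mulr1.
rewrite mmapU; case: (ord_widen_max i) => [->|[j ->]].
  by rewrite eqxx muni_max map_polyX.
rewrite muni_widen map_polyC /= mcoeff0X; case: eqP => // /(congr1 val) /= e.
by have := ltn_ord j; rewrite e ltnn.
Qed.

Lemma fraction_poly_clear (A : idomainType) (p : {poly {fraction A}}) :
  exists (b : A) (q : {poly A}), b != 0 /\ tofrac b *: p = map_poly (@FracField.tofrac A) q.
Proof.
elim/poly_ind: p => [|p c [b [q [b0 e]]]].
  by exists 1, 0; rewrite oner_neq0 scaler0 rmorph0.
have [[c1 c2] /= [c20 ->]] := fraction_ex c.
have t0 : tofrac c2 != 0 by rewrite tofrac_eq0.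
exists (b * c2), (c2 *: q * 'X + (b * c1)%:P); rewrite mulf_neq0 //; split=> //.
transitivity (tofrac c2 *: map_poly (@FracField.tofrac A) q * 'X + (tofrac (b * c1))%:P).
  rewrite -e tofracM scalerDr -!scalerAl scalerA [tofrac c2 * _]mulrC; congr (_ + _).
  rewrite -mul_polyC -polyCM tofracM; congr (_%:P).
  by rewrite -mulrA [tofrac c2 * _]mulrC divfK.
by rewrite -!mul_polyC !rmorphD !rmorphM /= !map_polyC map_polyX.
Qed.

Lemma pred_addn_geq (a b : nat) : (0 < a)%N -> (b <= (a + b).-1)%N.
Proof. by case: a => // a _; rewrite addSn leq_addl. Qed.

(** * The equation of the hypersurface over the base field *)

Section HypersurfaceAlgebra.
Variables (k : closedFieldType) (n : nat) (f : {mpoly k[n.+1]}).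
Variables (Ks : fieldExtType {fraction {mpoly k[n]}}) (pi : {rmorphism {mpoly k[n.+1]} -> Ks}).
Hypothesis pqf : presents_quotient_field f pi.
Hypothesis f_monic : muni f \is monic.
Notation A := {mpoly k[n]}.
Notation K := {fraction A}.
Let z : Ks := pi 'X_ord_max.
Local Notation widen := (widen_ord (leqnSn n)).
Local Notation pic := (pic pi).
Local Notation tf := (@FracField.tofrac A).

Definition base_poly : {poly K} := map_poly tf (muni f).

Lemma pic_cst c : pic c = (cst n c)%:A.
Proof. by rewrite /= -[c%:MP_[n.+1]]mwidenC (pqf_base pqf). Qed.

Lemma pi_horner P : pi P = (map_poly (GRing.in_alg Ks) (map_poly tf (muni P))).[z].
Proof.
have := @eq_mpoly_rmorph _ _ _ pi (horner_eval z \o (map_poly (GRing.in_alg Ks) \o (map_poly tf \o @muni n k))).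
apply=> [c|i] /=; rewrite horner_evalE.
  by rewrite muniC !map_polyC hornerC; exact: pic_cst.
case: (ord_widen_max i) => [->|[j ->]]; first by rewrite muni_max !map_polyX hornerX.
rewrite muni_widen !map_polyC hornerC /= -(pqf_base pqf); congr (pi _).
by rewrite /mwiden mmapU.
Qed.

(** Monicity of f takes the place of Gauss's lemma: after clearing denominators p becomes a multiple
    of f in the polynomial ring, and degrees in the last variable decide. *)
Lemma base_minimal (p : {poly K}) : (size p < size (muni f))%N ->
  (map_poly (GRing.in_alg Ks) p).[z] = 0 -> p = 0.
Proof.
move=> szp pz; have [b [q [b0 e]]] := fraction_poly_clear p.
have tb0 : tf b != 0 by rewrite tofrac_eq0.
have q0 : q = 0.
  have : pi (unmuni q) = 0.
    rewrite pi_horner unmuniK -e map_polyZ hornerZ pz mulr0 //.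
  move/(pqf_ker pqf) => [c /(congr1 (@muni n k))]; rewrite unmuniK muniM => eq.
  apply: contraTeq szp => q0; rewrite -leqNgt -(size_scale p tb0) e.
  rewrite size_map_inj_poly ?rmorph0 //; last by move=> x y /eqP; rewrite tofrac_eq => /eqP.
  have c0 : muni c != 0 by apply: contraNneq q0 => c0; rewrite eq c0 mul0r.
  rewrite eq size_Mmonic //; apply: pred_addn_geq; rewrite size_poly_gt0; exact: c0.
move/eqP: e; rewrite q0 rmorph0 scale_poly_eq0 (negbTE tb0) => /eqP //.
Qed.

(** By [base_minimal] the polynomial of f over K is the minimal polynomial of z. *)
Lemma base_poly_deriv : separable 1 {:Ks} ->
  (map_poly (GRing.in_alg Ks) base_poly)^`().[z] != 0.
Proof.
move=> /separableP/(_ z (memvf z)); rewrite /separable_element separable_poly.unlock => cop.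
set m := minPoly 1%AS z in cop.
have [q eq] : exists q : {poly K}, m = map_poly (GRing.in_alg Ks) q.
  by apply/polyOver1P; exact: minPolyOver.
have tinj : injective tf by move=> x y /eqP; rewrite tofrac_eq => /eqP.
have fz : root (map_poly (GRing.in_alg Ks) base_poly) z.
  by rewrite /root -pi_horner; apply/eqP/(pqf_ker pqf); exists 1; rewrite mul1r.
have mf : m %| map_poly (GRing.in_alg Ks) base_poly.
  by apply: minPoly_dvdp fz; apply/polyOver1P; exists base_poly.
have bm : base_poly \is monic by apply: monic_map.
have mm : m \is monic by exact: monic_minPoly.
have qz : (map_poly (GRing.in_alg Ks) q).[z] = 0 by rewrite -eq; apply/eqP/root_minPoly.
have q0 : q != 0.
  by apply: contraTneq mm => q0; rewrite eq q0 rmorph0 monicE lead_coef0 eq_sym oner_eq0.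
have em : m = map_poly (GRing.in_alg Ks) base_poly.
  apply/eqP; rewrite -eqp_monic ?monic_map // -dvdp_size_eqp // eqn_leq.
  rewrite dvdp_leq //; last by rewrite monic_neq0 ?monic_map.
  rewrite eq !size_map_poly size_map_inj_poly ?rmorph0 // leqNgt.
  by apply/negP => /base_minimal h; rewrite h ?eqxx in q0.
by rewrite -em; apply: coprimep_root cop _; exact: root_minPoly.
Qed.

End HypersurfaceAlgebra.

Lemma size_XaddC_poly (A : nzRingType) (c : A) : size ('X + c%:P) = 2.
Proof. by rewrite -[c]opprK polyCN size_XsubC. Qed.

Section HypersurfaceFrames.
Variables (k : closedFieldType) (n : nat) (f : {mpoly k[n.+1]}).
Variables (Ks : fieldExtType {fraction {mpoly k[n]}}) (pi : {rmorphism {mpoly k[n.+1]} -> Ks}).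
Hypothesis pqf : presents_quotient_field f pi.
Hypothesis f_monic : muni f \is monic.
Notation A := {mpoly k[n]}.
Notation K := {fraction A}.
Notation Q := {fraction {mpoly k[n.+1]}}.
Let z : Ks := pi 'X_ord_max.
Local Notation pic := (pic pi).
Local Notation alg := (GRing.in_alg Ks).
Local Notation widen := (widen_ord (leqnSn n)).

Lemma base_not_root (b : K) : (2 < size (muni f))%N -> z != b%:A.
Proof.
move=> sz; apply/eqP => e; have : 'X - b%:P = 0.
  apply: (base_minimal pqf f_monic); first by rewrite size_XsubC.
  by rewrite rmorphB /= map_polyX map_polyC hornerXsubC -/z e subrr.
by move/eqP; rewrite polyXsubC_eq0.
Qed.

Definition shifted (h : K) : {poly K} := base_poly f \Po ('X + h%:P).

Lemma map_shifted h : map_poly alg (shifted h) = map_poly alg (base_poly f) \Po ('X + (h%:A)%:P).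
Proof. by rewrite map_comp_poly rmorphD /= map_polyX map_polyC. Qed.

Lemma shifted_root h : (map_poly alg (shifted h)).[z - h%:A] = 0.
Proof.
rewrite map_shifted horner_comp hornerD hornerX hornerC subrK -(pi_horner pqf).
by apply/(pqf_ker pqf); exists 1; rewrite mul1r.
Qed.

Lemma shifted_deriv h :
  (map_poly alg (shifted h))^`().[z - h%:A] = (map_poly alg (base_poly f))^`().[z].
Proof.
rewrite map_shifted deriv_comp derivD derivX derivC addr0 mulr1.
by rewrite horner_comp hornerD hornerX hornerC subrK.
Qed.

Lemma mmap_pic_alg (y : 'I_n -> K) (q : A) : mmap pic (fun j => (y j)%:A) q = (psubst y q)%:A.
Proof.
rewrite -[RHS]/(alg (psubst y q)) /psubst mmap_comp; apply: eq_mmap => // c.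
exact: (pic_cst pqf).
Qed.

Lemma eval_extend y b P :
  mmap pic (extend (fun j => (y j)%:A) b) P = (map_poly alg (map_poly (psubst y) (muni P))).[b].
Proof.
rewrite mmap_extend; congr (_.[b]); rewrite -map_poly_comp.
by apply: eq_map_poly => q; exact: mmap_pic_alg.
Qed.

(** Division by the monic [Fp] leaves a remainder of smaller degree vanishing at z - h; translated
    back by h, it vanishes at z and is 0 by [base_minimal]. *)
Lemma frame_kernel y H (Fp : {poly A}) : alg_indep y -> Fp \is monic ->
  size Fp = size (muni f) -> map_poly (psubst y) Fp = shifted (psubst y H) ->
  forall P, mmap pic (extend (fun j => (y j)%:A) (z - (psubst y H)%:A)) P = 0 <->
    divides (unmuni Fp) P.
Proof.
move=> yi Fm szF eF P; set h := psubst y H in eF *.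
have F0 : (map_poly alg (map_poly (psubst y) Fp)).[z - h%:A] = 0.
  by rewrite eF shifted_root.
rewrite eval_extend; split=> [P0|[c ->]]; last first.
  by rewrite muniM unmuniK !rmorphM hornerM F0 mulr0.
have [q [rm [szr er rm0]]] : exists q rm : {poly A}, [/\ (size rm < size Fp)%N,
    muni P = q * Fp + rm &
    (map_poly alg (map_poly (psubst y) rm)).[z - h%:A] = 0].
  exists (Pdiv.CommonRing.rdivp (muni P) Fp), (Pdiv.CommonRing.rmodp (muni P) Fp); split.
  - by rewrite Pdiv.Ring.ltn_rmodpN0 // monic_neq0.
  - exact: Pdiv.RingMonic.rdivp_eq.
  - move: P0; rewrite {1}(Pdiv.RingMonic.rdivp_eq Fm (muni P)).
    by rewrite !rmorphD !rmorphM hornerD hornerM F0 mulr0 add0r.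
have sz2 : size ('X - h%:P) = 2 by exact: size_XsubC.
have : map_poly (psubst y) rm \Po ('X - h%:P) = 0.
  apply: (base_minimal pqf f_monic).
    by rewrite size_comp_poly2 // -szF; apply: leq_ltn_trans szr; exact: size_poly.
  rewrite map_comp_poly rmorphB /= map_polyX map_polyC horner_comp hornerXsubC.
  exact: rm0.
move/eqP; rewrite comp_poly2_eq0 // => /eqP e0.
have r0 : rm = 0.
  apply: (map_inj_poly yi); first exact: rmorph0.
  by rewrite e0 rmorph0.
by exists (unmuni q); rewrite -[LHS](muniK P) er r0 addr0 unmuniM.
Qed.

Variables (G : ordAbGroupType) (vK : prevaluation K G).
Hypothesis vK_c : forall c, c != 0 -> vK (cst n c) = 0.
Hypothesis vars_pos : forall i, vgt vK 0 (vars k i).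

(** The old variables are polynomials in y without constant term, and so is H. Hence the change of
    coordinates does not affect the restriction to the last axis, and the order r survives. *)
Lemma frame_poly y H : frame vK y -> H@_0%MM = 0 ->
  exists Fp : {poly A}, [/\ Fp \is monic, size Fp = size (muni f),
    map_poly (psubst y) Fp = shifted (psubst y H) &
    map_poly (mcoeff 0%MM) Fp = last_axis f].
Proof.
move=> fy H0; have [Y hY] := choice (frame_vars fy).
have Y0 i : (Y i)@_0%MM = 0.
  by apply/eqP; rewrite -(frame_vgtE vK_c (Y i) fy) -hY vars_pos.
pose phi : {rmorphism A -> A} := mmap (@mpolyC n k) Y.
have phiE P : psubst y (phi P) = tofrac P by rewrite -psubst_vars (psubst_psubst P hY).
have phi0 P : (phi P)@_0%MM = P@_0%MM.
  have := @eq_mpoly_rmorph _ _ _ (mcoeff 0%MM \o phi) (mcoeff 0%MM).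
  by apply=> [c|i] /=; rewrite /phi /= ?mmapC ?mmapU ?Y0 ?mcoeff0X.
pose p := map_poly phi (muni f).
have pm : p \is monic by exact: monic_map.
have szp : size p = size (muni f).
  by rewrite size_map_poly_id0 // (monicP f_monic) rmorph1 oner_neq0.
have sz2 : size ('X + H%:P) = 2 := size_XaddC_poly H.
exists (p \Po ('X + H%:P)); split.
- rewrite monicE lead_coef_comp ?sz2 // (monicP pm) mul1r.
  by rewrite lead_coefDl ?size_polyX ?lead_coefX ?expr1n // ltnS size_polyC; case: (_ != _).
- by rewrite size_comp_poly2.
- rewrite map_comp_poly rmorphD /= map_polyX map_polyC /shifted; congr (_ \Po _).
  by rewrite /p /base_poly -map_poly_comp; apply: eq_map_poly => q; exact: phiE.
- rewrite map_comp_poly rmorphD /= map_polyX map_polyC /= H0 addr0 comp_polyXr.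
  by rewrite last_axisE /p -map_poly_comp; apply: eq_map_poly => q; exact: phi0.
Qed.

Lemma mwiden_tofrac_inj : injective (@FracField.tofrac {mpoly k[n.+1]} \o @mwiden n k).
Proof. by move=> p q /= /eqP; rewrite tofrac_eq => /eqP /inj_mwiden. Qed.

Definition wfrac : {rmorphism K -> Q} := fraction_lift mwiden_tofrac_inj.

Lemma wfrac_tofrac a : wfrac (tofrac a) = tofrac (mwiden a).
Proof. exact: fraction_lift_tofrac. Qed.

Lemma residue_wfrac a : residue_f pi f (wfrac a) a%:A.
Proof.
have [[b c] /= [c0 ->]] := fraction_ex a.
have e : (tofrac b / tofrac c)%:A = pi (mwiden b) / pi (mwiden c) :> Ks.
  by rewrite !(pqf_base pqf) -[LHS]/(alg _) fmorph_div.
have p0 : pi (mwiden c) != 0.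
  by rewrite (pqf_base pqf) in_alg_eq0 tofrac_eq0.
rewrite fmorph_div !wfrac_tofrac e; apply: (residue_fM pqf); first exact: residue_tofrac.
by apply: (residue_fV pqf) => //; exact: residue_tofrac.
Qed.

(** The coordinates (y, x_m - H) in the fraction field of T. Their residues are y and z - H in K*,
    and the monomial changes are later performed on both in parallel. *)
Definition xi (y : 'I_n -> K) (H : A) : 'I_n.+1 -> Q :=
  extend (wfrac \o y) (tofrac 'X_ord_max - wfrac (psubst y H)).

Lemma mmap_wfrac y q : mmap (@cst k n.+1) (wfrac \o y) q = wfrac (psubst y q).
Proof.
rewrite /psubst mmap_comp; apply: eq_mmap => // c /=.
by rewrite /cst wfrac_tofrac mwidenC.
Qed.

Lemma wfrac_transcendental (p : {poly K}) : (map_poly wfrac p).[tofrac 'X_ord_max] = 0 -> p = 0.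
Proof.
move=> e; have [b [q [b0 eq]]] := fraction_poly_clear p.
have tb : tofrac b != 0 by rewrite tofrac_eq0.
have uE : (map_poly wfrac (map_poly (@FracField.tofrac A) q)).[tofrac 'X_ord_max] = tofrac (unmuni q).
  rewrite -map_poly_comp /unmuni -horner_map /= -map_poly_comp; congr (_.[_]).
  by apply: eq_map_poly => a /=; rewrite wfrac_tofrac.
have u0 : unmuni q = 0.
  apply/eqP; rewrite -tofrac_eq0 -uE -eq map_polyZ hornerZ e mulr0 //.
have q0 : q = 0 by rewrite -(unmuniK q) u0 muni0.
by move/eqP: eq; rewrite q0 rmorph0 scale_poly_eq0 (negbTE tb) => /eqP.
Qed.

Lemma xi_indep y H : alg_indep y -> alg_indep (xi y H).
Proof.
move=> yi; apply: raddf_inj => P e0.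
have e : mmap (@cst k n.+1)
    (extend (wfrac \o y) (tofrac 'X_ord_max - wfrac (psubst y H))) P = 0 := e0.
rewrite mmap_extend in e.
have e1 : map_poly (psubst y) (muni P) \Po ('X - (psubst y H)%:P) = 0.
  apply: wfrac_transcendental.
  rewrite map_comp_poly rmorphB /= map_polyX map_polyC horner_comp hornerXsubC -map_poly_comp.
  rewrite -[RHS]e; congr (_.[_]); apply: eq_map_poly => q; exact/esym/mmap_wfrac.
move/eqP: e1; rewrite comp_poly2_eq0 ?size_XsubC // => /eqP e2.
have m0 : muni P = 0.
  by apply: (map_inj_poly yi); [exact: rmorph0 | rewrite e2 rmorph0].
by rewrite -(muniK P) m0 /unmuni rmorph0 horner0.
Qed.

Lemma psubst_xi_mwiden y H q : psubst (xi y H) (mwiden q) = wfrac (psubst y q).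
Proof.
by rewrite /psubst /xi mmap_extend muni_mwiden map_polyC hornerC /= mmap_wfrac.
Qed.

Lemma xi_vars y H : frame vK y -> forall i, poly_subring (xi y H) (vars k i).
Proof.
move=> fy i; case: (ord_widen_max i) => [->|[j ->]].
  exists ('X_ord_max + mwiden H).
  rewrite [psubst _ (_ + _)]rmorphD [X in X + _]psubstX [X in _ + X]psubst_xi_mwiden.
  by rewrite /xi extend_max subrK.
have [Y eY] := frame_vars fy j; exists (mwiden Y).
by rewrite psubst_xi_mwiden -eY /vars wfrac_tofrac /mwiden mmapU.
Qed.

Lemma xi_residue y H i :
  residue_f pi f (xi y H i) (extend (fun j => (y j)%:A) (z - (psubst y H)%:A) i).
Proof.
rewrite /xi; case: (ord_widen_max i) => [->|[j ->]].
  rewrite !extend_max; apply: (residue_fD pqf); first exact: residue_tofrac.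
  by apply: (residue_fN pqf); exact: residue_wfrac.
by rewrite !extend_widen; exact: residue_wfrac.
Qed.

End HypersurfaceFrames.

(** * The Perron transform *)

Lemma shifted_powers_order (F : fieldType) (I : finType) (P : pred I) (lam : I -> nat)
    (g : I -> F) (a : F) (r : nat) :
  a != 0 -> (exists i, P i) -> (forall i, P i -> g i != 0) ->
  (forall i j, P i -> P j -> lam i = lam j -> i = j) ->
  (forall i j, P i -> P j -> (lam i < lam j + r)%N) ->
  let p := \sum_(i | P i) g i *: ('X + a%:P) ^+ lam i in p != 0 /\ (mup 0 p < r)%N.
Proof.
move=> a0 [i' Pi'] g0 inj lt p.
case: (arg_minnP lam Pi') => i1 Pi1 min {i' Pi'}.
pose q := \sum_(i | P i) g i *: 'X^(lam i - lam i1).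
have pE : p = ('X + a%:P) ^+ lam i1 * (q \Po ('X + a%:P)).
  rewrite /q raddf_sum /= mulr_sumr; apply: eq_bigr => i Pi.
  by rewrite comp_polyZ rmorphXn /= comp_polyX -scalerAr -exprD subnKC ?min.
(* Only i1 contributes to the constant term, the exponents being distinct; so q does not vanish. *)
have q0 : q`_0 != 0.
  rewrite /q coef_sum (bigD1 i1) //= subnn expr0 coefZ coef1 mulr1 big1 ?addr0 ?g0 //.
  move=> i /andP[Pi ne]; rewrite coefZ coefXn; case: eqP => [e|_]; last by rewrite mulr0.
  case/eqP: ne; apply: inj => //; apply/eqP; rewrite eqn_leq min // andbT.
  by rewrite -subn_eq0 -e.
have qn0 : q != 0 by apply: contraNneq q0 => ->; rewrite coef0.
have szq : (size q <= r)%N.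
  apply: leq_trans (size_sum _ _ _) _; apply/bigmax_leqP => i Pi.
  apply: leq_trans (size_scale_leq _ _) _; rewrite size_polyXn.
  by have := lt i i1 Pi Pi1; have := min i Pi; lia.
have sz2 : size ('X + a%:P) = 2 := size_XaddC_poly a.
have q'0 : q \Po ('X + a%:P) != 0 by rewrite comp_poly2_eq0.
have l0 : 'X + a%:P != 0 by rewrite -size_poly_eq0 sz2.
have p0 : p != 0 by rewrite pE mulf_neq0 ?expf_neq0.
split=> //; rewrite mup_ltn //; apply/negP; rewrite pE Gauss_dvdpr.
  move/dvdp_leq => /(_ q'0); rewrite size_comp_poly2 // size_exp_XsubC.
  by rewrite ltnNge szq.
apply/coprimep_expl/coprimep_expr; rewrite coprimep_sym coprimep_XsubC.
by rewrite /root hornerD hornerX hornerC add0r.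
Qed.

HB.instance Definition _ (k : fieldType) n :=
  GRing.RMorphism.copy (@last_axis k n)
    (mmap polyC (fun i : 'I_n.+1 => if i == ord_max then 'X else 0)).

Section LastAxis.
Variables (k : fieldType) (n : nat).
Implicit Types P : {mpoly k[n.+1]}.

Lemma last_axisX i : last_axis ('X_i : {mpoly k[n.+1]}) = if i == ord_max then 'X else 0.
Proof. exact: mmapU. Qed.

Lemma last_axisC c : last_axis (c%:MP : {mpoly k[n.+1]}) = c%:P.
Proof. exact: mmapC. Qed.

Lemma last_axis_mnm (e : 'X_{1..n.+1}) : e ord_max = 0%N ->
  last_axis ('X_[e] : {mpoly k[n.+1]}) = (e == 0%MM)%:R.
Proof.
move=> emax; have [->|ne] := eqVneq e 0%MM; first by rewrite mpolyX0 rmorph1.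
have [i ei] : exists i, e i != 0%N.
  apply/existsP; apply: contraT; rewrite negb_exists => /forallP h; case/eqP: ne.
  by apply/mnmP => i; rewrite mnm0E; apply/eqP; rewrite -[_ == _]negbK h.
rewrite mpolyXE_id rmorph_prod (bigD1 i) //= rmorphXn /= last_axisX.
have im : i != ord_max by apply: contraNneq ei => ->; rewrite emax.
by rewrite (negbTE im) expr0n (negbTE ei) mul0r.
Qed.

(** Used for the powers of x_m + alpha, which are invisible at the origin but must leave the strict
    transform. Each division lowers the degree on the last axis, so the process ends. *)
Lemma linear_power_factor (a : k) P : last_axis P != 0 ->
  exists l f', P = ('X_ord_max - a%:MP) ^+ l * f' /\ ~ divides ('X_ord_max - a%:MP) f'.
Proof.
have [d] := ubnP (size (last_axis P)); elim: d P => // d IH P lt P0.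
have [[Q eQ]|nd] := pselect (divides ('X_ord_max - a%:MP) P); last first.
  by exists 0%N, P; rewrite expr0 mul1r.
have eL : last_axis P = last_axis Q * ('X - a%:P).
  by rewrite eQ rmorphM rmorphB /= last_axisX eqxx last_axisC.
have Q0 : last_axis Q != 0 by apply: contraNneq P0 => e; rewrite eL e mul0r.
have [|l [f' [e nd]]] := IH Q _ Q0.
  by move: lt; rewrite eL size_Mmonic ?monicXsubC // size_XsubC addnS addn1.
by exists l.+1, f'; rewrite eQ e exprSr mulrAC.
Qed.

End LastAxis.

Section PrimeCancel.
Variables (A : idomainType) (f p : A).
Hypothesis p_prime : forall x y, divides p (x * y) -> divides p x \/ divides p y.
Hypothesis p0 : p != 0.
Hypothesis pf : ~ divides p f.

Lemma prime_cancel x : divides f (p * x) -> divides f x.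
Proof.
case=> c e; have [[d ed]|//] : divides p c \/ divides p f.
  by apply: p_prime; exists x; rewrite -e mulrC.
by exists d; apply: (mulfI p0); rewrite e ed mulrAC mulrC.
Qed.

End PrimeCancel.

Lemma kernel_irreducible (A : idomainType) (L : fieldType) (h : {rmorphism A -> L}) (f : A) :
  f != 0 -> (forall x, h x = 0 <-> divides f x) -> irreducible_elt f.
Proof.
move=> f0 ker.
have hf : h f = 0 by apply/ker; exists 1; rewrite mul1r.
have unit_of b c d : f = b * c -> b = d * f -> c \is a GRing.unit.
  move=> e ed; apply/unitrPr; exists d; apply: (mulfI f0).
  by rewrite mulr1 [RHS]e [in RHS]ed; ring.
split=> // [|b c e].
  apply/negP => /unitrPr[y /(congr1 h)].
  by rewrite rmorphM hf mul0r rmorph1 => /esym/eqP; rewrite oner_eq0.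
move: hf; rewrite e rmorphM => /eqP; rewrite mulf_eq0.
case/orP=> /eqP/ker[d ed]; [right | left].
  exact: unit_of e ed.
by apply: (unit_of c b d) ed; rewrite e mulrC.
Qed.

(* The substitution x_i |-> prod_j w_j^(A i j), where w_j = x_j, except that
   w_last = x_last + alpha. *)
Section MonomialSubstitution.
Variables (k : closedFieldType) (n : nat) (D : pred 'I_n.+1) (A B : 'M[int]_n.+1) (alpha : k).
Hypothesis hm : monomial_change D A B.
Notation T := {mpoly k[n.+1]}.

Definition shift_var (j : 'I_n.+1) : T :=
  'X_j + (if j == ord_max then alpha%:MP else 0).
Definition subst_var (i : 'I_n.+1) : T := \prod_j shift_var j ^+ `|A i j|%N.
Definition msubst : T -> T := mmap (@mpolyC n.+1 k) subst_var.
HB.instance Definition _ := GRing.RMorphism.on msubst.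

Lemma msubstX i : msubst 'X_i = subst_var i.
Proof. exact: mmapU. Qed.

Lemma msubst_mnm (m : 'X_{1..n.+1}) :
  msubst 'X_[m] = \prod_j shift_var j ^+ `|(mnm_row m *m A) 0%R j|%N.
Proof.
rewrite /msubst mmapX /mmap1.
transitivity (\prod_i \prod_j shift_var j ^+ (`|A i j| * m i)%N).
  apply: eq_bigr => i _; rewrite /subst_var -prodrXl.
  by apply: eq_bigr => j _; rewrite exprM.
rewrite exchange_big /=; apply: eq_bigr => j _.
rewrite prodrXr; congr (_ ^+ _); apply/eqP; rewrite -eqz_nat gez0_abs.
  rewrite mxE (big_morph Posz PoszD (erefl _)); apply/eqP; apply: eq_bigr => i _.
  by rewrite PoszM mxE gez0_abs ?(mc_ge0 hm) // mulrC.
by rewrite mxE sumr_ge0 // => i _; rewrite mxE mulr_ge0 ?(mc_ge0 hm).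
Qed.

Lemma shift_var_mnm (e : 'I_n.+1 -> nat) :
  \prod_j shift_var j ^+ e j =
  'X_[[multinom (if j == ord_max then 0%N else e j) | j < n.+1]] * shift_var ord_max ^+ e ord_max.
Proof.
rewrite (bigD1 ord_max) //= mulrC; congr (_ * _).
rewrite mpolyXE_id [RHS](bigD1 ord_max) //= mnmE eqxx expr0 mul1r.
by apply: eq_bigr => j /negbTE jm; rewrite mnmE /shift_var jm addr0.
Qed.

Section Evaluation.
Variables (L : fieldType) (e : {rmorphism k -> L}) (x : 'I_n.+1 -> L).
Hypothesis x0 : forall i, x i != 0.

Definition new_var (j : 'I_n.+1) : L :=
  laurent x (row j B) - (if j == ord_max then e alpha else 0).

Lemma eval_shift_var j : mmap e new_var (shift_var j) = laurent x (row j B).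
Proof.
rewrite [LHS]rmorphD [X in X + _]mmapU /new_var; case: eqP => _.
  by rewrite [X in _ + X]mmapC subrK.
by rewrite [X in _ + X]rmorph0 subr0 addr0.
Qed.

Lemma eval_subst_var i : mmap e new_var (subst_var i) = x i.
Proof.
rewrite /subst_var rmorph_prod /= -[RHS]laurent_delta (laurent_change _ x0 hm) -rowE.
rewrite laurent_abs_mnm; last by move=> j; rewrite mxE (mc_ge0 hm).
apply: eq_bigr => j _; rewrite mnmE !mxE rmorphXn; congr (_ ^+ _).
exact: eval_shift_var.
Qed.

Lemma eval_msubst P : mmap e new_var (msubst P) = mmap e x P.
Proof. by rewrite /msubst mmap_mmap; apply: eq_mmap => // i; exact: eval_subst_var. Qed.

Lemma new_var_independent : injective (mmap e x : T -> L) ->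
  injective (mmap e new_var : T -> L).
Proof.
move=> xi; apply: raddf_inj => P P0.
pose s : {rmorphism T -> T} := mmap (@mpolyC n.+1 k)
  (fun j => 'X_j - (if j == ord_max then alpha%:MP else 0)).
pose s' : {rmorphism T -> T} := mmap (@mpolyC n.+1 k) shift_var.
have ss : s' (s P) = P.
  have := @eq_mpoly_rmorph _ _ _ (s' \o s) idfun.
  apply=> [c|i] /=; first by rewrite /s /s' /= !mmapC.
  rewrite /s /= mmapU rmorphB /s' /= mmapU /shift_var.
  by case: eqP => _; rewrite ?mmapC ?rmorph0 ?subr0 ?addr0 ?addrK.
have sE : mmap e (fun j => laurent x (row j B)) (s P) = mmap e new_var P.
  rewrite /s /= mmap_mmap; apply: eq_mmap => // j.
  rewrite rmorphB /= mmapU /new_var; case: eqP => _; first by rewrite mmapC.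
  by rewrite rmorph0.
suff s0 : s P = 0 by rewrite -ss s0 rmorph0.
apply: (laurent_independent xi x0 (mc_invV hm)).
by rewrite sE [LHS]P0 rmorph0.
Qed.

(** The new variables are Laurent in the old ones. This brings a polynomial relation between the new
    residues back to the old coordinates, where the kernel is known. *)
Lemma clear_denominators P : exists (m : 'X_{1..n.+1}) (P' : T),
  mmap e x 'X_[m] * mmap e new_var P = mmap e x P'.
Proof.
elim/mpoly_ring_ind: P => [c|j|p q [m [p' ep]] [l [q' eq]]|p q [m [p' ep]] [l [q' eq]]].
- by exists 0%MM, c%:MP; rewrite mpolyX0 rmorph1 mul1r !mmapC.
- pose m := abs_mnm (row j B).
  pose c : T := if j == ord_max then alpha%:MP else 0.
  exists m, ('X_[abs_mnm (row j B + mnm_row m)] - 'X_[m] * c).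
  rewrite rmorphB rmorphM /= mmapU /new_var mulrBr; congr (_ - _ * _).
    rewrite !mmapX -(@laurent_abs_mnm _ _ x (row j B + mnm_row m)) => [|i].
      by rewrite mmap1_laurent laurentD // mulrC.
    by rewrite !mxE /m /abs_mnm mnmE !mxE; lia.
  by rewrite /c; case: (j == ord_max); [rewrite mmapC | rewrite (rmorph0 (mmap e x))].
- exists (m + l)%MM, ('X_[l] * p' + 'X_[m] * q').
  rewrite mpolyXD !rmorphD !rmorphM /= mulrDr -ep -eq; ring.
- exists (m + l)%MM, (p' * q').
  rewrite mpolyXD !rmorphM /= -ep -eq; ring.
Qed.

End Evaluation.
End MonomialSubstitution.

Section Transform.
Variables (k : closedFieldType) (n : nat) (f : {mpoly k[n.+1]}).
Variables (Ks : fieldExtType {fraction {mpoly k[n]}}) (pi : {rmorphism {mpoly k[n.+1]} -> Ks}).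
Hypothesis pqf : presents_quotient_field f pi.
Variables (G : ordAbGroupType) (v : valuation Ks G).
Hypothesis v_c : trivial_on v (fun c : k => pi c%:MP).
Hypothesis v_res : residue_field_is v (fun c : k => pi c%:MP).
Notation T := {mpoly k[n.+1]}.
Notation Q := {fraction T}.
Local Notation pic := (pic pi).
Let pv := preval_of v.

Variables (xi : 'I_n.+1 -> Q) (u : 'I_n.+1 -> Ks) (F : T).
Hypothesis xi_indep : alg_indep xi.
Hypothesis xi_vars : forall i, poly_subring xi (vars k i).
Hypothesis xi_res : forall i, residue_f pi f (xi i) (u i).
Hypothesis u0 : forall i, u i != 0.
Hypothesis u_pos : forall i, 0 < v (u i).
Hypothesis kerF : forall P, mmap pic u P = 0 <-> divides F P.

Variables (D0 : pred 'I_n.+1) (c0 : 'rV[int]_n.+1).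
Let D := [pred i | D0 i || (i == ord_max)].
Let t i := v (u i).
Hypothesis D0_max : ~~ D0 ord_max.
Hypothesis c0D : supported D c0.
Hypothesis c0_neq0 : c0 != 0.
Hypothesis c0_rel : mval t c0 = 0.
Hypothesis c0_gen : forall c, supported D c -> mval t c = 0 -> exists a : int, c = a *: c0.

Variables (r : nat) (S : pred 'I_r.+1) (m : 'I_r.+1 -> 'X_{1..n.+1}) (g : 'I_r.+1 -> T) (rest : T).
Let Mm (i : 'I_r.+1) : 'X_{1..n.+1} := (m i + U_(ord_max) *+ i)%MM.
Hypothesis F_eq : F = \sum_(i | S i) 'X_[Mm i] * g i + 'X_ord_max ^+ r.+1 * rest.
Hypothesis m_supp : forall i, S i -> supported D0 (mnm_row (m i)).
Hypothesis g_unit : forall i, S i -> (g i)@_0%MM != 0.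
Hypothesis S_max : S ord_max.
Hypothesis m_max : m ord_max = 0%MM.

Variable i0 : 'I_r.+1.
Hypothesis S_i0 : S i0.
Let M i := mnm_row (Mm i).
Hypothesis i0_min : forall i, S i -> mval t (M i0) <= mval t (M i).
(** The exponent vectors of two terms of least value differ by a times [c0], and after the transform
    their powers of x_m + alpha differ by a up to sign. *)
Hypothesis gap : forall i j (a : int), S i -> S j ->
  mval t (M i) = mval t (M i0) -> mval t (M j) = mval t (M i0) ->
  i%:Z - j%:Z = a * c0 0 ord_max -> `|a| < r%:Z.

Lemma M_last i : S i -> M i 0 ord_max = i%:Z.
Proof.
move=> Si; rewrite mxE mnmDE mulmnE mnm1E eqxx mul1n.
by have := m_supp Si D0_max; rewrite mxE => -[->].
Qed.

Lemma M_supp i : S i -> supported D (M i).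
Proof.
move=> Si j; rewrite negb_or => /andP[jD jm]; rewrite mxE mnmDE mulmnE mnm1E.
rewrite eq_sym (negbTE jm) mul0n addn0; have := m_supp Si jD.
by rewrite mxE.
Qed.

Lemma supportedB (E : pred 'I_n.+1) (c d : 'rV[int]_n.+1) :
  supported E c -> supported E d -> supported E (c - d).
Proof. by move=> h1 h2 j jE; rewrite !mxE h1 // h2 // subr0. Qed.

Lemma perron_transform : order_drop f pi v r.
Proof.
have tD i : D i -> 0 < t i by move=> _; exact: u_pos.
have [A [B [hm tmax tD0 [e ee c0A] ss]]] :=
  perron_dependent [seq M i - M i0 | i <- enum S] D0_max tD c0D c0_neq0 c0_rel c0_gen.
have Dmax : D ord_max by rewrite /= eqxx orbT.
pose t' := mact B t.
have tmax' : t' ord_max = 0 := tmax.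
have w0 j : laurent u (row j B) != 0 by exact: laurent_neq0.
have wv j : v (laurent u (row j B)) = t' j.
  by rewrite [LHS](preval_laurent pv) // /t' mact_mval.
have [|alpha [halpha _]] := v_res (x := laurent u (row ord_max B)).
  by rewrite /vring wv tmax' lexx orbT.
(* The transformed last variable has value exactly 0, so its residue is not zero. *)
have alpha0 : alpha != 0.
  apply: contraTneq halpha => ->; rewrite mpolyC0 rmorph0 subr0.
  by rewrite /vmax (negbTE (w0 _)) wv tmax' ltxx.
pose x' := new_var B alpha (@cst k n.+1) xi.
pose u' := new_var B alpha pic u.
pose phi : {rmorphism T -> T} := msubst A alpha.
have xi0 i : xi i != 0.
  by rewrite -psubstX -(rmorph0 (psubst xi)) (inj_eq xi_indep) mpolyX_neq0.
have x'i : alg_indep x' := new_var_independent (alpha := alpha) hm xi0 xi_indep.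
have phix P : psubst x' (phi P) = psubst xi P := eval_msubst alpha hm (@cst k n.+1) xi0 P.
have phiu P : mmap pic u' (phi P) = mmap pic u P := eval_msubst alpha hm pic u0 P.
have x'vars i : poly_subring x' (vars k i).
  by have [P eP] := xi_vars i; exists (phi P); rewrite phix.
have x'res i : residue_f pi f (x' i) (u' i).
  apply: (residue_fD pqf); first exact: residue_laurent.
  apply: (residue_fN pqf); case: (i == ord_max); first exact: residue_tofrac.
  by have := residue_tofrac pqf 0; rewrite tofrac0 rmorph0.
have u'pos i : vmax v (u' i).
  rewrite /u' /new_var; case: eqP => [->|/eqP im]; first exact: halpha.
  rewrite subr0 /vmax (negbTE (w0 _)) wv /=.
  have [iD|iD] := boolP (D0 i); first exact: tD0.
  have iD' : ~~ D i by rewrite negb_or iD im.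
  by rewrite -wv (laurent_out _ hm iD') u_pos.
pose ex i j := `|(M i *m A) 0%R j|%N.
have exE i j : (ex i j)%:Z = (M i *m A) 0 j.
  by rewrite gez0_abs // mxE sumr_ge0 // => l _; rewrite mulr_ge0 ?(mc_ge0 hm) // mxE.
pose E i : 'X_{1..n.+1} := [multinom (if j == ord_max then 0%N else ex i j) | j < n.+1].
pose W := shift_var alpha (@ord_max n).
have phiM i : phi 'X_[Mm i] = 'X_[E i] * W ^+ ex i ord_max.
  rewrite [LHS](msubst_mnm alpha hm) -shift_var_mnm; apply: eq_bigr => j _ //.
have relA c : supported D c -> mval t c = mval t' (c *m A) by move=> _; exact: mval_change hm.
have Mrel i : S i -> supported D (M i - M i0).
  by move=> Si; apply: supportedB; exact: M_supp.
have outA i j : S i -> ~~ D j -> (M i *m A) 0 j = 0.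
  by move=> Si jD; apply: (supported_change hm (M_supp Si)).
have Ele i : S i -> (E i0 <= E i)%MM.
  move=> Si; apply/mnm_lepP => j; rewrite !mnmE; case: eqP => // /eqP jm.
  rewrite -lez_nat !exE.
  have [jD|jD] := boolP (D0 j); last by rewrite !outA ?lexx // negb_or jD jm.
  pose c := (M i - M i0) *m A.
  (* Clearing the last entry does not change the value, the last variable having value 0. What
     remains has one sign on D0, where all values are positive. *)
  pose c' : 'rV[int]_n.+1 := \row_l (if l == ord_max then 0 else c 0 l).
  have c'E l : D0 l -> c' 0 l = c 0 l.
    by move=> lD; rewrite /c' mxE ifN //; apply: contraTneq lD => ->.
  have c'D : supported D0 c'.
    move=> l lD; rewrite /c' mxE; case: ifP => // lm.
    by rewrite (supported_change hm (Mrel i Si)) // negb_or lD lm.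
  have ssc : same_sign D0 c'.
    have [|h|h] := ss (M i - M i0); first by apply: map_f; rewrite mem_enum.
      by left=> l lD; rewrite c'E // h.
    by right=> l lD; rewrite c'E // h.
  have val_c' : mval t' c' = mval t' c.
    by apply: eq_bigr => l _; rewrite /c' mxE; case: eqP => // ->; rewrite tmax' !mul0rz.
  have : 0 <= c' 0 j.
    apply: (same_sign_ge0 tD0 c'D ssc _ jD); rewrite [mval _ _]val_c' -(mval_change _ _ hm) mvalB.
    by rewrite ogsub_ge0 i0_min.
  rewrite c'E // /c mulmxBl [X in 0 <= X]mxE [X in _ + X]mxE subr_ge0 //.
have Eeq i : S i -> E i = E i0 -> mval t (M i) = mval t (M i0).
  move=> Si eE; apply/eqP; rewrite -subr_eq0 -mvalB (mval_change _ _ hm).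
  have -> : (M i - M i0) *m A = ((M i - M i0) *m A) 0 ord_max *: delta_mx 0 ord_max.
    apply/rowP => j; rewrite [RHS]mxE [delta_mx _ _ _ _]mxE eqxx /=.
    have [->|jm] := eqVneq j ord_max; first by rewrite mulr1.
    rewrite mulr0 mulmxBl [LHS]mxE [X in _ + X]mxE -!exE.
    have := congr1 (fun q : 'X_{1..n.+1} => q j) eE; rewrite !mnmE (negbTE jm) => ->.
    by rewrite subrr.
  by rewrite mvalZ mval_delta tmax mul0rz.
have rel2 i j : S i -> S j -> E i = E i0 -> E j = E i0 -> exists2 a : int,
    i%:Z - j%:Z = a * c0 0 ord_max & (ex i ord_max)%:Z - (ex j ord_max)%:Z = a * e.
  move=> Si Sj ei ej; have [||a ea] := c0_gen (c := M i - M j).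
  - by apply: supportedB; exact: M_supp.
  - by rewrite mvalB !Eeq // subrr.
  exists a; first by rewrite -(M_last Si) -(M_last Sj); have /rowP/(_ ord_max) := ea; rewrite !mxE.
  rewrite !exE; have /(congr1 (fun q => (q *m A) 0 ord_max)) := ea.
  rewrite mulmxBl -scalemxAl c0A [LHS]mxE [X in _ + X]mxE => ->.
  by rewrite !mxE !eqxx mulr1.
(* The tail of F is absorbed by the term of index r: since [m ord_max] is 0, that monomial is a pure
   r-th power of the last variable and divides the tail, leaving one more factor ['X_ord_max]. *)
pose F1 := \sum_(i | S i) 'X_[E i - E i0] * W ^+ ex i ord_max * phi (g i) +
  'X_[E ord_max - E i0] * W ^+ ex ord_max ord_max * phi ('X_ord_max * rest).
have phiF : phi F = 'X_[E i0] * F1.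
  rewrite F_eq rmorphD rmorph_sum /= mulrDr mulr_sumr; congr (_ + _).
    apply: eq_bigr => i Si; rewrite rmorphM /= phiM !mulrA -mpolyXD addmC submK ?Ele //.
  rewrite exprSr -mulrA rmorphM /= !mulrA -mpolyXD addmC submK ?Ele // -phiM.
  by rewrite /Mm m_max add0m -mpolyXn.
(* Each old variable has positive value, so its expression in the new ones involves a variable other
   than the last, and vanishes on the last axis. *)
have LAphi P : last_axis (phi P) = (P@_0%MM)%:P.
  have := @eq_mpoly_rmorph _ _ _ (@last_axis k n \o phi) (polyC \o mcoeff 0%MM).
  apply=> [c|i] /=; first by rewrite [phi _]mmapC last_axisC mcoeffC eqxx mulr1.
  rewrite [phi _]msubstX mcoeff0X /subst_var.
  have [j [jm Aij]] : exists j, j != ord_max /\ A i j != 0.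
    apply: contrapT => no; have := u_pos i.
    rewrite -[v (u i)]/(t i) -[t i]mval_delta (mval_change _ _ hm) -rowE.
    rewrite /mval (bigD1 ord_max) //= [mact B t _]tmax mul0rz add0r big1 ?ltxx // => j jm.
    rewrite mxE; case: (eqVneq (A i j) 0) => [->|ne]; first by rewrite mulr0z.
    by case: no; exists j.
  rewrite rmorph_prod (bigD1 j) //= rmorphXn /= /shift_var (negbTE jm) addr0 last_axisX.
  by rewrite (negbTE jm) expr0n absz_eq0 (negbTE Aij) mul0r.
have LAW : last_axis W = 'X + alpha%:P.
  by rewrite /W /shift_var eqxx rmorphD /= last_axisX eqxx last_axisC.
have LAF1 : last_axis F1 =
    \sum_(i | S i && (E i == E i0)) (g i)@_0%MM *: ('X + alpha%:P) ^+ ex i ord_max.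
  have Emax i : (E i - E i0)%MM ord_max = 0%N by rewrite mnmBE !mnmE eqxx.
  have Xr0 : ('X_ord_max * rest)@_0%MM = 0.
    by rewrite [LHS](rmorphM (mcoeff 0%MM)) /= mcoeff0X mul0r.
  rewrite /F1 rmorphD rmorphM /= LAphi Xr0 mulr0 addr0.
  rewrite rmorph_sum (bigID (fun i => E i == E i0)) /= [X in _ + X]big1 ?addr0.
    apply: eq_bigr => i /andP[Si /eqP ei].
    rewrite !rmorphM rmorphXn /= LAphi LAW last_axis_mnm ?Emax // ei.
    have -> : (E i0 - E i0)%MM = 0%MM by apply/mnmP => j; rewrite mnmBE subnn mnm0E.
    by rewrite eqxx mul1r mulrC mul_polyC.
  move=> i /andP[Si ei]; rewrite !rmorphM /= last_axis_mnm ?Emax //.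
  case: eqP => [e0|_]; last by rewrite !mul0r.
  by case/eqP: ei; rewrite -(submK (Ele i Si)) e0 add0m.
have [LA0 LAlt] : last_axis F1 != 0 /\ (mup 0 (last_axis F1) < r)%N.
  rewrite LAF1; apply: shifted_powers_order => //.
  - by exists i0; rewrite S_i0 eqxx.
  - by move=> i /andP[Si _]; exact: g_unit.
  - move=> i j /andP[Si /eqP ei] /andP[Sj /eqP ej] eij.
    have [a h1 h2] := rel2 i j Si Sj ei ej; apply/val_inj/eqP; rewrite -eqz_nat -subr_eq0 h1.
    move: h2; rewrite eij subrr => /esym/(congr1 ( *%R^~ e)).
    by rewrite -mulrA ee mulr1 mul0r => ->; rewrite mul0r.
  - move=> i j /andP[Si /eqP ei] /andP[Sj /eqP ej].
    have [a h1 h2] := rel2 i j Si Sj ei ej.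
    have := gap Si Sj (Eeq i Si ei) (Eeq j Sj ej) h1; move: h2 ee; clear; nia.
have [l [f' [eF1 ndW]]] := linear_power_factor (- alpha) LA0.
have WE : W = 'X_ord_max - (- alpha)%:MP by rewrite /W /shift_var eqxx mpolyCN opprK.
rewrite -WE in eF1 ndW.
have LAf' : last_axis F1 = ('X + alpha%:P) ^+ l * last_axis f'.
  by rewrite eF1 rmorphM rmorphXn /= LAW.
have LAf'0 : last_axis f' != 0 by apply: contraNneq LA0 => h; rewrite LAf' h mulr0.
have f'0 : f' != 0 by apply: contraNneq LAf'0 => ->; rewrite rmorph0.
have shiftE j : shift_var alpha j = 'X_j - (if j == ord_max then - alpha else 0)%:MP.
  by rewrite /shift_var; case: eqP => _; [rewrite mpolyCN opprK | rewrite mpolyC0 subr0 addr0].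
have shift0 j : shift_var alpha j != 0.
  rewrite shiftE; apply/eqP => /(congr1 (mcoeff U_(j)%MM)); rewrite mcoeffB mcoeffXU eqxx.
  by rewrite mcoeffC mnm1_eq0 mulr0 subr0 mcoeff0 => /eqP; rewrite oner_eq0.
have ndshift j : ~ divides (shift_var alpha j) f'.
  have [->|jm] := eqVneq j ord_max; first exact: ndW.
  case=> q eq; case/eqP: LAf'0; rewrite eq rmorphM /= /shift_var (negbTE jm) addr0.
  by rewrite last_axisX (negbTE jm) mulr0.
(* The factors that can be cancelled modulo f'. The shifted variables are prime and do not divide
   f', so they and their products are of this kind. *)
pose good (mu : T) := forall P, divides f' (mu * P) -> divides f' P.
have good1 : good 1 by move=> P; rewrite mul1r.
have goodM a b : good a -> good b -> good (a * b).
  by move=> ga gb P; rewrite -mulrA => /ga /gb.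
have goodX a i : good a -> good (a ^+ i).
  by move=> ga; elim: i => [|i IH]; rewrite ?expr0 // exprS; apply: goodM.
have good_shift j : good (shift_var alpha j).
  move=> P; apply: prime_cancel; [|exact: shift0|exact: ndshift].
  by move=> x y; rewrite shiftE; exact: linear_prime.
have good_phi (N : 'X_{1..n.+1}) : good (phi 'X_[N]).
  rewrite [phi _](msubst_mnm alpha hm).
  by elim/big_ind: _ => // j _; exact/goodX/good_shift.
have f'F : divides f' (phi F).
  by exists ('X_[E i0] * W ^+ l); rewrite phiF eF1 mulrA.
have ev0 : mmap pic u' ('X_[E i0] * W ^+ l) != 0.
  have WN i : mmap pic u' (shift_var alpha i) != 0.
    by rewrite (eval_shift_var B alpha pic u) w0.
  rewrite rmorphM rmorphXn /= mulf_neq0 //; last by rewrite expf_neq0 // WN.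
  rewrite mpolyXE_id rmorph_prod /=; apply/prodf_neq0 => i _; rewrite rmorphXn /= mnmE.
  have [im|im] := eqVneq i ord_max; first by rewrite expr0 oner_eq0.
  by have := WN i; rewrite {1}/shift_var (negbTE im) addr0 => h; rewrite expf_neq0.
have kerf' P : mmap pic u' P = 0 <-> divides f' P.
  have f'ker : mmap pic u' f' = 0.
    have : mmap pic u' (phi F) = 0 by rewrite phiu; apply/kerF; exists 1; rewrite mul1r.
    rewrite phiF eF1 mulrA rmorphM => /eqP; rewrite mulf_eq0 (negbTE ev0) => /eqP //.
  split=> [P0|[q ->]]; last by rewrite [LHS]rmorphM [X in _ * X]f'ker mulr0.
  (* Multiplied by a monomial, P comes from the old coordinates, where the kernel is generated by F.
     Then f' divides the transform of F, and the transformed monomial is cancelled. *)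
  have [N [P' eP']] := clear_denominators B alpha (@cst k n.+1) xi0 P.
  have P'0 : mmap pic u P' = 0.
    have h1 := residue_psubst pqf P' xi_res.
    have h2 := residue_fM pqf (residue_psubst pqf 'X_[N] xi_res) (residue_psubst pqf P x'res).
    rewrite [psubst xi 'X_[N] * _]eP' in h2.
    by rewrite (residue_f_fun pqf h1 h2) [X in _ * X]P0 mulr0.
  have [C eC] := (kerF P').1 P'0.
  apply: (good_phi N); have -> : phi 'X_[N] * P = phi C * phi F.
    apply: x'i; rewrite -rmorphM -eC phix -[RHS]eP'; rewrite [LHS]rmorphM; congr (_ * _).
    exact: phix.
  by have [q ->] := f'F; exists (phi C * q); rewrite mulrA.
have f'irr : irreducible_elt f'.
  exact: (kernel_irreducible (h := mmap pic u')) f'0 kerf'.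
have ord' : has_ord (last_axis f') (mup 0 (last_axis f')) by split.
apply: (order_drop_intro pqf v_c x'i x'vars x'res u'pos f'irr kerf' ord').
apply: leq_ltn_trans LAlt; rewrite mup_geq // LAf' dvdp_mull //.
by rewrite -mup_geq.
Qed.
End Transform.

(** * Order reduction *)

Lemma coef_mup0 (F : fieldType) (p : {poly F}) : p != 0 -> p`_(mup 0 p) != 0.
Proof.
move=> p0; have := leqnn (mup 0 p); rewrite mup_geq // subr0 => /dvdpP[q eq].
apply/eqP; rewrite {1}eq coefMXn ltnn subnn => q0.
have := leqnn (mup 0 p); rewrite [in X in X -> _]mup_leq // subr0 => /negP; apply.
rewrite {2}eq exprS dvdp_mul //.
by rewrite -['X]subr0 dvdp_XsubCl rootE horner_coef0 q0.
Qed.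

Section RelationGenerator.
Variables (n : nat) (G : ordAbGroupType) (t : 'I_n.+1 -> G) (D0 : pred 'I_n.+1).
Let D := [pred i | D0 i || (i == ord_max)].
Hypothesis t_indep : independent D0 t.

Lemma supported_last c : supported D c -> c 0 ord_max = 0 -> supported D0 c.
Proof.
move=> cD cmax i iD; have [->//|im] := eqVneq i ord_max.
by apply: cD; rewrite negb_or iD im.
Qed.

(** Take a relation whose last entry is positive and least. The remainder of any other relation
    modulo it has last entry 0, so it is supported on D0 and vanishes by independence. *)
Lemma relation_generator c1 : supported D c1 -> mval t c1 = 0 -> c1 0 ord_max != 0 ->
  exists c0, [/\ supported D c0, c0 != 0, mval t c0 = 0, 0 < c0 0 ord_max &
    forall c, supported D c -> mval t c = 0 -> exists a : int, c = a *: c0].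
Proof.
move=> c1D c1r c1max.
pose P e := `[< exists c, [/\ supported D c, mval t c = 0 & c 0 ord_max = e.+1%:Z] >].
have exP : exists e, P e.
  exists `|c1 0%R ord_max|.-1; apply/asboolP.
  have e : `|c1 0%R ord_max|.-1.+1 = `|c1 0%R ord_max|%N by rewrite prednK // absz_gt0.
  rewrite e; have [h|h] := leP 0 (c1 0 ord_max); first by exists c1; rewrite gez0_abs.
  exists (- c1); rewrite mvalN c1r oppr0 mxE ltz0_abs //; split=> //; exact: supportedN.
case: (ex_minnP exP) => e /asboolP[c0 [c0D c0r c0e]] min_e.
have c0max : 0 < c0 0 ord_max by rewrite c0e.
exists c0; split=> //; first by apply: contraTneq c0max => ->; rewrite mxE ltxx.
move=> c cD cr; pose q := (c 0%R ord_max %/ c0 0%R ord_max)%Z; exists q.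
pose d := c - q *: c0.
have dD : supported D d.
  by move=> i iD; rewrite !mxE cD // c0D // mulr0 subr0.
have dr : mval t d = 0 by rewrite mvalB mvalZ cr c0r mul0rz subr0.
have dmax : d 0 ord_max = (c 0%R ord_max %% c0 0%R ord_max)%Z.
  by rewrite !mxE {1}(divz_eq (c 0 ord_max) (c0 0 ord_max)) addrC addKr.
have dmax0 : d 0 ord_max = 0.
  apply/eqP; apply: contraT => ne.
  have ge0 : 0 <= d 0 ord_max by rewrite dmax modz_ge0 // gt_eqF.
  have lt : d 0 ord_max < e.+1%:Z by rewrite dmax -c0e ltz_pmod.
  have : (e <= `|d 0%R ord_max|.-1)%N.
    apply: min_e; apply/asboolP; exists d; split=> //.
    by rewrite prednK ?absz_gt0 // gez0_abs.
  by move: ne ge0 lt; clear; lia.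
by apply/eqP; rewrite -subr_eq0 -/d (t_indep (supported_last dD dmax0) dr).
Qed.

End RelationGenerator.

(* Two terms of a vanishing sum have the same value. *)
Lemma root_value_torsion (F : fieldType) (L : fieldExtType F) (G : ordAbGroupType)
    (w : prevaluation L G) (p : {poly F}) (x : L) :
  p != 0 -> x != 0 -> (map_poly (GRing.in_alg L) p).[x] = 0 ->
  exists (m : nat) (b : F), b != 0 /\ w x *+ m.+1 = w b%:A.
Proof.
move=> p0 x0 px; pose E i : L := (p`_i)%:A * x ^+ i.
pose s := [seq i <- iota 0 (size p) | p`_i != 0].
have E0 i : i \in s -> E i != 0.
  by rewrite mem_filter => /andP[pi _]; rewrite mulf_neq0 ?expf_neq0 // in_alg_eq0.
have sE : \sum_(i <- s) E i = 0.
  transitivity (map_poly (GRing.in_alg L) p).[x]; last exact: px.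
  rewrite (@horner_coef_wide _ (size p)) ?size_map_poly //.
  rewrite -(big_mkord xpredT (fun i => (map_poly (GRing.in_alg L) p)`_i * x ^+ i)).
  rewrite big_filter /index_iota subn0 [RHS](bigID (fun i => p`_i != 0)) /= [X in _ + X]big1 ?addr0.
    by apply: eq_bigr => i _; rewrite coef_map.
  by move=> i /negbNE /eqP pi; rewrite coef_map /= pi scale0r mul0r.
have s0 : s != [::].
  have : (size p).-1 \in s.
    rewrite mem_filter mem_iota /= -lead_coefE lead_coef_eq0 p0 add0n.
    by rewrite prednK ?leqnn // size_poly_gt0.
  by case: s {E0 sE}.
have us : uniq s by rewrite filter_uniq // iota_uniq.
have [[i [j [si sj lt eij]]]|no] := pselect (exists i j,
    [/\ i \in s, j \in s, (i < j)%N & w (E i) = w (E j)]).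
  have pi : p`_i != 0 by move: si; rewrite mem_filter => /andP[].
  have pj : p`_j != 0 by move: sj; rewrite mem_filter => /andP[].
  exists (j - i).-1, (p`_i / p`_j); split; first by rewrite mulf_neq0 ?invr_eq0.
  rewrite prednK ?subn_gt0 // mulrnBr 1?ltnW // -!prevalX //.
  rewrite -[(p`_i / p`_j)%:A]/(GRing.in_alg L _) fmorph_div /= prevalM ?invr_eq0 ?in_alg_eq0 //.
  rewrite prevalV ?in_alg_eq0 //; move: eij; rewrite /E !prevalM ?in_alg_eq0 ?expf_neq0 // => e.
  by apply/eqP; rewrite subr_eq addrAC eq_sym subr_eq e addrC.
case: (@preval_sum_distinct _ _ w _ s E) => //; last first.
  by move=> i []; rewrite sE eqxx.
move=> i j si sj e; have [//|ne] := eqVneq i j; case: no.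
by case: (ltngtP i j) ne => // lt _; [exists i, j | exists j, i].
Qed.

(* If w x > w (p'(x)) then p'(x) and p_1 have the same value. *)
Lemma deriv_dominates (F : fieldType) (G : ordAbGroupType) (w : prevaluation F G)
    (p : {poly F}) (x : F) :
  (forall i, vge w 0 p`_i) -> vgt w 0 x -> x != 0 -> p^`().[x] != 0 ->
  vgt w (w p^`().[x]) x ->
  p`_1 != 0 /\ forall i, (1 < i)%N -> p`_i != 0 -> w (p`_1 * x) < w (p`_i * x ^+ i).
Proof.
move=> pV x_gt0 x0 th0 th_lt.
have dV i : vge w 0 p^`()`_i.
  rewrite coef_deriv -mulr_natr vge0M //.
  by elim: (i.+1) => [|m IH]; [exact: vge0 | rewrite -natr1 vgeD // vge1].
have xV : vge w 0 x by exact: vgtW.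
have eth : p^`().[x] = p`_1 + \sum_(i < size p^`()) p^`()`_(lift ord0 i) * x ^+ i.+1.
  rewrite (@horner_coef_wide _ (size p^`()).+1 _ x) ?leqnSn // big_ord_recl expr0 mulr1.
  by rewrite coef_deriv mulr1n.
have close : vgt w (w p^`().[x]) (p^`().[x] - p`_1).
  rewrite [X in vgt _ _ (X - _)]eth addrAC subrr add0r; apply: vgt_sum => i _.
  rewrite exprS mulrCA -[w _]addr0; apply: vgtM => //.
  by rewrite vge0M ?vge0X.
have [p1 wp1] := preval_eq_close th0 close.
split=> // -[|[|i]] // _ pi0.
have lt : w (p`_1) < w x by rewrite wp1 -vgt_nz.
(* Hence the term of degree i + 2 has value at least 2 w x, which exceeds w (p_1 x) because w p_1 <
   w x. *)
have : vge w 0 (p`_i.+2 * x ^+ i) by rewrite vge0M ?vge0X.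
rewrite vge_nz ?mulf_neq0 ?expf_neq0 // => h.
have -> : p`_i.+2 * x ^+ i.+2 = (p`_i.+2 * x ^+ i) * x * x by rewrite !exprSr !mulrA.
rewrite !prevalM ?mulf_neq0 ?expf_neq0 // oglt_add2r -prevalM ?expf_neq0 //.
by apply: lt_le_trans lt _; rewrite -[X in X <= _]add0r ogle_add2r.
Qed.

Section OrderReduction.
Variables (k : closedFieldType) (n : nat) (f : {mpoly k[n.+1]}).
Variables (Ks : fieldExtType {fraction {mpoly k[n]}}) (pi : {rmorphism {mpoly k[n.+1]} -> Ks}).
Hypothesis pqf : presents_quotient_field f pi.
Hypothesis f_monic : muni f \is monic.
Variables (G : ordAbGroupType) (v : valuation Ks G).
Hypothesis v_c : trivial_on v (fun c : k => pi c%:MP).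
Hypothesis v_res : residue_field_is v (fun c : k => pi c%:MP).
Notation A := {mpoly k[n]}.
Notation K := {fraction A}.
Local Notation alg := (GRing.in_alg Ks).
Local Notation widen := (widen_ord (leqnSn n)).
Local Notation pic := (pic pi).
Let z : Ks := pi 'X_ord_max.
Let pv := preval_of v.
Let vK : prevaluation K G := preval_comp alg pv.
Hypothesis vars_pos : forall i, vgt vK 0 (vars k i).

Lemma base_vgt g (x : K) : vgt vK g x = vgt pv g x%:A.
Proof. by rewrite /vgt in_alg_eq0. Qed.

Lemma base_vge g (x : K) : vge vK g x = vge pv g x%:A.
Proof. by rewrite /vge in_alg_eq0. Qed.

Lemma base_val (x : K) : pv x%:A = vK x. Proof. by []. Qed.

Lemma base_cst c : c != 0 -> vK (cst n c) = 0.
Proof. by move=> c0; exact: etrans (congr1 v (esym (pic_cst pqf c))) (v_c c0). Qed.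

Lemma mval_extend_row (t : 'I_n.+1 -> G) (c : 'rV[int]_n.+1) :
  mval t c = mval (t \o widen) (\row_j c 0 (widen j)) + t ord_max *~ c 0 ord_max.
Proof.
rewrite /mval big_ord_recr; congr (_ + _).
by apply: eq_bigr => j _; rewrite mxE.
Qed.

Lemma mnm_row_widen (m : 'X_{1..n}) i :
  mnm_row (mnmwiden m) 0 i = extend (fun j => (m j)%:Z) 0 i.
Proof.
rewrite mxE; case: (ord_widen_max i) => [->|[j ->]].
  by rewrite mnmwiden_ordmax extend_max.
by rewrite mnmwiden_widen extend_widen.
Qed.

Lemma unmuni_split (p : {poly A}) r : exists rest, unmuni p =
  \sum_(i < r.+1 | p`_i != 0) mwiden p`_i * 'X_ord_max ^+ i + 'X_ord_max ^+ r.+1 * rest.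
Proof.
exists (unmuni (drop_poly r.+1 p)); rewrite {1}/unmuni -{1}(poly_take_drop r.+1 p).
rewrite rmorphD rmorphM /= map_polyXn hornerD hornerM hornerXn mulrC; congr (_ + _).
rewrite (@horner_coef_wide _ r.+1); last by rewrite (leq_trans (size_poly _ _)) // size_take_poly.
rewrite [RHS]big_mkcond; apply: eq_bigr => i _ /=.
rewrite coef_map /= coef_take_poly ltn_ord; case: eqP => [->|//].
by rewrite rmorph0 mul0r.
Qed.

Section MonomialCoefficients.
Variables (y : 'I_n -> K) (H : A) (D : pred 'I_n) (Fp : {poly A}) (r : nat).
Let Z := z - (psubst y H)%:A.
Hypothesis fy : frame vK y.
Hypothesis Z0 : Z != 0.
Hypothesis Zpos : 0 < v Z.
Hypothesis D_indep : independent D (vK \o y).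
Hypothesis D_span : forall x, x != 0 -> exists (m : nat) (c : 'rV[int]_n),
  supported D c /\ vK x *+ m.+1 = mval (vK \o y) c.
Hypothesis Fp_monic : Fp \is monic.
Hypothesis Fp_size : size Fp = size (muni f).
Hypothesis FpE : map_poly (psubst y) Fp = shifted f (psubst y H).
Hypothesis r_gt1 : (1 < r)%N.
Hypothesis Fp_r : (Fp`_r)@_0%MM != 0.
Hypothesis Fp_factor : forall i, (i <= r)%N -> Fp`_i != 0 -> exists m g,
  [/\ supported D (mnm_row m), g@_0%MM != 0 & Fp`_i = 'X_[m] * g].
Let kappa i : Ks := (psubst y Fp`_i)%:A.
(** The two cases of the dichotomy for z: v Z is not a value of K, or the linear term has smaller
    value than every later one. *)
Hypothesis gap : (forall b, b != 0 -> v Z <> vK b) \/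
  kappa 1 != 0 /\ forall i, (1 < i)%N -> kappa i != 0 -> v (kappa 1 * Z) < v (kappa i * Z ^+ i).

Let u := extend (fun j => (y j)%:A) Z.
Let t i := v (u i).
Let D0 : pred 'I_n.+1 := extend D false.

Lemma t_row c : mval t c = mval (vK \o y) (\row_j c 0 (widen j)) + v Z *~ c 0 ord_max.
Proof.
rewrite mval_extend_row /t /u extend_max; congr (_ + _).
by apply: eq_bigr => j _; rewrite /= extend_widen.
Qed.

Lemma D0_indep : independent D0 t.
Proof.
move=> c cD ct; have cmax : c 0 ord_max = 0 by apply: cD; rewrite /D0 extend_max.
have c0 : \row_j c 0 (widen j) = 0.
  apply: D_indep; first by move=> j jD; rewrite mxE cD // /D0 extend_widen.
  by move: ct; rewrite t_row cmax mulr0z addr0.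
apply/rowP => i; rewrite mxE; case: (ord_widen_max i) => [->//|[j ->]].
by have /rowP/(_ j) := c0; rewrite !mxE.
Qed.

(** Z is algebraic over K, so a positive multiple of v Z is the value of some b in K, and a further
    multiple is a combination of the values of the variables in D. *)
Lemma last_relation : exists c, [/\ supported [pred i | D0 i || (i == ord_max)] c,
  mval t c = 0 & c 0 ord_max != 0].
Proof.
have Fp0 : map_poly (psubst y) Fp != 0.
  apply: contraTneq Fp_r => e.
  have := congr1 (fun p : {poly K} => p`_r) e; rewrite coef_map coef0 -(rmorph0 (psubst y)).
  by move/(frame_indep fy) => ->; rewrite mcoeff0 eqxx.
have root : (map_poly alg (map_poly (psubst y) Fp)).[Z] = 0.
  have ker := frame_kernel pqf f_monic (frame_indep fy) Fp_monic Fp_size FpE.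
  have := (ker (unmuni Fp)).2 (ex_intro _ 1 (esym (mul1r _))).
  by rewrite (eval_extend pqf) unmuniK.
have [m [b [b0 eb]]] := @root_value_torsion _ _ _ pv _ _ Fp0 Z0 root.
have [l [c [cD ec]]] := D_span b0.
exists (\row_i extend (fun j => - c 0 j) (m.+1 * l.+1)%N%:Z i); split.
- move=> i; rewrite negb_or mxE => /andP[]; case: (ord_widen_max i) => [->|[j ->]].
    by rewrite eqxx.
  by rewrite /D0 !extend_widen => /cD -> _; rewrite oppr0.
- rewrite t_row mxE extend_max -pmulrn mulrnA [v Z *+ _]eb [v _ *+ _]ec.
  have -> : \row_j (\row_i extend (fun j => - c 0 j) (m.+1 * l.+1)%N%:Z i) 0 (widen j) = - c.
    by apply/rowP => j; rewrite !mxE extend_widen.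
  by rewrite mvalN addNr.
- by rewrite mxE extend_max.
Qed.

Lemma kappa0 i : (kappa i == 0) = (Fp`_i == 0).
Proof.
rewrite in_alg_eq0; apply/eqP/eqP => [|->]; last by rewrite rmorph0.
by rewrite -(rmorph0 (psubst y)) => /(frame_indep fy).
Qed.

Lemma monomial_value i m g : g@_0%MM != 0 -> Fp`_i = 'X_[m] * g ->
  v (kappa i * Z ^+ i) = mval t (mnm_row (mnmwiden m + U_(ord_max) *+ i)%MM).
Proof.
move=> g0 e; have y0 j : y j != 0 := frame_neq0 j fy.
have [pg0 vg] := frame_unit base_cst fy g0.
have eX : psubst y 'X_[m] = laurent y (mnm_row m) by rewrite -mmap1_laurent /psubst mmapX.
have pX0 : psubst y 'X_[m] != 0 by rewrite eX; exact: laurent_neq0.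
have eM : psubst y Fp`_i = psubst y 'X_[m] * psubst y g by rewrite e; exact: rmorphM.
have p0 : psubst y Fp`_i != 0 by rewrite eM; exact: mulf_neq0 pX0 pg0.
have vp : vK (psubst y Fp`_i) = mval (vK \o y) (mnm_row m).
  by rewrite eM (prevalM vK pX0 pg0) vg addr0 eX; exact: preval_laurent.
have k0 : kappa i != 0 by rewrite in_alg_eq0; exact: p0.
pose e' := (mnmwiden m + U_(ord_max) *+ i)%MM.
have erow : mnm_row m = \row_j mnm_row e' 0 (widen j).
  apply/rowP => j; rewrite !mxE mnmDE mulmnE mnm1E mnmwiden_widen.
  case: eqP => [/(congr1 val) /= ej|_]; first by have := ltn_ord j; rewrite -ej ltnn.
  by rewrite mul0n addn0.
have elast : mnm_row e' 0 ord_max = i.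
  by rewrite mxE mnmDE mulmnE mnm1E eqxx mul1n mnmwiden_ordmax add0n.
rewrite t_row elast -erow.
transitivity (pv (kappa i) + pv (Z ^+ i)); first exact: (prevalM pv k0 (expf_neq0 i Z0)).
by rewrite base_val vp (prevalX pv i Z0).
Qed.

Lemma monomial_coefficients_drop : order_drop f pi v r.
Proof.
have [c1 [c1D c1r c1max]] := last_relation.
have D0_max : ~~ D0 ord_max by rewrite /D0 extend_max.
have [c0 [c0D c00 c0r c0pos c0gen]] := relation_generator D0_indep c1D c1r c1max.
have [rest Fp_split] := unmuni_split Fp r.
pose S : pred 'I_r.+1 := [pred i : 'I_r.+1 | Fp`_i != 0].
have /choice[mg mgP] : forall i : 'I_r.+1, exists mg : 'X_{1..n} * A, Fp`_i != 0 ->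
    [/\ supported D (mnm_row mg.1), mg.2@_0%MM != 0 & Fp`_i = 'X_[mg.1] * mg.2].
  move=> i; have [e|e] := eqVneq (Fp`_i) 0; first by exists (0%MM, 0).
  by have [m [g h]] := Fp_factor (ltn_ord i : i <= r)%N e; exists (m, g).
pose m i := mnmwiden (mg i).1; pose g i := mwiden (mg i).2.
pose M (i : 'I_r.+1) := mnm_row (m i + U_(ord_max) *+ i)%MM.
have valM i : S i -> v (kappa i * Z ^+ i) = mval t (M i).
  by move=> /mgP[_ h1 h2]; exact: monomial_value h1 h2.
have S_max : S ord_max by apply: contraNneq Fp_r => /= ->; rewrite mcoeff0.
have [i0 Si0 i0_min] := 
  @og_argmin G 'I_r.+1 S (fun i => mval t (M i)) (ex_intro (fun i => is_true (S i)) _ S_max).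
have u0 i : u i != 0.
  rewrite /u; case: (ord_widen_max i) => [->|[j ->]]; first by rewrite extend_max.
  by rewrite extend_widen in_alg_eq0 (frame_neq0 j fy).
have u_pos i : 0 < v (u i).
  rewrite /u; case: (ord_widen_max i) => [->|[j ->]]; first by rewrite extend_max.
  by rewrite extend_widen; exact: (frame_gt0 j fy).
refine (@perron_transform k n f Ks pi pqf G v v_c v_res (xi y H) u (unmuni Fp)
  (xi_indep (frame_indep fy)) (xi_vars H fy) (xi_residue pqf y H) u0 u_pos
  (frame_kernel pqf f_monic (frame_indep fy) Fp_monic Fp_size FpE)
  D0 c0 D0_max c0D c00 c0r c0gen r S m g rest _ _ _ S_max _ i0 Si0 i0_min _).
- rewrite Fp_split; congr (_ + _); apply: eq_bigr => i /mgP[_ _ e].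
  by rewrite {1}e rmorphM /= mwidenX mulrAC mpolyXD mpolyXn.
- move=> i /mgP[iD _ _] j jD; rewrite mnm_row_widen; move: jD; rewrite /D0.
  case: (ord_widen_max j) => [->|[l ->]]; first by rewrite !extend_max.
  by rewrite !extend_widen => /iD; rewrite mxE.
- by move=> i /mgP[_ h _]; rewrite /g -mnmwiden0 mwiden_mnmwiden.
- have [_ _ e] := mgP _ S_max; rewrite /m; suff -> : (mg ord_max).1 = 0%MM by rewrite mnmwiden0.
  apply/eqP; apply: contraNT Fp_r => ne.
  rewrite [Fp`_r]e [_@__](rmorphM (mcoeff 0%MM)) /= mcoeffX (negbTE ne) mul0r //.
move=> i j a Si Sj ei ej eij; case: gap => [caseA|[k1 caseB]].
  (* If the last entry of the generator were 1, v Z would be the value of a Laurent monomial in y.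
     So it is at least 2, and |a| <= |i - j| / 2 <= r / 2 < r. *)
  have e0 : c0 0 ord_max != 1.
    apply/eqP => e; pose c : 'rV[int]_n := - \row_j c0 0 (widen j).
    have y0 j' : y j' != 0 := frame_neq0 j' fy.
    apply: (caseA (laurent y c)); first by rewrite laurent_neq0.
    rewrite preval_laurent // /c mvalN; move: c0r; rewrite t_row e mulr1z => /eqP.
    by rewrite addrC addr_eq0 => /eqP.
  have := ltn_ord i; have := ltn_ord j; move: eij e0 c0pos r_gt1.
  move: (c0 0 ord_max) (nat_of_ord i) (nat_of_ord j); clear; nia.
(* Beyond index 1 every term is beaten by the linear one, so |i - j| <= 1 and |a| <= 1 < r. *)
have small l : S l -> mval t (M l) = mval t (M i0) -> (l <= 1)%N.
  move=> Sl el; rewrite leqNgt; apply/negP => l1.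
  have r1 : (1 < r.+1)%N by rewrite ltnW.
  have S1 : S (Ordinal r1) by rewrite /S /= -kappa0.
  have kl : kappa l != 0 by rewrite kappa0.
  have := caseB l l1 kl; rewrite (valM l Sl) el ogltNge => /negP; apply.
  by have := i0_min _ S1; rewrite -(valM _ S1) expr1.
have := small i Si ei; have := small j Sj ej; move: eij c0pos r_gt1.
move: (c0 0 ord_max) (nat_of_ord i) (nat_of_ord j); clear; nia.
Qed.

End MonomialCoefficients.
Variables (R : realType) (rho : {additive G -> R}).
Hypothesis rho_inj : injective rho.
Hypothesis elu : ELU n.
Variable r : nat.
Hypothesis r_gt1 : (1 < r)%N.
Hypothesis f_ord : has_ord (last_axis f) r.

Lemma base_residue x : vge vK 0 x -> exists c, vgt vK 0 (x - cst n c).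
Proof.
rewrite base_vge => /v_res[c [hc _]]; exists c.
have e : (x - cst n c)%:A = x%:A - pic c by rewrite (pic_cst pqf) scalerBl.
by rewrite base_vgt e; exact: hc.
Qed.

Let theta : Ks := (map_poly alg (base_poly f))^`().[z].

(** ELU is applied to the product of the nonzero coefficients of f(X + b) up to degree r. [Fp] and
    [Fq] are the same polynomial over K, written in the frames y and y1, so every factor becomes a
    monomial times a unit in the new frame. *)
Lemma frame_order_drop (y : 'I_n -> K) (H : A) (b : K) :
  frame vK y -> b = psubst y H -> z - b%:A != 0 -> vgt pv 0 (z - b%:A) -> vgt vK 0 b ->
  (forall b', b' != 0 -> v (z - b%:A) <> vK b') \/
    theta != 0 /\ vgt pv (v theta) (z - b%:A) ->
  order_drop f pi v r.
Proof.
move=> fy eb Z0 Zpos bpos gap.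
have H0 : H@_0%MM = 0 by apply/eqP; rewrite -(frame_vgtE base_cst H fy) -eb.
have [Fp [Fp_monic Fp_size FpE Fp0]] := frame_poly f_monic base_cst vars_pos fy H0.
rewrite -eb in FpE.
have FpE_coef i : psubst y Fp`_i = (shifted f b)`_i.
  by have := congr1 (fun p : {poly K} => p`_i) FpE; rewrite coef_map.
pose P := \prod_(i < r.+1 | Fp`_i != 0) Fp`_i.
have P0 : P != 0 by apply/prodf_neq0.
have [y1 [D [fy1 sub D_indep D_span [m [g1 [mD g1u eP]]]]]] :=
  ELU_frame base_cst base_residue rho_inj elu fy P0.
have [H1 eb1] := sub b (ex_intro _ H eb).
have H10 : H1@_0%MM = 0 by apply/eqP; rewrite -(frame_vgtE base_cst H1 fy1) -eb1.
have [Fq [Fq_monic Fq_size FqE Fq0]] := frame_poly f_monic base_cst vars_pos fy1 H10.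
have FqE_coef i : psubst y1 Fq`_i = (shifted f b)`_i.
  by have := congr1 (fun p : {poly K} => p`_i) FqE; rewrite coef_map -eb1.
have Fq_neq0 i : Fq`_i != 0 -> Fp`_i != 0.
  apply: contraNneq => e; apply/eqP; apply: (frame_indep fy1).
  by rewrite FqE_coef -FpE_coef e [LHS]rmorph0 [RHS]rmorph0.
have eQ : \prod_(i < r.+1 | Fp`_i != 0) Fq`_i = 'X_[m] * g1.
  apply: (frame_indep fy1); rewrite -eP [LHS]rmorph_prod [RHS]rmorph_prod.
  by apply: eq_bigr => i _; exact: etrans (FqE_coef i) (esym (FpE_coef i)).
(* On the last axis [Fq] still restricts to f, of order r, so its coefficient of degree r is a unit
   at the origin. *)
have Fq_r : (Fq`_r)@_0%MM != 0.
  have [l0 <-] := f_ord; have := coef_mup0 l0; rewrite -{1}Fq0 coef_map //.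
have Fq_factor i : (i <= r)%N -> Fq`_i != 0 -> exists m g,
    [/\ supported D (mnm_row m), g@_0%MM != 0 & Fq`_i = 'X_[m] * g].
  move=> ir qi; move: eQ; rewrite (bigD1 (Ordinal (ir : (i < r.+1)%N))) ?Fq_neq0 //= => eQ.
  have [m' [g [le gu e]]] := monomial_factor eQ g1u.
  exists m', g; split=> //; last exact/vars_idealN.
  move=> j jD; have := mD j jD; rewrite !mxE => -[mj]; congr (Posz _); apply/eqP.
  by have /mnm_lepP/(_ j) := le; rewrite mj leqn0.
have gap' : (forall b', b' != 0 -> v (z - b%:A) <> vK b') \/
    ((shifted f b)`_1)%:A != 0 :> Ks /\ forall i, (1 < i)%N -> ((shifted f b)`_i)%:A != 0 :> Ks ->
    v (((shifted f b)`_1)%:A * (z - b%:A)) < v (((shifted f b)`_i)%:A * (z - b%:A) ^+ i).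
  case: gap => [caseA|[th0 caseB]]; [by left | right].
  have := @deriv_dominates _ _ pv (map_poly alg (shifted f b)) (z - b%:A).
  rewrite (shifted_deriv f pi b) => dom.
  have [|p1 dom'] := dom _ Zpos Z0 th0 caseB.
    move=> i; rewrite coef_map -base_vge -FqE_coef.
    exact: (mmap_vge base_cst (frame_pos fy1)).
  rewrite coef_map in p1; split=> // i i1 pi0.
  by have := dom' i i1; rewrite !coef_map; apply.
have Zpos' : 0 < v (z - b%:A) by move: Zpos; rewrite vgt_nz.
clear FpE eb gap Zpos bpos FpE_coef.
move: Z0 Zpos' gap' FqE_coef; rewrite eb1 => Z0 Zpos gap FqE_coef.
apply: (monomial_coefficients_drop fy1 Z0 Zpos D_indep D_span Fq_monic Fq_size FqE r_gt1 Fq_r Fq_factor).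
case: gap => [caseA|[k1 caseB]]; [by left | right].
by rewrite FqE_coef; split=> // i; rewrite FqE_coef; exact: caseB.
Qed.

End OrderReduction.

Theorem theorem7p1 (R : realType) (k : closedFieldType) (n : nat)
    (f : {mpoly k[n.+1]})
    (Kstar : fieldExtType {fraction {mpoly k[n]}})
    (pi : {rmorphism {mpoly k[n.+1]} -> Kstar})
    (G : ordAbGroupType) (v : valuation Kstar G) (r : nat) :
  irreducible_elt f ->
  muni f \is monic ->
  presents_quotient_field f pi ->
  separable 1 {:Kstar} ->
  trivial_on v (fun c : k => pi c%:MP) ->
  rank_one G R ->
  (forall g, vring v (pi g)) ->
  residue_field_is v (fun c : k => pi c%:MP) ->
  (forall g, vmax v (pi g) <-> vars_ideal g) ->
  ELU n ->
  has_ord (last_axis f) r ->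
  (1 < r)%N ->
  has_defect v 0 ->
  exists x' : 'I_n.+1 -> {fraction {mpoly k[n.+1]}},
    [/\ alg_indep x',
        birational_ext (poly_subring (@vars k n.+1)) (poly_subring x'),
        along pi v f x',
        center_is_origin pi v f x' &
        exists f' : {mpoly k[n.+1]},
          [/\ strict_transform f x' f',
              birational_ext (residue_subring pi) (image_subring pi f x') &
              exists2 r' : nat, has_ord (last_axis f') r' & (r' < r)%N]].
Proof.
move=> f_irr f_monic pqf sep v_c rk v_ring v_res center elu [l0 lr] r_gt1 defect.
pose z : Kstar := pi 'X_ord_max; pose pv := preval_of v.
pose vK : prevaluation {fraction {mpoly k[n]}} G := preval_comp (GRing.in_alg Kstar) pv.
have archG := archimedean_rank_one rk.
have [gn0 [rho rho_le]] := rk.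
have rho_inj : injective rho by move=> a b e; apply/le_anti; rewrite !rho_le e lexx.
have vars_pos i : vgt vK 0 (vars k i).
  rewrite base_vgt -(pqf_base pqf); apply/(center _)/vars_idealE.
  by rewrite /mwiden mmapU mcoeff0X.
have z_pos : vgt pv 0 z by apply/(center _)/vars_idealE; exact: mcoeff0X.
(* A nonzero coefficient of degree r >= 2 forces degree at least 2, hence z is not in K and z - b
   never vanishes. *)
have sz : (2 < size (muni f))%N.
  apply: leq_ltn_trans r_gt1 _; rewrite ltnNge; apply/negP => le.
  by have := coef_mup0 l0; rewrite lr last_axisE coef_map nth_default // raddf0 eqxx.
have zb b : z - b%:A != 0 by rewrite subr_eq0; exact: (base_not_root pqf f_monic).
have theta0 := base_poly_deriv pqf f_monic sep.
set theta := _.[_] in theta0.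
(* b is replaced by a polynomial in a frame, at a distance of value greater than v (z - b); this
   leaves the value of z - b, hence both alternatives, unchanged. *)
have close b : vgt pv 0 (z - b%:A) -> (forall b', b' != 0 -> v (z - b%:A) <> vK b') \/
    vgt pv (v theta) (z - b%:A) -> order_drop f pi v r.
  move=> zb_pos gap; have sub_pos c : vgt pv 0 (z - c%:A) -> vgt vK 0 c.
    by move=> h; rewrite base_vgt -[c%:A](subKr z) vgtB.
  have vars_frame : frame vK (@vars k n).
    split=> // [P Q|i]; last by exists 'X_i; rewrite psubstX.
    by rewrite !psubst_vars => /eqP; rewrite tofrac_eq => /eqP.
  have [y [H [fy _ approx]]] := frame_approx (base_cst pqf v_c) (base_residue pqf v_res)
    rho_inj archG elu (v (z - b%:A)) vars_frame (sub_pos b zb_pos).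
  have [_ vb] : z - (psubst y H)%:A != 0 /\ pv (z - (psubst y H)%:A) = pv (z - b%:A).
    apply: preval_eq_close => //.
    have e c : z - b%:A - (z - c) = - (b%:A - c) by ring.
    by rewrite e vgtN -scalerBl -base_vgt.
  have vgt_b g : vgt pv g (z - (psubst y H)%:A) = vgt pv g (z - b%:A).
    by rewrite (vgt_nz pv g (zb (psubst y H))) (vgt_nz pv g (zb b)) vb.
  have [h eh] : exists h, h = psubst y H by exists (psubst y H).
  rewrite -eh in vb vgt_b.
  have h_pos : vgt pv 0 (z - h%:A) by rewrite vgt_b.
  apply: (frame_order_drop pqf f_monic v_c v_res vars_pos rho_inj elu r_gt1 (conj l0 lr) fy
    eh (zb h) h_pos (sub_pos h h_pos)).
  case: gap => gap; [left => b' b'0; rewrite [v _]vb; exact: gap | by right; rewrite vgt_b].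
have v_cst c : c != 0 -> v (cst n c)%:A = 0.
  by move=> c0; exact: etrans (congr1 v (esym (pic_cst pqf c))) (v_c c c0).
have res x : vring v x -> exists c, vmax v (x - (cst n c)%:A).
  by move=> /v_res[c [hc _]]; exists c; rewrite -(pic_cst pqf).
have [[b [_ caseA]]|caseB] := defectless_dichotomy v_cst res archG gn0 defect z.
  apply: (close b); last by left.
  have [b0|b0] := eqVneq b 0; first by rewrite b0 scale0r subr0.
  (* If z - b had value at most 0, then, as z has positive value, this value would be that of -b,
     which case A excludes. *)
  rewrite vgtNge //; apply/negP => le.
  have [_ e] : - b%:A != 0 :> Kstar /\ pv (- b%:A) = pv (z - b%:A).
    by apply: preval_eq_close => //; rewrite addrK; exact: vgt_le z_pos.
  by apply: (caseA b b0); rewrite -[LHS]e prevalN.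
(* The precision must exceed both 0, to keep z - b in the maximal ideal, and v theta, to compare
   with the derivative. *)
have [g g_ge0 g_ge] : exists2 g, 0 <= g & v theta <= g.
  by case/orP: (ogle_total 0 (v theta)) => h; [exists (v theta) | exists 0].
have [b hb] := caseB g.
by apply: (close b); [exact: vgt_le hb | right; exact: vgt_le hb].
Qed.
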